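(* Let $0<\alpha<1$ and consider the problem described in the context with the specific heat $c$ unknown (Case 1), the data $k,\rho,\ell>0$, $T_m$, $T_0>T_m$, $q_0>0$ being given. If $$\frac{k\rho\ell(T_0-T_m)\,\Gamma\left(1+\frac{\alpha}{2}\right)}{q_0^2\,\Gamma\left(1-\frac{\alpha}{2}\right)}<1,$$ then the equation $$\frac{1-W\left(-x;-\frac{\alpha}{2},1\right)}{x}=\frac{k\rho\ell(T_0-T_m)\,\Gamma\left(1+\frac{\alpha}{2}\right)}{q_0^2\,\Gamma^3\left(1-\frac{\alpha}{2}\right)}\,\frac{1}{M_{\alpha/2}(x)},\quad x>0,$$ has a unique solution $\xi_\alpha>0$, and the solution of Case 1 is given by $$c=c_\alpha=\frac{\ell\,\Gamma\left(1+\frac{\alpha}{2}\right)}{(T_0-T_m)\,\Gamma\left(1-\frac{\alpha}{2}\right)}\,\frac{\xi_\alpha}{M_{\alpha/2}(\xi_\alpha)}\left[1-W\left(-\xi_\alpha;-\frac{\alpha}{2},1\right)\right],$$ $$T_\alpha(x,t)=T_0-\frac{T_0-T_m}{1-W\left(-\xi_\alpha;-\frac{\alpha}{2},1\right)}\left[1-W\left(-\frac{x}{\lambda_\alpha t^{\alpha/2}};-\frac{\alpha}{2},1\right)\right],\qquad s_\alpha(t)=\lambda_\alpha\xi_\alpha t^{\alpha/2},$$ where $$\lambda_\alpha^2=\frac{k}{\rho c_\alpha}=\frac{k(T_0-T_m)\,\Gamma\left(1-\frac{\alpha}{2}\right)}{\rho\ell\,\Gamma\left(1+\frac{\alpha}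{2}\right)}\,\frac{M_{\alpha/2}(\xi_\alpha)}{\xi_\alpha\left[1-W\left(-\xi_\alpha;-\frac{\alpha}{2},1\right)\right]}.$$
   Context: For $0<\alpha<1$ the Caputo fractional derivative of a function $f$ of $t$ is $D^\alpha f(t)=\frac{1}{\Gamma(1-\alpha)}\int_0^t \frac{f'(\tau)}{(t-\tau)^\alpha}\,d\tau$, where $\Gamma$ is Euler's Gamma function. The Wright function is $W(z;a,b)=\sum_{n=0}^{\infty}\frac{z^n}{n!\,\Gamma(na+b)}$ for $z\in\mathbb{C}$, $a>-1$, $b\in\mathbb{R}$; the Mainardi function is $M_\nu(z)=W(-z;-\nu,1-\nu)$ for $\nu<1$. The problem: $\rho,k,c,\ell$ are positive constants (density, conductivity, specific heat, latent heat), $\lambda^2=k/(\rho c)$, $T_m$ is the melting temperature, $T_0>T_m$ and $q_0>0$ are constants. Find $x=s(t)$, $T=T(x,t)$ and the unknown coefficient such that: $D^\alpha T=\lambda^2 T_{xx}$ for $0<x<s(t)$, $t>0$ (Caputo derivative in $t$); $s(0)=0$; $T(x,0)=T(+\infty,t)=T_m$ for $x>0,t>0$; $T(s(t),t)=T_m$; $-kT_x(s(t),t)=\rho\ell\, D^\alpha s(t)$; $T(0,t)=T_0$; $kT_x(0,t)=-q_0/t^{\alpha/2}$, for all $t>0$.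
   Formalization: The displayed T does not tend to T_m as x→+∞ or t→0, so T(x,0)=T(+∞,t)=T_m is imposed on T replaced by T_m for x≥s(t), while D^α T uses the displayed formula for all past times; the formulas are shown to solve the problem, with uniqueness only for ξ. *)

(* Defs.v *)
From Stdlib Require Import Reals Factorial.
From Coquelicot Require Import Coquelicot.
Open Scope R_scope.

(* Real power with the convention 0^a = 0 (used with a > 0 at t >= 0). *)
Definition rpow (t a : R) : R := if Rlt_dec 0 t then Rpower t a else 0.

Definition Gamma (x : R) : R :=
  RInt_gen (fun t => Rpower t (x - 1) * exp (- t)) (at_right 0) (Rbar_locally p_infty).

(* Reciprocal Gamma 1/Gamma(x) on all of R (entire function, = 0 at the poles
   0,-1,-2,...), via  1/Gamma(x) = x (x+1) ... (x+n-1) / Gamma(x+n),  x+n > 0.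
   For x > 0 one has n = 0 and rgamma x = 1 / Gamma x. *)
Definition rgamma (x : R) : R :=
  let n := Z.to_nat (up (- x)) in
  (fix P (m : nat) : R := match m with O => 1 | S m' => P m' * (x + INR m') end) n
  / Gamma (x + INR n).

Definition Wright (z a b : R) : R :=
  Series (fun n => z ^ n / INR (Factorial.fact n) * rgamma (INR n * a + b)).

Definition Mainardi (nu z : R) : R := Wright (- z) (- nu) (1 - nu).

Definition is_caputo (alpha : R) (f : R -> R) (t v : R) : Prop :=
  (forall tau, 0 < tau < t -> ex_derive f tau) /\
  is_RInt_gen (fun tau => Derive f tau * Rpower (t - tau) (- alpha))
    (at_right 0) (at_left t) (v * Gamma (1 - alpha)).

(* Full temperature: liquid temperature T in 0 <= x < s(t), melting temperature
   T_m in the solid region x >= s(t). *)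
Definition temp_ext (T : R -> R -> R) (s : R -> R) (Tm x t : R) : R :=
  if Rlt_dec x (s t) then T x t else Tm.

Definition stefan_solution (alpha k rho c l Tm T0 q0 : R)
  (T : R -> R -> R) (s : R -> R) : Prop :=
  (forall t x, 0 < t -> 0 < x < s t ->
     (forall y, 0 < y < s t -> ex_derive (fun z => T z t) y) /\
     exists D2, is_derive (fun y => Derive (fun z => T z t) y) x D2 /\
       is_caputo alpha (fun tau => T x tau) t (k / (rho * c) * D2)) /\
  s 0 = 0 /\
  (forall x, 0 < x -> temp_ext T s Tm x 0 = Tm) /\
  (forall t, 0 < t -> is_lim (fun x => temp_ext T s Tm x t) p_infty Tm) /\
  (forall t, 0 < t -> T (s t) t = Tm) /\
  (forall t, 0 < t -> exists Tx Ds,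
     is_derive (fun z => T z t) (s t) Tx /\ is_caputo alpha s t Ds /\
     - k * Tx = rho * l * Ds) /\
  (forall t, 0 < t -> T 0 t = T0) /\
  (forall t, 0 < t -> exists Tx,
     is_derive (fun z => T z t) 0 Tx /\ k * Tx = - q0 / rpow t (alpha / 2)).

(* Main.v *)
Require Import Defs.
From Stdlib Require Import Reals ZArith Lra Lia.
From Coquelicot Require Import Coquelicot.
Open Scope R_scope.

(** Put [nu = alpha/2 < 1/2] and let [c(a,n)] be the coefficient of [z^n] in [(1-z)^(-a)].  By
    Gauss's product formula [n^(1-a) c(a,n) -> 1/Gamma(a)] for every real [a], so by Tannery's theorem
    [n^(1-b)] times the coefficient of [z^n] in [(1-z)^(-b) exp(- y n^nu (1-z)^nu)] tends to
    [W(-y;-nu,b)].  These coefficients are nonnegative for [b >= 0], hence so is [W(-y;-nu,b)]; since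
    [d/dy W(-y;-nu,b) = - W(-y;-nu,b-nu)] and [1 - 2 nu > 0], the function [M = M_nu] is nonnegative and
    decreasing, strictly because it is entire and not constant.  Then [M(x) (1 - W(-x)) / x] decreases
    strictly from [1/Gamma(1-nu)^2] to [0], which gives existence and uniqueness of [xi].

    For the fractional heat equation one needs
    [int_0^1 f(tau) (1-tau)^(-2 nu) dtau = Gamma(1-2nu) W(-y;-nu,1-2nu)] with
    [f = d/dtau W(-y tau^(-nu);-nu,1)].  Its discrete counterpart is Vandermonde's identity (multiplication
    by [(1-z)^(-mu)]), and the passage to the limit is a comparison with Riemann-Stieltjes sums in which
    only pointwise limits at the nodes [i/p] are used.  The same limit with [c(nu,k)] in place of the
    stable coefficients is Euler's Beta integral, which gives the Caputo derivative of [t^nu]. *)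

(** Why discretise: the density [f] expands in powers [tau^(-j nu - 1)] with [j >= 1], which are not
    integrable at [0], so the fractional integral cannot be taken term by term. Before the passage
    to the limit the same operation is a finite sum of convergent series, where the exchange is
    free. The price is a bound on [n^(1-a) c(a,n)] uniform in [n], with explicit growth as
    [a = b - j nu] tends to minus infinity. The bound [gcoef_majorant] has size [18^m (2m+1)!] with
    [m] about [j nu]; it is crude, but the [j!] of the Wright series still beats it because
    [2 nu < 1]. The needed asymptotics of Gamma all come from its functional equation and the single
    inequality [Gamma (x + s) <= x^s Gamma x] for [0 <= s <= 1]. *)

(** * The Gamma integral *)

(* Coquelicot states many equations at a structure sort convertible to [R], which [ring] does not see through. *)
Ltac real_eq := match goal with |- ?a = ?b => change (@eq R a b) end.

Lemma Rpower_pos (x y : R) : 0 < Rpower x y.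
Proof. apply exp_pos. Qed.

Lemma Rpower_ge_0 (x y : R) : 0 <= Rpower x y.
Proof. left; apply exp_pos. Qed.

Lemma is_derive_Rpower (a x : R) :
  0 < x -> is_derive (fun t => Rpower t a) x (a * Rpower x (a - 1)).
Proof.
intros Hx; unfold Rpower; auto_derive; [exact Hx|].
replace ((a - 1) * ln x) with (a * ln x + - ln x) by ring.
rewrite exp_plus, exp_Ropp, exp_ln by exact Hx; field; lra.
Qed.

Lemma continuous_Rpower (a x : R) : 0 < x -> continuous (fun t => Rpower t a) x.
Proof.
intros Hx; apply (ex_derive_continuous (fun t => Rpower t a)).
eexists; apply is_derive_Rpower, Hx.
Qed.

Lemma Rpower_le_1 (x a : R) : 0 < x <= 1 -> 0 <= a -> Rpower x a <= 1.
Proof.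
intros Hx Ha; unfold Rpower; rewrite <- exp_0.
destruct (Rle_lt_or_eq_dec (a * ln x) 0) as [H|H].
- assert (ln x <= 0) by (rewrite <- ln_1; destruct (proj2 Hx) as [H|H];
    [left; apply ln_increasing; lra | rewrite H; lra]); nra.
- left; apply exp_increasing, H.
- rewrite H; lra.
Qed.

Lemma Rpower_Rinv_l (x a : R) : 0 < x -> Rpower (/ x) a = Rpower x (- a).
Proof. intros Hx; unfold Rpower; rewrite ln_Rinv by exact Hx; f_equal; ring. Qed.

Lemma Rpower_le_base_neg (x y a : R) :
  0 < x <= y -> a <= 0 -> Rpower y a <= Rpower x a.
Proof.
intros Hx Ha; replace a with (- - a) by ring.
rewrite !(Rpower_Ropp _ (- a)).
apply Rinv_le_contravar; [apply Rpower_pos|apply Rle_Rpower_l; lra].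
Qed.

(* Bernoulli's inequality, from [exp w >= 1 + w] at [w = (1 - s) ln z] and [w = - s ln z]. *)
Lemma Rpower_le_tangent (z s : R) : 0 < z -> 0 <= s <= 1 -> Rpower z s <= s * z + (1 - s).
Proof.
intros Hz Hs.
pose proof (exp_ineq1_le ((1 - s) * ln z)) as H1.
pose proof (exp_ineq1_le (- (s * ln z))) as H2.
assert (E1 : exp ((1 - s) * ln z) * Rpower z s = z).
{ unfold Rpower; rewrite <- exp_plus.
  replace ((1 - s) * ln z + s * ln z) with (ln z) by ring; apply exp_ln, Hz. }
assert (E2 : exp (- (s * ln z)) * Rpower z s = 1).
{ unfold Rpower; rewrite <- exp_plus, Rplus_opp_l; apply exp_0. }
pose proof (Rpower_pos z s) as HA.
set (A := Rpower z s) in *.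
rewrite <- E1 at 1; rewrite <- E2 at 2.
assert (1 <= s * exp ((1 - s) * ln z) + (1 - s) * exp (- (s * ln z))) by nra.
nra.
Qed.

(** * Criteria for improper integrals *)

Lemma is_RInt_gen_eps (f : R -> R) (Fa Fb : (R -> Prop) -> Prop) (V : R) :
  Filter Fa -> Filter Fb ->
  (forall eps : posreal, filter_prod Fa Fb
     (fun ab => exists I, is_RInt f (fst ab) (snd ab) I /\ Rabs (I - V) < eps)) ->
  is_RInt_gen f Fa Fb V.
Proof.
intros HFa HFb H P [eps HP]; unfold filtermapi.
apply filter_imp with (2 := H eps).
intros ab [I [HI Hd]]; exists I; split; [exact HI|apply HP, Hd].
Qed.

Lemma is_RInt_gen_antiderivative (F f : R -> R) (Fa Fb : (R -> Prop) -> Prop) (la lb : R) :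
  Filter Fa -> Filter Fb ->
  filter_prod Fa Fb (fun ab => forall x,
    Rmin (fst ab) (snd ab) <= x <= Rmax (fst ab) (snd ab) ->
    is_derive F x (f x) /\ continuous f x) ->
  filterlim F Fa (locally la) -> filterlim F Fb (locally lb) ->
  is_RInt_gen f Fa Fb (lb - la).
Proof.
intros HFa HFb H Ha Hb; apply is_RInt_gen_eps; [exact HFa|exact HFb|].
intros eps.
assert (Ha' : Fa (fun x => Rabs (F x - la) < eps / 2)).
{ apply (Ha (fun y => Rabs (y - la) < eps / 2)).
  exists (mkposreal _ (is_pos_div_2 eps)); intros y Hy; exact Hy. }
assert (Hb' : Fb (fun x => Rabs (F x - lb) < eps / 2)).
{ apply (Hb (fun y => Rabs (y - lb) < eps / 2)).
  exists (mkposreal _ (is_pos_div_2 eps)); intros y Hy; exact Hy. }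
assert (Hab : filter_prod Fa Fb (fun ab =>
    Rabs (F (fst ab) - la) < eps / 2 /\ Rabs (F (snd ab) - lb) < eps / 2)).
{ econstructor; [exact Ha'|exact Hb'|]; simpl; auto. }
apply filter_imp with (2 := filter_and _ _ H Hab).
intros [u v] [H1 [H2 H3]]; simpl in *; exists (F v - F u); split.
- apply (is_RInt_derive (V:=R_CompleteNormedModule) F f); intros x Hx; apply H1, Hx.
- replace (F v - F u - (lb - la)) with ((F v - lb) - (F u - la)) by ring.
  eapply Rle_lt_trans; [apply Rabs_triang|]; rewrite Rabs_Ropp; lra.
Qed.

Lemma RInt_le_of_subinterval (f : R -> R) (a u v b : R) :
  a <= u <= v -> v <= b -> ex_RInt f a b -> (forall x, a <= x <= b -> 0 <= f x) ->
  RInt f u v <= RInt f a b.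
Proof.
intros H1 H2 Hex Hf.
assert (Hau : ex_RInt f a u) by (apply (ex_RInt_Chasles_1 (V:=R_CompleteNormedModule)) with b; [lra|exact Hex]).
assert (Hub : ex_RInt f u b) by (apply (ex_RInt_Chasles_2 (V:=R_CompleteNormedModule)) with a; [lra|exact Hex]).
assert (Huv : ex_RInt f u v) by (apply (ex_RInt_Chasles_1 (V:=R_CompleteNormedModule)) with b; [lra|exact Hub]).
assert (Hvb : ex_RInt f v b) by (apply (ex_RInt_Chasles_2 (V:=R_CompleteNormedModule)) with u; [lra|exact Hub]).
rewrite <- (RInt_Chasles f a u b Hau Hub), <- (RInt_Chasles f u v b Huv Hvb).
assert (0 <= RInt f a u) by (apply RInt_ge_0; [lra|exact Hau|intros; apply Hf; lra]).
assert (0 <= RInt f v b) by (apply RInt_ge_0; [lra|exact Hvb|intros; apply Hf; lra]).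
unfold plus; simpl; lra.
Qed.

(** For a nonnegative integrand the integral grows with the interval, so convergence along the
    filters needs only an upper bound [V] and, for each [eps], one interval that comes within [eps]
    of it. *)
Lemma is_RInt_gen_nonneg (f : R -> R) (I : R -> Prop) (Fa Fb : (R -> Prop) -> Prop) (V : R) :
  Filter Fa -> Filter Fb ->
  (forall u v x, I u -> I v -> u <= x <= v -> 0 <= f x) ->
  (forall u v, I u -> I v -> u <= v -> ex_RInt f u v /\ RInt f u v <= V) ->
  (forall eps, 0 < eps -> exists u v, u <= v /\ V - eps < RInt f u v /\
     filter_prod Fa Fb (fun ab => I (fst ab) /\ I (snd ab) /\ fst ab <= u /\ v <= snd ab)) ->
  is_RInt_gen f Fa Fb V.
Proof.
intros HFa HFb Hpos Hle Hge; apply is_RInt_gen_eps; [exact HFa|exact HFb|].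
intros eps; destruct (Hge eps (cond_pos eps)) as (u & v & Huv & HV & Hf).
apply filter_imp with (2 := Hf); intros [a b] (Ha & Hb & Hau & Hvb); simpl in *.
destruct (Hle a b Ha Hb) as [Hex HV']; [lra|].
exists (RInt f a b); split; [apply (RInt_correct (V:=R_CompleteNormedModule)); exact Hex|].
assert (RInt f u v <= RInt f a b).
{ apply RInt_le_of_subinterval; try lra; [exact Hex|]; intros; apply (Hpos a b); auto. }
apply Rabs_def1; lra.
Qed.

(** * Convergence of the Gamma integral, functional equation and positivity *)

Definition gamma_density (x t : R) : R := Rpower t (x - 1) * exp (- t).

Lemma gamma_density_pos (x t : R) : 0 < gamma_density x t.
Proof. apply Rmult_lt_0_compat; apply exp_pos. Qed.

Lemma continuous_gamma_density (x t : R) : 0 < t -> continuous (gamma_density x) t.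
Proof.
intros Ht; apply (continuous_mult (K:=R_AbsRing)); [apply continuous_Rpower, Ht|].
apply (ex_derive_continuous (V:=R_NormedModule)); auto_derive; exact Logic.I.
Qed.

Lemma ex_RInt_of_continuous_pos (f : R -> R) (u v : R) :
  0 < u -> 0 < v -> (forall t, 0 < t -> continuous f t) -> ex_RInt f u v.
Proof.
intros Hu Hv Hf; apply (ex_RInt_continuous (V:=R_CompleteNormedModule)); intros z Hz; apply Hf.
apply Rlt_le_trans with (2 := proj1 Hz); apply Rmin_glb_lt; assumption.
Qed.

(** This is [ln z <= z - 1] at [z = (1 + t) / (x + 1)]. The exponent [x + 1] is chosen because
    [t^(x-1) (1+t)^(-(x+1))] has the elementary primitive [(t / (1+t))^x / x], which is bounded on
    the half-line. *)
Lemma gamma_density_tail (x t : R) :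
  0 < x -> 0 < t ->
  exp (- t) <= exp (1 + (x + 1) * ln (x + 1)) * Rpower (1 + t) (- (x + 1)).
Proof.
intros Hx Ht; unfold Rpower; rewrite <- exp_plus.
assert (H : ln (1 + t) <= (1 + t) / (x + 1) - 1 + ln (x + 1)).
{ pose proof (exp_ineq1_le (ln ((1 + t) / (x + 1)))) as H.
  assert (0 < (1 + t) / (x + 1)) by (apply Rdiv_lt_0_compat; lra).
  rewrite exp_ln in H by assumption.
  rewrite ln_div in H by lra; lra. }
assert (H2 : (x + 1) * ln (1 + t) <= 1 + t - (x + 1) + (x + 1) * ln (x + 1)).
{ apply Rmult_le_compat_l with (r := x + 1) in H; [|lra].
  replace ((x + 1) * ((1 + t) / (x + 1) - 1 + ln (x + 1)))
    with (1 + t - (x + 1) + (x + 1) * ln (x + 1)) in H by (field; lra).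
  exact H. }
destruct (Rle_lt_or_eq_dec (- t) (1 + (x + 1) * ln (x + 1) + - (x + 1) * ln (1 + t))) as [H3|H3];
  [lra|left; apply exp_increasing, H3|right; f_equal; exact H3].
Qed.

Lemma RInt_gamma_density_bounded (x : R) :
  0 < x -> exists B, forall u v, 0 < u -> u <= v -> RInt (gamma_density x) u v <= B.
Proof.
intros Hx; set (K := exp (1 + (x + 1) * ln (x + 1))).
assert (HK : 0 < K) by apply exp_pos.
exists (K / x); intros u v Hu Huv.
set (G := fun t => K / x * Rpower (t / (1 + t)) x).
set (g := fun t => K * (Rpower t (x - 1) * Rpower (1 + t) (- (x + 1)))).
assert (HG : forall t, 0 < t -> is_derive G t (g t)).
{ intros t Ht; unfold G, g, Rpower.
  auto_derive; [split; [lra|split; [|exact Logic.I]]; apply Rdiv_lt_0_compat; lra|].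
  rewrite <- exp_plus.
  replace ((x - 1) * ln t + - (x + 1) * ln (1 + t))
    with (x * (ln t - ln (1 + t)) + (- ln t + - ln (1 + t))) by ring.
  change (t * / (1 + t)) with (t / (1 + t)); rewrite (ln_div t (1 + t)) by lra.
  rewrite !exp_plus, !exp_Ropp, !exp_ln by lra; field; lra. }
assert (Hc : forall t, 0 < t -> continuous g t).
{ intros t Ht; apply (continuous_mult (K:=R_AbsRing)); [apply continuous_const|].
  apply (continuous_mult (K:=R_AbsRing)); [apply continuous_Rpower, Ht|].
  apply (continuous_comp (fun t => 1 + t) (fun t => Rpower t (- (x + 1)))).
  - apply (ex_derive_continuous (V:=R_NormedModule)); auto_derive; exact Logic.I.
  - apply continuous_Rpower; lra. }
assert (Hg : is_RInt g u v (G v - G u)).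
{ apply (is_RInt_derive (V:=R_CompleteNormedModule) G g); intros t Ht;
    rewrite Rmin_left, Rmax_right in Ht by lra; [apply HG|apply Hc]; lra. }
apply Rle_trans with (RInt g u v).
- apply RInt_le; [exact Huv| | |].
  + apply ex_RInt_of_continuous_pos; [lra|lra|apply continuous_gamma_density].
  + eexists; exact Hg.
  + intros t Ht; unfold gamma_density, g.
    pose proof (gamma_density_tail x t Hx ltac:(lra)) as H; fold K in H.
    pose proof (Rpower_ge_0 t (x - 1)); nra.
- rewrite (is_RInt_unique _ _ _ _ Hg); unfold G.
  pose proof (Rpower_pos (u / (1 + u)) x).
  assert (Rpower (v / (1 + v)) x <= 1).
  { apply Rpower_le_1; [|lra]; split; [apply Rdiv_lt_0_compat; lra|].
    apply (Rmult_le_reg_r (1 + v)); [lra|]; field_simplify; lra. }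
  assert (0 < K / x) by (apply Rdiv_lt_0_compat; lra); nra.
Qed.

Lemma filter_at_right_le (a b : R) : a < b -> at_right a (fun x => a < x <= b).
Proof.
intros Hab; exists (mkposreal (b - a) ltac:(lra)); simpl; intros x Hx Hax.
change (Rabs (x - a) < b - a) in Hx; apply Rabs_def2 in Hx; lra.
Qed.

Lemma filter_at_left_ge (a b : R) : a < b -> at_left b (fun x => a <= x < b).
Proof.
intros Hab; exists (mkposreal (b - a) ltac:(lra)); simpl; intros x Hx Hax.
change (Rabs (x - b) < b - a) in Hx; apply Rabs_def2 in Hx; lra.
Qed.

Lemma is_RInt_gen_Gamma (x : R) :
  0 < x -> is_RInt_gen (gamma_density x) (at_right 0) (Rbar_locally p_infty) (Gamma x).
Proof.
intros Hx.
assert (H : exists V, is_RInt_gen (gamma_density x) (at_right 0) (Rbar_locally p_infty) V).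
{ destruct (RInt_gamma_density_bounded x Hx) as [B HB].
  destruct (completeness (fun r => exists u v, 0 < u /\ u <= v /\ r = RInt (gamma_density x) u v))
    as [V [HV1 HV2]].
  - exists B; intros r (u & v & Hu & Huv & ->); apply HB; assumption.
  - exists (RInt (gamma_density x) 1 1), 1, 1; repeat split; lra.
  - exists V; apply (is_RInt_gen_nonneg _ (fun t => 0 < t)); try typeclasses eauto.
    + intros u v t _ _ _; left; apply gamma_density_pos.
    + intros u v Hu Hv Huv; split.
      * apply ex_RInt_of_continuous_pos; [lra|lra|apply continuous_gamma_density].
      * apply HV1; exists u, v; auto.
    + intros eps Heps.
      destruct (Classical_Prop.classic (exists u v, 0 < u /\ u <= v /\
         V - eps < RInt (gamma_density x) u v)) as [(u & v & Hu & Huv & HI)|Hn].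
      * exists u, v; split; [exact Huv|split; [exact HI|]].
        exists (fun a => 0 < a <= u) (fun b => v < b).
        -- apply filter_at_right_le, Hu.
        -- exists v; auto.
        -- simpl; intros; lra.
      * exfalso; assert (V <= V - eps); [|lra].
        apply HV2; intros r (u & v & Hu & Huv & ->).
        apply Rnot_lt_le; intros HI; apply Hn; exists u, v; auto. }
destruct H as [V HV].
unfold Gamma; change (fun t : R => Rpower t (x - 1) * exp (- t)) with (gamma_density x).
rewrite (is_RInt_gen_unique _ _ HV); exact HV.
Qed.

Lemma filterlim_Rpower_exp_0 (x : R) :
  0 < x -> filterlim (fun t => Rpower t x * exp (- t)) (at_right 0) (locally 0).
Proof.
intros Hx P [eps HP].
exists (mkposreal (Rpower eps (/ x)) (Rpower_pos _ _)); simpl; intros t Ht Ht0; apply HP.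
change (Rabs (t - 0) < Rpower eps (/ x)) in Ht; rewrite Rminus_0_r, Rabs_pos_eq in Ht by lra.
change (Rabs (Rpower t x * exp (- t) - 0) < eps); rewrite Rminus_0_r, Rabs_pos_eq
  by (left; apply Rmult_lt_0_compat; apply exp_pos).
apply Rle_lt_trans with (Rpower t x).
- assert (exp (- t) <= 1) by (rewrite <- exp_0; left; apply exp_increasing; lra).
  pose proof (Rpower_pos t x); nra.
- replace (pos eps) with (Rpower (Rpower eps (/ x)) x).
  + apply Rlt_Rpower_l; lra.
  + rewrite Rpower_mult, Rinv_l, Rpower_1 by (try apply cond_pos; lra); reflexivity.
Qed.

Lemma filterlim_Rpower_exp_infty (x : R) :
  0 < x -> filterlim (fun t => Rpower t x * exp (- t)) (Rbar_locally p_infty) (locally 0).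
Proof.
intros Hx P [eps HP]; set (K := exp (1 + (x + 1) * ln (x + 1))).
assert (HK : 0 < K) by apply exp_pos.
exists (K / eps); intros t Ht; apply HP.
assert (H0 : 0 < K / eps) by (apply Rdiv_lt_0_compat; [exact HK|apply cond_pos]).
change (Rabs (Rpower t x * exp (- t) - 0) < eps); rewrite Rminus_0_r, Rabs_pos_eq
  by (left; apply Rmult_lt_0_compat; apply exp_pos).
pose proof (gamma_density_tail x t Hx ltac:(lra)) as H; fold K in H.
assert (H1 : Rpower t x <= Rpower (1 + t) x) by (apply Rle_Rpower_l; lra).
assert (H2 : Rpower (1 + t) x * Rpower (1 + t) (- (x + 1)) = / (1 + t)).
{ rewrite <- Rpower_plus; replace (x + - (x + 1)) with (- (1)) by ring.
  rewrite Rpower_Ropp, Rpower_1 by lra; reflexivity. }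
apply Rle_lt_trans with (K * / (1 + t)).
- rewrite <- H2.
  apply Rle_trans with (Rpower (1 + t) x * (K * Rpower (1 + t) (- (x + 1)))); [|right; ring].
  apply Rmult_le_compat; try assumption; left; apply exp_pos.
- apply (Rmult_lt_reg_r (1 + t)); [lra|].
  rewrite Rmult_assoc, Rinv_l, Rmult_1_r by lra.
  apply (Rmult_lt_compat_r eps) in Ht; [|apply cond_pos].
  replace (K / eps * eps) with K in Ht by (field; apply Rgt_not_eq, cond_pos).
  pose proof (cond_pos eps); nra.
Qed.

Lemma filter_prod_pos (P : R -> Prop) :
  (forall x, 0 < x -> P x) ->
  filter_prod (at_right 0) (Rbar_locally p_infty)
    (fun ab => forall x, Rmin (fst ab) (snd ab) <= x <= Rmax (fst ab) (snd ab) -> P x).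
Proof.
intros HP; exists (fun a => 0 < a <= 1) (fun b => 1 < b).
- apply filter_at_right_le; lra.
- exists 1; auto.
- simpl; intros a b Ha Hb x Hx; apply HP; rewrite Rmin_left in Hx; lra.
Qed.

(** Integration by parts: [t^x exp (-t)] vanishes at both ends, and its derivative is the difference
    of [x] times the density for [x] and the density for [x + 1]. *)
Lemma Gamma_S (x : R) : 0 < x -> Gamma (x + 1) = x * Gamma x.
Proof.
intros Hx.
assert (H1 : is_RInt_gen (fun t => x * gamma_density x t - gamma_density (x + 1) t)
  (at_right 0) (Rbar_locally p_infty) (0 - 0)).
{ apply (is_RInt_gen_antiderivative (fun t => Rpower t x * exp (- t))); try typeclasses eauto.
  - apply (filter_prod_pos (fun t =>
      is_derive (fun t => Rpower t x * exp (- t)) t (x * gamma_density x t - gamma_density (x + 1) t)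
      /\ continuous (fun t => x * gamma_density x t - gamma_density (x + 1) t) t)).
    intros t Ht; split.
    + unfold gamma_density; replace (x + 1 - 1) with x by ring.
      replace (x * (Rpower t (x - 1) * exp (- t)) - Rpower t x * exp (- t))
        with (plus (mult (x * Rpower t (x - 1)) (exp (- t))) (mult (Rpower t x) (- exp (- t))))
        by (unfold plus, mult; simpl; ring).
      apply (is_derive_mult (fun t => Rpower t x) (fun t => exp (- t))).
      * apply is_derive_Rpower, Ht.
      * auto_derive; [exact Logic.I|ring].
      * apply Rmult_comm.
    + apply (continuous_minus (V:=R_NormedModule)); [apply (continuous_mult (K:=R_AbsRing)); [apply continuous_const|]|];
        apply continuous_gamma_density, Ht.
  - apply filterlim_Rpower_exp_0, Hx.
  - apply filterlim_Rpower_exp_infty, Hx. }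
pose proof (is_RInt_gen_minus _ _ _ _ (is_RInt_gen_scal _ x _ (is_RInt_gen_Gamma x Hx)) H1) as H2.
assert (H3 : is_RInt_gen (gamma_density (x + 1)) (at_right 0) (Rbar_locally p_infty)
   (minus (scal x (Gamma x)) (0 - 0))).
{ apply is_RInt_gen_ext with (2 := H2).
  exists (fun _ => True) (fun _ => True); [apply filter_true|apply filter_true|].
  intros a b _ _ t _; unfold minus, scal, plus, opp; simpl; unfold mult; simpl; ring. }
pose proof (is_RInt_gen_Gamma (x + 1) ltac:(lra)) as H4.
rewrite <- (is_RInt_gen_unique _ _ H4), (is_RInt_gen_unique _ _ H3).
unfold minus, scal, plus, opp; simpl; unfold mult; simpl; ring.
Qed.

Lemma is_RInt_gen_le (f g : R -> R) (u v : R) :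
  (forall t, 0 < t -> 0 <= f t <= g t) ->
  is_RInt_gen f (at_right 0) (Rbar_locally p_infty) u ->
  is_RInt_gen g (at_right 0) (Rbar_locally p_infty) v -> 0 <= u <= v.
Proof.
intros H Hf Hg.
assert (Hle : filter_prod (at_right 0) (Rbar_locally p_infty) (fun ab => fst ab <= snd ab)).
{ exists (fun a => 0 < a <= 1) (fun b => 1 < b); [apply filter_at_right_le; lra|exists 1; auto|].
  simpl; intros; lra. }
assert (Hp : forall P : R -> Prop, (forall x, 0 < x -> P x) ->
  filter_prod (at_right 0) (Rbar_locally p_infty) (fun ab => forall x, fst ab <= x <= snd ab -> P x)).
{ intros P HP; exists (fun a => 0 < a <= 1) (fun b => 1 < b);
    [apply filter_at_right_le; lra|exists 1; auto|].
  simpl; intros a b Ha Hb x Hx; apply HP; lra. }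
(* Comparing [f] with itself in [RInt_gen_norm] gives the sign of [u]. *)
assert (H1 : Rabs u <= u).
{ apply (RInt_gen_norm f f u u Hle); [|exact Hf|exact Hf].
  apply (Hp (fun x => norm (f x) <= f x)).
  intros x Hx; right; apply Rabs_pos_eq, H, Hx. }
assert (H2 : Rabs u <= v).
{ apply (RInt_gen_norm f g u v Hle); [|exact Hf|exact Hg].
  apply (Hp (fun x => norm (f x) <= g x)).
  intros x Hx; change (Rabs (f x) <= g x); rewrite Rabs_pos_eq; apply H, Hx. }
pose proof (Rabs_pos u); pose proof (Rle_abs u); lra.
Qed.

Lemma Gamma_nonneg (x : R) : 0 < x -> 0 <= Gamma x.
Proof.
intros Hx; refine (proj1 (is_RInt_gen_le _ _ _ _ _ (is_RInt_gen_Gamma x Hx) (is_RInt_gen_Gamma x Hx))).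
intros t _; split; [left; apply gamma_density_pos|lra].
Qed.

Lemma Gamma_1 : Gamma 1 = 1.
Proof.
assert (H : is_RInt_gen (gamma_density 1) (at_right 0) (Rbar_locally p_infty) (0 - (-1))).
{ apply (is_RInt_gen_antiderivative (fun t => - exp (- t))); try typeclasses eauto.
  - apply (filter_prod_pos (fun t => is_derive (fun t => - exp (- t)) t (gamma_density 1 t)
      /\ continuous (gamma_density 1) t)).
    intros t Ht; split; [|apply continuous_gamma_density, Ht].
    unfold gamma_density; rewrite Rminus_diag, Rpower_O by exact Ht.
    auto_derive; [exact Logic.I|ring].
  - replace (-1) with (- exp (- 0)) by (rewrite Ropp_0, exp_0; ring).
    apply (filterlim_filter_le_1 (F := locally 0) _ (filter_le_within _)).
    apply (ex_derive_continuous (fun t => - exp (- t))); auto_derive; exact Logic.I.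
  - replace 0 with (- 0) by ring.
    apply (filterlim_comp _ _ _ (fun t => exp (- t)) Ropp _ (locally 0)); [|apply (filterlim_opp 0)].
    apply (is_lim_comp exp Ropp p_infty 0 m_infty).
    + apply is_lim_exp_m.
    + change m_infty with (Rbar_opp p_infty); apply is_lim_opp, is_lim_id.
    + exists 0; intros y _; discriminate. }
rewrite <- (is_RInt_gen_unique _ _ (is_RInt_gen_Gamma 1 Rlt_0_1)), (is_RInt_gen_unique _ _ H); ring.
Qed.

(* Integrates the tangent-line bound [t^s <= s x^(s-1) t + (1-s) x^s] against the Gamma density. *)
Lemma Gamma_le_Rpower (x s : R) :
  0 < x -> 0 <= s <= 1 -> Gamma (x + s) <= Rpower x s * Gamma x.
Proof.
intros Hx Hs.
pose proof (is_RInt_gen_Gamma (x + 1) ltac:(lra)) as H1.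
pose proof (is_RInt_gen_plus _ _ _ _
  (is_RInt_gen_scal _ (Rpower x s * s / x) _ H1)
  (is_RInt_gen_scal _ (Rpower x s * (1 - s)) _ (is_RInt_gen_Gamma x Hx))) as H.
clear H1.
assert (H0 : 0 < x + s) by lra.
apply is_RInt_gen_le with (2 := is_RInt_gen_Gamma (x + s) H0) in H.
- destruct H as [_ H]; unfold plus, scal in H; simpl in H; unfold mult in H; simpl in H.
  rewrite Gamma_S in H by exact Hx.
  replace (Rpower x s * Gamma x) with
    (Rpower x s * s / x * (x * Gamma x) + Rpower x s * (1 - s) * Gamma x) by (field; lra).
  exact H.
- intros t Ht; split; [left; apply gamma_density_pos|].
  unfold plus, scal; simpl; unfold mult; simpl; unfold gamma_density.
  replace (x + s - 1) with ((x - 1) + s) by ring.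
  replace (x + 1 - 1) with ((x - 1) + 1) by ring.
  rewrite !Rpower_plus, Rpower_1 by exact Ht.
  pose proof (Rpower_le_tangent (t / x) s ltac:(apply Rdiv_lt_0_compat; lra) Hs) as H1.
  assert (E : Rpower t s = Rpower x s * Rpower (t / x) s).
  { rewrite Rpower_mult_distr by (try apply Rdiv_lt_0_compat; lra); f_equal; field; lra. }
  rewrite E.
  replace (Rpower x s * s / x * (Rpower t (x - 1) * t * exp (- t)) +
           Rpower x s * (1 - s) * (Rpower t (x - 1) * exp (- t)))
    with (Rpower t (x - 1) * exp (- t) * Rpower x s * (s * (t / x) + (1 - s))) by (field; lra).
  replace (Rpower t (x - 1) * (Rpower x s * Rpower (t / x) s) * exp (- t))
    with (Rpower t (x - 1) * exp (- t) * Rpower x s * Rpower (t / x) s) by ring.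
  apply Rmult_le_compat_l; [|exact H1].
  left; repeat apply Rmult_lt_0_compat; apply exp_pos.
Qed.

(** A zero at [x] propagates to [x + 1] by the functional equation, and then, by [Gamma_le_Rpower]
    over a step of length at most [1], to an integer argument, where Gamma is at least [1]. *)
Lemma Gamma_pos (x : R) : 0 < x -> 0 < Gamma x.
Proof.
intros Hx; destruct (Gamma_nonneg x Hx) as [H|H]; [exact H|exfalso].
assert (Hn : forall n, Gamma (x + INR n) = 0).
{ induction n as [|n IH]; [simpl; rewrite Rplus_0_r; auto|].
  rewrite S_INR; replace (x + (INR n + 1)) with ((x + INR n) + 1) by ring.
  pose proof (pos_INR n); rewrite Gamma_S, IH by lra; ring. }
assert (Hm : forall n, Gamma (INR n + 1) >= 1).
{ induction n as [|n IH]; [simpl; rewrite Rplus_0_l, Gamma_1; lra|].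
  rewrite Gamma_S, S_INR by (pose proof (pos_INR (S n)); rewrite S_INR in *; pose proof (pos_INR n); lra).
  pose proof (pos_INR n); nra. }
destruct (archimed x) as [Hu1 Hu2].
set (n := Z.to_nat (up x)).
assert (Hup : INR n = IZR (up x)).
{ unfold n; rewrite INR_IZR_INZ, Z2Nat.id; [reflexivity|]; apply le_IZR; lra. }
pose proof (Hm n) as H1; pose proof (Hn 1%nat) as H2; simpl in H2.
pose proof (Gamma_le_Rpower (x + 1) (INR n - x)) as H3.
replace (x + 1 + (INR n - x)) with (INR n + 1) in H3 by ring.
rewrite H2, Rmult_0_r in H3; lra.
Qed.

(** * Gauss's product formula and bounds for binomial coefficients *)

Fixpoint rising (x : R) (n : nat) : R :=
  match n with O => 1 | S n' => rising x n' * (x + INR n') end.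

Lemma rising_S_l (x : R) (n : nat) : rising x (S n) = x * rising (x + 1) n.
Proof.
induction n as [|n IH]; [simpl; ring|].
change (rising x (S (S n))) with (rising x (S n) * (x + INR (S n))).
rewrite IH, S_INR; simpl; ring.
Qed.

Lemma rising_add (x : R) (m n : nat) : rising x (m + n) = rising x m * rising (x + INR m) n.
Proof.
induction n as [|n IH]; [rewrite Nat.add_0_r; simpl; ring|].
rewrite Nat.add_succ_r; simpl; rewrite IH, plus_INR; ring.
Qed.

Lemma Gamma_rising (x : R) (n : nat) : 0 < x -> Gamma (x + INR n) = rising x n * Gamma x.
Proof.
intros Hx; induction n as [|n IH]; [simpl; rewrite Rplus_0_r; ring|].
rewrite S_INR; replace (x + (INR n + 1)) with ((x + INR n) + 1) by ring.
rewrite Gamma_S, IH by (pose proof (pos_INR n); lra); simpl; ring.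
Qed.

Lemma Gamma_nat (n : nat) : Gamma (INR n + 1) = INR (Factorial.fact n).
Proof.
induction n as [|n IH]; [simpl; rewrite Rplus_0_l; apply Gamma_1|].
rewrite Gamma_S, S_INR, IH by (pose proof (pos_INR (S n)); rewrite S_INR in *; pose proof (pos_INR n); lra).
rewrite fact_simpl, mult_INR, S_INR; ring.
Qed.

(** The shift used inside [rgamma]; it brings every [x <= 1] into the interval [(0, 1]]. *)
Definition pole_index (x : R) : nat := Z.to_nat (up (- x)).

Lemma pole_index_gt (x : R) : 0 < x + INR (pole_index x).
Proof.
unfold pole_index; destruct (archimed (- x)) as [H1 H2].
destruct (Z_le_gt_dec 0 (up (- x))) as [H|H].
- rewrite INR_IZR_INZ, Z2Nat.id by exact H; lra.
- replace (Z.to_nat (up (- x))) with 0%nat by lia; apply Z.gt_lt, IZR_lt in H; simpl; lra.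
Qed.

Lemma pole_index_le (x : R) : x <= 1 -> x + INR (pole_index x) <= 1.
Proof.
intros Hx; unfold pole_index; destruct (archimed (- x)) as [H1 H2].
destruct (Z_le_gt_dec 0 (up (- x))) as [H|H].
- rewrite INR_IZR_INZ, Z2Nat.id by exact H; lra.
- replace (Z.to_nat (up (- x))) with 0%nat by lia; simpl; lra.
Qed.

Lemma pole_index_0 (x : R) : 0 < x -> pole_index x = 0%nat.
Proof.
intros Hx; unfold pole_index; destruct (archimed (- x)) as [H1 H2].
assert (up (- x) < 1)%Z by (apply lt_IZR; lra); lia.
Qed.

(** Two admissible shifts are both compared with their sum, where [Gamma_rising] cancels the
    additional factors. Later proofs can thus choose the shift freely. *)
Lemma rgamma_rising (x : R) (n : nat) :
  0 < x + INR n -> rgamma x = rising x n / Gamma (x + INR n).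
Proof.
assert (H : forall m k : nat, 0 < x + INR m ->
  rising x (m + k) / Gamma (x + INR (m + k)) = rising x m / Gamma (x + INR m)).
{ intros m k Hm; rewrite plus_INR, <- Rplus_assoc, Gamma_rising, rising_add by exact Hm.
  assert (0 < Gamma (x + INR m)) by (apply Gamma_pos, Hm).
  assert (0 < Gamma (x + INR m + INR k)) by (apply Gamma_pos; pose proof (pos_INR k); lra).
  rewrite Gamma_rising in H0 by exact Hm.
  field; split; [lra|]; intros E; rewrite E in H0; lra. }
intros Hn.
assert (E : rgamma x = rising x (pole_index x) / Gamma (x + INR (pole_index x))).
{ unfold rgamma; fold (pole_index x); f_equal.
  generalize (pole_index x) as m; induction m as [|m IH]; [reflexivity|simpl; rewrite IH; reflexivity]. }
rewrite E.
rewrite <- (H (pole_index x) n (pole_index_gt x)), <- (H n (pole_index x) Hn).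
rewrite Nat.add_comm; reflexivity.
Qed.

Lemma rgamma_pos (x : R) : 0 < x -> rgamma x = / Gamma x.
Proof.
intros Hx; rewrite (rgamma_rising x 0) by (simpl; lra).
simpl; rewrite Rplus_0_r; unfold Rdiv; ring.
Qed.

Lemma rgamma_S (x : R) : rgamma x = x * rgamma (x + 1).
Proof.
destruct (INR_unbounded (- x)) as [n Hn].
rewrite (rgamma_rising x (S n)) by (rewrite S_INR; lra).
rewrite (rgamma_rising (x + 1) n) by lra.
rewrite rising_S_l, S_INR; replace (x + (INR n + 1)) with (x + 1 + INR n) by ring.
unfold Rdiv; ring.
Qed.

(* [gcoef a n] is the coefficient of [z^n] in [(1 - z)^(-a)]. *)
Definition gcoef (a : R) (n : nat) : R := rising a n / INR (Factorial.fact n).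

Lemma gcoef_0 (a : R) : gcoef a 0 = 1.
Proof. unfold gcoef; simpl; field. Qed.

Lemma gcoef_S (a : R) (n : nat) : INR (S n) * gcoef a (S n) = (a + INR n) * gcoef a n.
Proof.
unfold gcoef; rewrite fact_simpl, mult_INR; simpl rising.
assert (INR (Factorial.fact n) <> 0) by apply INR_fact_neq_0.
assert (INR (S n) <> 0) by (apply not_0_INR; lia).
field; split; assumption.
Qed.

Lemma gcoef_S_shift (a : R) (n : nat) : INR (S n) * gcoef a (S n) = a * gcoef (a + 1) n.
Proof.
unfold gcoef; rewrite fact_simpl, mult_INR, rising_S_l.
assert (INR (Factorial.fact n) <> 0) by apply INR_fact_neq_0.
assert (INR (S n) <> 0) by (apply not_0_INR; lia).
field; split; assumption.
Qed.

Lemma gcoef_shift (a : R) (n : nat) : a * gcoef (a + 1) n = (a + INR n) * gcoef a n.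
Proof. rewrite <- gcoef_S_shift, gcoef_S; reflexivity. Qed.

Lemma gcoef_nonneg (a : R) (n : nat) : 0 <= a -> 0 <= gcoef a n.
Proof.
intros Ha; apply Rmult_le_pos; [|left; apply Rinv_0_lt_compat, INR_fact_lt_0].
induction n as [|n IH]; simpl; [lra|].
apply Rmult_le_pos; [exact IH|pose proof (pos_INR n); lra].
Qed.

Lemma gcoef_1 (n : nat) : gcoef 1 n = 1.
Proof.
induction n as [|n IH]; [apply gcoef_0|].
pose proof (gcoef_S 1 n) as H; rewrite IH, S_INR in H; pose proof (pos_INR n).
apply (Rmult_eq_reg_l (INR n + 1)); [lra|lra].
Qed.

Lemma gcoef_decreasing (a : R) (m n : nat) :
  0 <= a <= 1 -> (m <= n)%nat -> gcoef a n <= gcoef a m.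
Proof.
intros Ha H; induction H as [|n H IH]; [lra|].
apply Rle_trans with (2 := IH).
pose proof (gcoef_S a n) as E; rewrite S_INR in E; pose proof (pos_INR n).
pose proof (gcoef_nonneg a n (proj1 Ha)).
apply (Rmult_le_reg_l (INR n + 1)); [lra|]; rewrite E; nra.
Qed.

(** The sequence of Gauss's formula. At [n = 0] the power takes a default value, so the bounds are
    stated at [S n]. *)
Definition gcoef_norm (a : R) (n : nat) : R := Rpower (INR n) (1 - a) * gcoef a n.

Lemma gcoef_Gamma (a : R) (n : nat) :
  0 < a -> gcoef a n = Gamma (a + INR n) / (Gamma a * INR (Factorial.fact n)).
Proof.
intros Ha; rewrite Gamma_rising by exact Ha; unfold gcoef.
assert (0 < Gamma a) by (apply Gamma_pos, Ha).
assert (INR (Factorial.fact n) <> 0) by apply INR_fact_neq_0.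
field; lra.
Qed.

(** Both sides come from [Gamma_le_Rpower], with [n! = n Gamma n]. The upper bound is
    [Gamma (n + a) <= n^a Gamma n]. The lower one is [n Gamma n = Gamma (n + 1) <= (n + a)^(1-a)
    Gamma (n + a)], where replacing [(n + a)^(1-a)] by [n^(1-a)] costs at most the factor
    [n / (n + 1)]. *)
Lemma gcoef_norm_bounds (a : R) (n : nat) :
  0 < a <= 1 -> INR (S n) / (INR (S n) + 1) * / Gamma a <= gcoef_norm a (S n) <= / Gamma a.
Proof.
intros Ha; assert (HG : 0 < Gamma a) by (apply Gamma_pos; lra).
unfold gcoef_norm; rewrite gcoef_Gamma by lra.
set (x := INR (S n)).
assert (Hx : 0 < x) by (apply lt_0_INR; lia).
assert (HF : INR (Factorial.fact (S n)) = x * Gamma x).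
{ rewrite <- Gamma_nat; fold x; apply Gamma_S, Hx. }
rewrite HF.
assert (HGx : 0 < Gamma x) by (apply Gamma_pos, Hx).
assert (HGa : 0 < Gamma (a + x)) by (apply Gamma_pos; lra).
assert (Hp : Rpower x (1 - a) * Rpower x a = x).
{ rewrite <- Rpower_plus; replace (1 - a + a) with 1 by ring; apply Rpower_1, Hx. }
pose proof (Rpower_pos x (1 - a)) as Hp1.
split.
- pose proof (Gamma_le_Rpower (a + x) (1 - a) ltac:(lra) ltac:(lra)) as H.
  replace (a + x + (1 - a)) with (x + 1) in H by ring; rewrite Gamma_S in H by exact Hx.
  assert (H2 : x / (x + 1) * Rpower (a + x) (1 - a) <= Rpower x (1 - a)).
  { apply Rle_trans with (Rpower (x / (x + 1)) (1 - a) * Rpower (x + 1) (1 - a)).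
    - apply Rmult_le_compat; [left; apply Rdiv_lt_0_compat; lra|left; apply Rpower_pos| |].
      + rewrite <- (Rpower_1 (x / (x + 1))) at 1 by (apply Rdiv_lt_0_compat; lra).
        assert (E : Rpower (x / (x + 1)) 1 = Rpower (x / (x + 1)) (1 - a) * Rpower (x / (x + 1)) a)
          by (rewrite <- Rpower_plus; f_equal; ring).
        rewrite E; assert (Rpower (x / (x + 1)) a <= 1).
        { apply Rpower_le_1; [|lra]; split; [apply Rdiv_lt_0_compat; lra|].
          apply (Rmult_le_reg_r (x + 1)); [lra|]; field_simplify; lra. }
        pose proof (Rpower_pos (x / (x + 1)) (1 - a)); nra.
      + apply Rle_Rpower_l; lra.
    - right; rewrite Rpower_mult_distr by (try apply Rdiv_lt_0_compat; lra).
      f_equal; field; lra. }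
  apply (Rmult_le_reg_r (Gamma a * (x * Gamma x))); [repeat apply Rmult_lt_0_compat; assumption|].
  replace (x / (x + 1) * / Gamma a * (Gamma a * (x * Gamma x)))
    with (x / (x + 1) * (x * Gamma x)) by (field; lra).
  replace (Rpower x (1 - a) * (Gamma (a + x) / (Gamma a * (x * Gamma x))) * (Gamma a * (x * Gamma x)))
    with (Rpower x (1 - a) * Gamma (a + x)) by (field; lra).
  apply Rle_trans with (x / (x + 1) * (Rpower (a + x) (1 - a) * Gamma (a + x))).
  + apply Rmult_le_compat_l; [left; apply Rdiv_lt_0_compat; lra|exact H].
  + rewrite <- Rmult_assoc; apply Rmult_le_compat_r; lra.
- pose proof (Gamma_le_Rpower x a Hx ltac:(lra)) as H; rewrite (Rplus_comm x a) in H.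
  apply (Rmult_le_reg_r (Gamma a * (x * Gamma x))); [repeat apply Rmult_lt_0_compat; assumption|].
  replace (Rpower x (1 - a) * (Gamma (a + x) / (Gamma a * (x * Gamma x))) * (Gamma a * (x * Gamma x)))
    with (Rpower x (1 - a) * Gamma (a + x)) by (field; lra).
  replace (/ Gamma a * (Gamma a * (x * Gamma x))) with (Rpower x (1 - a) * Rpower x a * Gamma x)
    by (rewrite Hp; field; lra).
  rewrite Rmult_assoc; apply Rmult_le_compat_l; lra.
Qed.

Lemma is_lim_seq_Rpower_ratio (s : R) : is_lim_seq (fun n => Rpower (INR (S (S n)) / INR (S n)) s) 1.
Proof.
rewrite <- (Rpower_O 1 Rlt_0_1) at 1; rewrite <- (Rmult_0_l s).
replace (Rpower 1 (0 * s)) with (Rpower 1 s)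
  by (unfold Rpower; rewrite ln_1; f_equal; ring).
apply (is_lim_seq_continuous (fun x => Rpower x s)).
- apply continuity_pt_filterlim, continuous_Rpower; lra.
- apply is_lim_seq_ext with (fun n => 1 + / INR (S n)).
  + intros n; rewrite (S_INR (S n)); field; apply not_0_INR; lia.
  + replace (Finite 1) with (Rbar_plus 1 0) by (simpl; f_equal; ring).
    apply is_lim_seq_plus'; [apply is_lim_seq_const|].
    apply (is_lim_seq_incr_1 (fun n => / INR n)).
    apply (is_lim_seq_inv INR p_infty); [apply is_lim_seq_INR|discriminate].
Qed.

(** The recurrence [gcoef_S_shift] runs parallel to [rgamma_S]; the factor [a - 1] is what produces
    the zeros of [rgamma] at the poles of Gamma. *)
Lemma gcoef_norm_down (a : R) :
  is_lim_seq (gcoef_norm a) (rgamma a) -> is_lim_seq (gcoef_norm (a - 1)) (rgamma (a - 1)).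
Proof.
(* The recurrence uses up one index, and the remaining one must be nonzero for the ratio of
   powers. *)
intros H; do 2 apply is_lim_seq_incr_1.
apply is_lim_seq_ext with
  (fun n => (a - 1) * (Rpower (INR (S (S n)) / INR (S n)) (1 - a) * gcoef_norm a (S n))).
- intros n; unfold gcoef_norm.
  pose proof (gcoef_S_shift (a - 1) (S n)) as E; replace (a - 1 + 1) with a in E by ring.
  assert (H1 : 0 < INR (S n)) by (apply lt_0_INR; lia).
  assert (H2 : 0 < INR (S (S n))) by (apply lt_0_INR; lia).
  replace (1 - (a - 1)) with ((1 - a) + 1) by ring.
  rewrite Rpower_plus, Rpower_1, Rmult_assoc, E by exact H2.
  rewrite <- (Rmult_assoc (Rpower (INR (S (S n)) / INR (S n)) (1 - a))), Rpower_mult_distr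
    by (try apply Rdiv_lt_0_compat; assumption).
  replace (INR (S (S n)) / INR (S n) * INR (S n)) with (INR (S (S n))) by (field; lra); ring.
- rewrite (rgamma_S (a - 1)); replace (a - 1 + 1) with a by ring.
  replace ((a - 1) * rgamma a) with ((a - 1) * (1 * rgamma a)) by ring.
  apply is_lim_seq_mult'; [apply is_lim_seq_const|].
  apply is_lim_seq_mult'; [apply is_lim_seq_Rpower_ratio|].
  apply is_lim_seq_incr_1 in H; exact H.
Qed.

Lemma gcoef_norm_up (a : R) : 0 < a ->
  is_lim_seq (gcoef_norm a) (rgamma a) -> is_lim_seq (gcoef_norm (a + 1)) (rgamma (a + 1)).
Proof.
intros Ha H; apply is_lim_seq_incr_1.
apply is_lim_seq_ext with (fun n => (1 + a * / INR (S n)) * (gcoef_norm a (S n) / a)).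
- intros n; unfold gcoef_norm.
  assert (H1 : 0 < INR (S n)) by (apply lt_0_INR; lia).
  assert (E : gcoef (a + 1) (S n) = (a + INR (S n)) * gcoef a (S n) / a)
    by (rewrite <- gcoef_shift; field; lra).
  rewrite E; replace (1 - (a + 1)) with ((1 - a) + - (1)) by ring.
  rewrite Rpower_plus, (Rpower_Ropp _ 1), Rpower_1 by exact H1; field; lra.
- replace (rgamma (a + 1)) with ((1 + a * 0) * (rgamma a / a))
    by (rewrite (rgamma_S a); field; lra).
  apply is_lim_seq_mult'.
  + apply is_lim_seq_plus'; [apply is_lim_seq_const|].
    apply is_lim_seq_mult'; [apply is_lim_seq_const|].
    apply (is_lim_seq_incr_1 (fun n => / INR n)).
    apply (is_lim_seq_inv INR p_infty); [apply is_lim_seq_INR|discriminate].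
  + apply is_lim_seq_mult'; [apply is_lim_seq_incr_1 in H; exact H|apply is_lim_seq_const].
Qed.

(* Gauss's product formula for [1 / Gamma]. *)
Lemma is_lim_gcoef_norm (a : R) : is_lim_seq (gcoef_norm a) (rgamma a).
Proof.
assert (Hbase : forall x, 0 < x <= 1 -> is_lim_seq (gcoef_norm x) (rgamma x)).
{ intros x Hx; apply is_lim_seq_incr_1; rewrite rgamma_pos by lra.
  apply is_lim_seq_le_le with (fun n => INR (S n) / (INR (S n) + 1) * / Gamma x) (fun _ => / Gamma x).
  - intros n; apply gcoef_norm_bounds, Hx.
  - replace (Finite (/ Gamma x)) with (Finite ((1 - 0) * / Gamma x)) by (f_equal; ring).
    apply is_lim_seq_mult'; [|apply is_lim_seq_const].
    apply is_lim_seq_ext with (fun n => 1 - / INR (S (S n))).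
    + intros n; rewrite (S_INR (S n)); field; pose proof (pos_INR (S n)); lra.
    + apply is_lim_seq_minus'; [apply is_lim_seq_const|].
      apply (is_lim_seq_incr_1 (fun n => / INR (S n))), (is_lim_seq_incr_1 (fun n => / INR n)).
      apply (is_lim_seq_inv INR p_infty); [apply is_lim_seq_INR|discriminate].
  - apply is_lim_seq_const. }
assert (Hup : forall m x, 0 < x <= INR m + 1 -> is_lim_seq (gcoef_norm x) (rgamma x)).
{ induction m as [|m IH]; intros x Hx; [apply Hbase; simpl in Hx; lra|].
  destruct (Rle_lt_dec x 1) as [H|H]; [apply Hbase; lra|].
  replace x with ((x - 1) + 1) by ring; apply gcoef_norm_up; [lra|].
  apply IH; rewrite S_INR in Hx; lra. }
assert (Hdown : forall m x, - INR m < x -> is_lim_seq (gcoef_norm x) (rgamma x)).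
{ induction m as [|m IH]; intros x Hx.
  - destruct (INR_unbounded x) as [k Hk]; apply (Hup k); simpl in Hx; lra.
  - replace x with ((x + 1) - 1) by ring; apply gcoef_norm_down, IH; rewrite S_INR in Hx; lra. }
destruct (INR_unbounded (- a)) as [m Hm]; apply (Hdown m); lra.
Qed.

(** The factors are those met in the induction of [gcoef_weighted_le]: [18 = 9 * 2], with [9] from
    [pow_shift_le] and [2] from [(x + 1)^(1-a) <= 2 x^(1-a)]; [m' + 1] bounds the multiplier of the
    recurrence, and [m' + 2] bounds [(x + m' + 2) / (x + 1)]. The initial value [4 = 2 * 2] is what
    the range [1 < a <= 2] of [gcoef_norm_le] asks for. *)
Fixpoint gcoef_majorant (m : nat) : R :=
  match m with
  | O => 4
  | S m' => 18 * (INR m' + 1) * (INR m' + 2) * gcoef_majorant m'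
  end.

Lemma gcoef_majorant_pos (m : nat) : 0 < gcoef_majorant m.
Proof.
induction m as [|m IH]; simpl; [lra|]; pose proof (pos_INR m).
repeat apply Rmult_lt_0_compat; lra.
Qed.

(** [(1 + 2/x)^m <= exp (2 m / x) <= exp 2 <= 9]. *)
Lemma pow_shift_le (x : R) (m : nat) : 0 < x -> INR m <= x -> (x + 2) ^ m <= 9 * x ^ m.
Proof.
intros Hx Hm.
assert (H : (1 + 2 / x) ^ m <= 9).
{ apply Rle_trans with (exp (2 / x) ^ m).
  - apply pow_incr; split; [|apply exp_ineq1_le].
    assert (0 < 2 / x) by (apply Rdiv_lt_0_compat; lra); lra.
  - rewrite <- Rpower_pow by apply exp_pos; unfold Rpower; rewrite ln_exp.
    apply Rle_trans with (exp (1 + 1)).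
    + assert (INR m * (2 / x) <= 2).
      { apply (Rmult_le_reg_r x); [exact Hx|].
        replace (INR m * (2 / x) * x) with (2 * INR m) by (field; lra); lra. }
      destruct (Rle_lt_or_eq_dec (INR m * (2 / x)) (1 + 1)) as [H1|H1]; [lra| |].
      * left; apply exp_increasing, H1.
      * right; f_equal; exact H1.
    + rewrite exp_plus; pose proof exp_le_3; pose proof (exp_pos 1); nra. }
replace (x + 2) with (x * (1 + 2 / x)) by (field; lra).
rewrite Rpow_mult_distr, (Rmult_comm 9); apply Rmult_le_compat_l; [|exact H].
apply pow_le; lra.
Qed.

(** [1 = Gamma 2 <= (a + 1)^(1-a) Gamma (a + 1)], and the power is at most [a + 1 <= 2]. *)
Lemma Gamma_inv_le (a : R) : 0 < a <= 1 -> / Gamma (a + 1) <= 2.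
Proof.
intros Ha.
pose proof (Gamma_le_Rpower (a + 1) (1 - a) ltac:(lra) ltac:(lra)) as H.
replace (a + 1 + (1 - a)) with (1 + 1) in H by ring.
rewrite Gamma_S, Gamma_1 in H by lra.
assert (0 < Gamma (a + 1)) by (apply Gamma_pos; lra).
assert (Rpower (a + 1) (1 - a) <= 2).
{ apply Rle_trans with (Rpower (a + 1) 1); [apply Rle_Rpower; lra|rewrite Rpower_1; lra]. }
apply (Rmult_le_reg_r (Gamma (a + 1))); [assumption|]; rewrite Rinv_l by lra; nra.
Qed.

(** Serves the coefficient of index [1] in [gcoef_weighted_le]: there the recurrence lands on
    [gcoef _ 0 = 1], which the induction hypothesis does not cover. *)
Lemma gcoef_majorant_first (m : nat) :
  (INR m + 1) * (INR m + 2) ^ S m <= gcoef_majorant (S m).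
Proof.
induction m as [|m IH]; [simpl; lra|].
change (gcoef_majorant (S (S m))) with (18 * (INR (S m) + 1) * (INR (S m) + 2) * gcoef_majorant (S m)).
rewrite S_INR in *; pose proof (pos_INR m).
pose proof (pow_shift_le (INR m + 2) (S m) ltac:(lra) ltac:(rewrite S_INR; lra)) as H1.
assert (H2 : (INR m + 1 + 2) ^ S m <= (INR m + 2 + 2) ^ S m) by (apply pow_incr; lra).
assert (H3 : 0 < (INR m + 2) ^ S m) by (apply pow_lt; lra).
change ((INR m + 1 + 2) ^ S (S m)) with ((INR m + 1 + 2) * (INR m + 1 + 2) ^ S m).
assert (H4 : (INR m + 2) ^ S m <= gcoef_majorant (S m)) by nra.
apply Rle_trans with ((INR m + 1 + 1) * ((INR m + 1 + 2) * (9 * gcoef_majorant (S m)))).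
- apply Rmult_le_compat_l; [lra|]; apply Rmult_le_compat_l; lra.
- pose proof (gcoef_majorant_pos (S m)).
  assert (0 < (INR m + 1 + 1) * (INR m + 1 + 2) * gcoef_majorant (S m)); [|lra].
  apply Rmult_lt_0_compat; [apply Rmult_lt_0_compat|]; lra.
Qed.

(** The weight is [(n + m)^m] rather than [n^m] so that the induction on [m] closes. The recurrence
    passes from [(m + 1, n + 1)] to [(m, n)]; [(n + m + 2)^m] is at most [9 (n + m)^m] uniformly,
    whereas [((n + 1) / n)^m] is unbounded in [m]. *)
Lemma gcoef_weighted_le (m : nat) (a : R) (n : nat) :
  0 < a <= 1 ->
  Rabs (gcoef (a - INR m) (S n)) * (INR (S n) + INR m) ^ m * Rpower (INR (S n)) (1 - a)
    <= gcoef_majorant m.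
Proof.
intros Ha; revert n; induction m as [|m IH]; intros n.
- simpl INR at 1 3; rewrite Rminus_0_r, pow_O, Rmult_1_r.
  rewrite Rabs_pos_eq by (apply gcoef_nonneg; lra); rewrite Rmult_comm.
  change (gcoef_norm a (S n) <= 4).
  apply Rle_trans with (1 := proj2 (gcoef_norm_bounds a n Ha)).
  rewrite <- rgamma_pos, rgamma_S, rgamma_pos by lra.
  pose proof (Gamma_inv_le a Ha); assert (0 < / Gamma (a + 1)) by (apply Rinv_0_lt_compat, Gamma_pos; lra).
  nra.
- pose proof (pos_INR m) as Hm; pose proof (pos_INR n) as Hn.
  assert (Habs : Rabs (a - INR (S m)) <= INR m + 1).
  { rewrite S_INR; apply Rabs_le; lra. }
  assert (Hrec : Rabs (gcoef (a - INR (S m)) (S n)) <=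
    (INR m + 1) / INR (S n) * Rabs (gcoef (a - INR m) n)).
  { pose proof (gcoef_S_shift (a - INR (S m)) n) as E.
    replace (a - INR (S m) + 1) with (a - INR m) in E by (rewrite S_INR; ring).
    assert (H1 : 0 < INR (S n)) by (apply lt_0_INR; lia).
    apply (Rmult_le_reg_l (INR (S n))); [exact H1|].
    rewrite <- (Rabs_pos_eq (INR (S n))) at 1 by lra; rewrite <- Rabs_mult, E, Rabs_mult.
    replace (INR (S n) * ((INR m + 1) / INR (S n) * Rabs (gcoef (a - INR m) n)))
      with ((INR m + 1) * Rabs (gcoef (a - INR m) n)) by (field; lra).
    apply Rmult_le_compat_r; [apply Rabs_pos|exact Habs]. }
  destruct n as [|n].
  + apply Rle_trans with (2 := gcoef_majorant_first m).
    rewrite gcoef_0, Rabs_R1 in Hrec; change (INR 1) with 1 in *.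
    replace (Rpower 1 (1 - a)) with 1 by (unfold Rpower; rewrite ln_1, Rmult_0_r, exp_0; reflexivity).
    rewrite Rmult_1_r, S_INR; replace (1 + (INR m + 1)) with (INR m + 2) by ring.
    apply Rmult_le_compat_r; [apply pow_le; lra|].
    rewrite <- (S_INR m); eapply Rle_trans; [exact Hrec|]; right; rewrite S_INR; field.
  + set (x := INR (S n)) in *; assert (Hx : 1 <= x) by (unfold x; rewrite S_INR; pose proof (pos_INR n); lra).
    specialize (IH n); fold x in IH.
    replace (INR (S (S n))) with (x + 1) in * by (unfold x; rewrite (S_INR (S n)); reflexivity).
    change (gcoef_majorant (S m)) with (18 * (INR m + 1) * (INR m + 2) * gcoef_majorant m).
    rewrite (S_INR m) at 2.
    replace (x + 1 + (INR m + 1)) with (x + INR m + 2) by ring.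
    change ((x + INR m + 2) ^ S m) with ((x + INR m + 2) * (x + INR m + 2) ^ m).
    pose proof (pow_shift_le (x + INR m) m ltac:(lra) ltac:(lra)) as H1.
    assert (H2 : Rpower (x + 1) (1 - a) <= 2 * Rpower x (1 - a)).
    { apply Rle_trans with (Rpower (2 * x) (1 - a)); [apply Rle_Rpower_l; lra|].
      rewrite <- Rpower_mult_distr by lra; apply Rmult_le_compat_r; [apply Rpower_ge_0|].
      rewrite <- (Rpower_1 2) at 2 by lra; apply Rle_Rpower; lra. }
    set (g := Rabs (gcoef (a - INR m) (S n))) in *.
    assert (Hg : 0 <= g) by apply Rabs_pos.
    assert (Hp : 0 < Rpower x (1 - a)) by apply Rpower_pos.
    assert (Hq : 0 < (x + INR m) ^ m) by (apply pow_lt; lra).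
    assert (Hr : 0 < (x + INR m + 2) ^ m) by (apply pow_lt; lra).
    apply Rle_trans with ((INR m + 1) / (x + 1) * g * ((x + INR m + 2) * (9 * (x + INR m) ^ m))
       * (2 * Rpower x (1 - a))).
    * apply Rmult_le_compat; [|apply Rpower_ge_0| |exact H2].
      -- apply Rmult_le_pos; [apply Rabs_pos|]; apply Rmult_le_pos; lra.
      -- apply Rmult_le_compat; [apply Rabs_pos| |exact Hrec|].
         ++ apply Rmult_le_pos; lra.
         ++ apply Rmult_le_compat_l; lra.
    * replace ((INR m + 1) / (x + 1) * g * ((x + INR m + 2) * (9 * (x + INR m) ^ m))
         * (2 * Rpower x (1 - a)))
        with (18 * (INR m + 1) * ((x + INR m + 2) / (x + 1)) * (g * (x + INR m) ^ m * Rpower x (1 - a)))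
        by (field; lra).
      apply Rmult_le_compat; [| |apply Rmult_le_compat_l; [lra|]|exact IH].
      -- apply Rmult_le_pos; [lra|]; left; apply Rdiv_lt_0_compat; lra.
      -- apply Rmult_le_pos; [|lra]; apply Rmult_le_pos; lra.
      -- apply (Rmult_le_reg_r (x + 1)); [lra|].
         replace ((x + INR m + 2) / (x + 1) * (x + 1)) with (x + INR m + 2) by (field; lra); nra.
Qed.

(** For [a <= 1] the shifted parameter [b = a + m] lies in [(0, 1]] and the weight [(n + m)^m]
    dominates [n^m]. For [1 < a <= 2] one step of [gcoef_shift] leads back to [b = a - 1]; the two
    factors [2] bound [1 / Gamma a] and [(b + n) / n]. *)
Lemma gcoef_norm_le (a : R) (n : nat) :
  a <= 2 -> Rabs (gcoef_norm a (S n)) <= gcoef_majorant (pole_index a).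
Proof.
intros Ha; assert (Hn : 0 < INR (S n)) by (apply lt_0_INR; lia).
unfold gcoef_norm; rewrite Rabs_mult, (Rabs_pos_eq (Rpower _ _)) by apply Rpower_ge_0.
destruct (Rle_lt_dec a 1) as [H1|H1].
- pose proof (pole_index_gt a) as Hm1; pose proof (pole_index_le a H1) as Hm2.
  set (m := pole_index a) in *; set (b := a + INR m) in *.
  pose proof (gcoef_weighted_le m b n ltac:(lra)) as H.
  replace (b - INR m) with a in H by (unfold b; ring).
  apply Rle_trans with (2 := H).
  replace (1 - a) with (INR m + (1 - b)) by (unfold b; ring).
  rewrite Rpower_plus, Rpower_pow by exact Hn.
  assert (H2 : INR (S n) ^ m <= (INR (S n) + INR m) ^ m)
    by (apply pow_incr; pose proof (pos_INR m); lra).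
  rewrite (Rmult_comm _ (Rabs _)), <- Rmult_assoc.
  apply Rmult_le_compat_r; [apply Rpower_ge_0|].
  apply Rmult_le_compat_l; [apply Rabs_pos|exact H2].
- rewrite pole_index_0 by lra; simpl gcoef_majorant.
  rewrite Rabs_pos_eq by (apply gcoef_nonneg; lra).
  set (b := a - 1); pose proof (gcoef_norm_bounds b n ltac:(unfold b; lra)) as [_ H].
  pose proof (gcoef_shift b (S n)) as E; replace (b + 1) with a in E by (unfold b; ring).
  pose proof (Gamma_inv_le b ltac:(unfold b; lra)) as H2.
  assert (Hb : 0 < b) by (unfold b; lra).
  rewrite Gamma_S in H2 by exact Hb.
  assert (HG : 0 < Gamma b) by (apply Gamma_pos, Hb).
  assert (E2 : Rpower (INR (S n)) (1 - a) * gcoef a (S n) =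
     gcoef_norm b (S n) * / b * ((b + INR (S n)) / INR (S n))).
  { apply (Rmult_eq_reg_l b); [|lra]; rewrite (Rmult_comm (Rpower _ _)), <- Rmult_assoc, E.
    unfold gcoef_norm; replace (1 - b) with ((1 - a) + 1) by (unfold b; ring).
    rewrite Rpower_plus, Rpower_1 by exact Hn; field; lra. }
  rewrite E2; replace 4 with (2 * 2) by ring.
  assert (H3 : 1 <= INR (S n)) by (rewrite S_INR; pose proof (pos_INR n); lra).
  apply Rmult_le_compat.
  + apply Rmult_le_pos; [|left; apply Rinv_0_lt_compat, Hb].
    apply Rmult_le_pos; [apply Rpower_ge_0|apply gcoef_nonneg; lra].
  + left; apply Rdiv_lt_0_compat; lra.
  + apply Rle_trans with (2 := H2); rewrite Rinv_mult, Rmult_comm.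
    apply Rmult_le_compat_l; [left; apply Rinv_0_lt_compat, Hb|exact H].
  + apply (Rmult_le_reg_r (INR (S n))); [exact Hn|].
    replace ((b + INR (S n)) / INR (S n) * INR (S n)) with (b + INR (S n)) by (field; lra).
    unfold b; lra.
Qed.

(** The recursion multiplies up to [4 * 18^m * m! * (m+1)!]; a single factorial is easier to set
    against [j!]. *)
Lemma gcoef_majorant_fact (m : nat) :
  gcoef_majorant m <= 4 * 18 ^ m * INR (Factorial.fact (2 * m + 1)).
Proof.
induction m as [|m IH]; [simpl; lra|].
replace (2 * S m + 1)%nat with (S (S (2 * m + 1))) by lia.
rewrite !fact_simpl, !mult_INR.
change (18 ^ S m) with (18 * 18 ^ m).
change (gcoef_majorant (S m)) with (18 * (INR m + 1) * (INR m + 2) * gcoef_majorant m).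
rewrite !S_INR, plus_INR, mult_INR; change (INR 2) with 2; change (INR 1) with 1; pose proof (pos_INR m).
assert (H0 : 0 < 18 ^ m * INR (Factorial.fact (2 * m + 1)))
  by (apply Rmult_lt_0_compat; [apply pow_lt; lra|apply INR_fact_lt_0]).
apply Rle_trans with (18 * (INR m + 1) * (INR m + 2) * (4 * 18 ^ m * INR (Factorial.fact (2 * m + 1)))).
- apply Rmult_le_compat_l; [|exact IH]; apply Rmult_le_pos; lra.
- set (F := INR (Factorial.fact (2 * m + 1))) in *.
  replace (18 * (INR m + 1) * (INR m + 2) * (4 * 18 ^ m * F))
    with (72 * (18 ^ m * F) * ((INR m + 1) * (INR m + 2))) by ring.
  apply Rle_trans with (72 * (18 ^ m * F) * ((2 * INR m + 3) * (2 * INR m + 2))); [|right; ring].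
  apply Rmult_le_compat_l; [lra|]; nra.
Qed.

Lemma fact_mul_le (p q : nat) : (Factorial.fact p * Factorial.fact q <= Factorial.fact (p + q))%nat.
Proof.
induction p as [|p IH]; simpl; [lia|].
rewrite Nat.mul_add_distr_r, <- Nat.mul_assoc; nia.
Qed.

Lemma fact_add_3 (j : nat) :
  INR (Factorial.fact (j + 3)) <= 6 * 4 ^ j * INR (Factorial.fact j).
Proof.
induction j as [|j IH]; [simpl; lra|].
replace (S j + 3)%nat with (S (j + 3)) by lia.
rewrite !fact_simpl, !mult_INR, !S_INR, plus_INR; change (4 ^ S j) with (4 * 4 ^ j).
pose proof (pos_INR j); simpl (INR 3).
assert (0 < 4 ^ j) by (apply pow_lt; lra).
pose proof (INR_fact_lt_0 j).
apply Rle_trans with ((INR j + (1 + 1 + 1) + 1) * (6 * 4 ^ j * INR (Factorial.fact j))).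
- apply Rmult_le_compat_l; lra.
- assert (0 < 6 * 4 ^ j * INR (Factorial.fact j)) by (repeat apply Rmult_lt_0_compat; lra).
  nra.
Qed.

(** With [m <= j nu + 1] the complement [q = j + 3 - (2m + 1)] is at least [(1 - 2 nu) j], and
    [(2m+1)! q! <= (j+3)! <= 6 * 4^j j!]. The term is therefore at most [432 (72 X)^j / q!], where
    [72 = 18 * 4] and [432 = 4 * 18 * 6]. As [j <= L q], this is at most [432 Z^q / q!], a bounded
    sequence. The maximum with [1] in [Y] allows the exponent [j] to be raised to [L q]. *)
Lemma majorant_term_bounded (nu b X : R) :
  0 < nu < 1 / 2 -> 0 <= b -> 0 <= X ->
  exists C, 0 < C /\ forall j,
    X ^ j / INR (Factorial.fact j) * gcoef_majorant (pole_index (b - INR j * nu)) <= C.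
Proof.
intros Hnu Hb HX.
destruct (INR_unbounded (/ (1 - 2 * nu))) as [L HL].
set (Y := Rmax 1 (72 * X)); set (Z := Y ^ L).
assert (HY : 1 <= Y) by apply Rmax_l.
destruct (maj_by_pos (fun n => Z ^ n / INR (Factorial.fact n))) as [C [HC1 HC]].
{ exists 0; apply cv_speed_pow_fact. }
exists (432 * C); split; [lra|]; intros j.
set (m := pole_index (b - INR j * nu)).
pose proof (pos_INR j) as Hj.
assert (Hm : INR m <= INR j * nu + 1).
{ destruct (Rle_lt_dec (b - INR j * nu) 1) as [H|H].
  - pose proof (pole_index_le _ H) as H1; fold m in H1; lra.
  - unfold m; rewrite pole_index_0 by lra; simpl; nra. }
assert (Hmj : (m <= S j)%nat) by (apply INR_le; rewrite S_INR; nra).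
assert (Hpj : (2 * m + 1 <= j + 3)%nat).
{ apply INR_le; rewrite !plus_INR, mult_INR; simpl INR; nra. }
set (q := (j + 3 - (2 * m + 1))%nat).
assert (Hq : (1 - 2 * nu) * INR j <= INR q).
{ unfold q; rewrite minus_INR by exact Hpj; rewrite !plus_INR, mult_INR; simpl INR; nra. }
assert (HjL : (j <= L * q)%nat).
{ apply INR_le; rewrite mult_INR.
  apply (Rmult_lt_compat_l (1 - 2 * nu)) in HL; [|lra]; rewrite Rinv_r in HL by lra.
  pose proof (pos_INR q); pose proof (pos_INR L); nra. }
assert (Hfact : INR (Factorial.fact (2 * m + 1)) * INR (Factorial.fact q)
   <= 6 * 4 ^ j * INR (Factorial.fact j)).
{ apply Rle_trans with (2 := fact_add_3 j); rewrite <- mult_INR; apply le_INR.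
  replace (j + 3)%nat with (2 * m + 1 + q)%nat by (unfold q; lia); apply fact_mul_le. }
pose proof (INR_fact_lt_0 j) as Fj; pose proof (INR_fact_lt_0 q) as Fq.
assert (H18 : 18 ^ m <= 18 * 18 ^ j).
{ change (18 * 18 ^ j) with (18 ^ S j); apply Rle_pow; [lra|exact Hmj]. }
assert (HXj : 0 <= X ^ j) by (apply pow_le, HX).
assert (HZ : (72 * X) ^ j <= Z ^ q).
{ unfold Z; rewrite <- pow_mult; apply Rle_trans with (Y ^ j).
  - apply pow_incr; split; [lra|apply Rmax_r].
  - apply Rle_pow; [exact HY|exact HjL]. }
apply Rle_trans with (432 * (Z ^ q / INR (Factorial.fact q))).
- apply Rle_trans with (X ^ j / INR (Factorial.fact j) *
    (4 * (18 * 18 ^ j) * (6 * 4 ^ j * INR (Factorial.fact j) / INR (Factorial.fact q)))).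
  + apply Rmult_le_compat_l; [apply Rmult_le_pos; [exact HXj|left; apply Rinv_0_lt_compat, Fj]|].
    apply Rle_trans with (1 := gcoef_majorant_fact m).
    apply Rmult_le_compat; [|left; apply INR_fact_lt_0|lra|].
    * assert (0 < 18 ^ m) by (apply pow_lt; lra); lra.
    * apply (Rmult_le_reg_r (INR (Factorial.fact q))); [exact Fq|].
      unfold Rdiv; rewrite (Rmult_assoc _ (/ _)), Rinv_l by lra; lra.
  + replace (X ^ j / INR (Factorial.fact j) *
      (4 * (18 * 18 ^ j) * (6 * 4 ^ j * INR (Factorial.fact j) / INR (Factorial.fact q))))
      with (432 * ((18 ^ j * 4 ^ j * X ^ j) / INR (Factorial.fact q))) by (field; lra).
    rewrite <- !Rpow_mult_distr; replace (18 * 4 * X) with (72 * X) by ring.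
    apply Rmult_le_compat_l; [lra|]; apply Rmult_le_compat_r; [left; apply Rinv_0_lt_compat, Fq|exact HZ].
- apply Rmult_le_compat_l; [lra|]; apply Rle_trans with (2 := HC q); apply Rle_abs.
Qed.

(** * The Wright function as a limit of coefficients *)

Lemma is_lim_sum_f_R0 (a : nat -> nat -> R) (l : nat -> R) (N : nat) :
  (forall j, (j <= N)%nat -> is_lim_seq (fun n => a n j) (l j)) ->
  is_lim_seq (fun n => sum_f_R0 (a n) N) (sum_f_R0 l N).
Proof.
intros H; induction N as [|N IH]; simpl; [apply H; lia|].
apply is_lim_seq_plus'; [apply IH; intros; apply H; lia|apply H; lia].
Qed.

Lemma sum_f_R0_nonneg (u : nat -> R) (n : nat) :
  (forall k, (k <= n)%nat -> 0 <= u k) -> 0 <= sum_f_R0 u n.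
Proof.
intros H; induction n as [|n IH]; simpl; [apply H; lia|].
apply Rplus_le_le_0_compat; [apply IH; intros; apply H; lia|apply H; lia].
Qed.

Lemma Series_Rabs_le (a K : nat -> R) :
  (forall j, Rabs (a j) <= K j) -> ex_series K -> Rabs (Series a) <= Series K.
Proof.
intros H HK; apply Rle_trans with (Series (fun j => Rabs (a j))).
- apply Series_Rabs, (ex_series_le (V := R_CompleteNormedModule) (fun j => Rabs (a j)) K); [|exact HK].
  intros j; change (Rabs (Rabs (a j)) <= K j); rewrite Rabs_Rabsolu; apply H.
- apply Series_le; [|exact HK]; intros j; split; [apply Rabs_pos|apply H].
Qed.

(* Tannery's theorem. *)
Lemma is_lim_Series_dominated (a : nat -> nat -> R) (l K : nat -> R) :
  (forall n j, Rabs (a n j) <= K j) -> ex_series K ->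
  (forall j, is_lim_seq (fun n => a n j) (l j)) ->
  is_lim_seq (fun n => Series (a n)) (Series l).
Proof.
intros Ha HK Hl.
assert (Hl' : forall j, Rabs (l j) <= K j).
{ intros j; change (Rbar_le (Rabs (l j)) (K j)).
  apply is_lim_seq_le with (fun n => Rabs (a n j)) (fun _ => K j); [intros n; apply Ha| |apply is_lim_seq_const].
  apply (is_lim_seq_abs _ (l j)), Hl. }
assert (HaK : forall n, ex_series (a n)) by (intros n; apply (ex_series_le (V := R_CompleteNormedModule) _ K); [apply Ha|exact HK]).
assert (HlK : ex_series l) by (apply (ex_series_le (V := R_CompleteNormedModule) _ K); [apply Hl'|exact HK]).
assert (Htail : forall (u : nat -> R) N, (forall j, Rabs (u j) <= K j) -> ex_series u ->
  Rabs (Series u - sum_f_R0 u N) <= Series K - sum_f_R0 K N).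
{ intros u N Hu Hex.
  rewrite (Series_incr_n u (S N)), (Series_incr_n K (S N)) by (try assumption; lia); simpl pred.
  replace (sum_f_R0 u N + Series (fun k => u (S N + k)%nat) - sum_f_R0 u N)
    with (Series (fun k => u (S N + k)%nat)) by ring.
  replace (sum_f_R0 K N + Series (fun k => K (S N + k)%nat) - sum_f_R0 K N)
    with (Series (fun k => K (S N + k)%nat)) by ring.
  apply Series_Rabs_le; [intros j; apply Hu|].
  apply (ex_series_incr_n K (S N)); exact HK. }
apply is_lim_seq_spec; intros eps.
assert (HN : exists N, Series K - sum_f_R0 K N < eps / 4).
{ pose proof (Series_correct K HK) as H.
  assert (He : 0 < eps / 4) by (pose proof (cond_pos eps); lra).
  assert (H' : is_lim_seq (sum_n K) (Series K)) by exact H.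
  apply is_lim_seq_spec in H'; destruct (H' (mkposreal _ He)) as [N HN].
  exists N; specialize (HN N (Nat.le_refl N)); simpl in HN; rewrite sum_n_Reals in HN.
  apply Rabs_def2 in HN; lra. }
destruct HN as [N HN].
assert (Hs : is_lim_seq (fun n => sum_f_R0 (a n) N) (sum_f_R0 l N))
  by (apply is_lim_sum_f_R0; intros; apply Hl).
apply is_lim_seq_spec in Hs; destruct (Hs (pos_div_2 eps)) as [n0 Hn0].
exists n0; intros n Hn; specialize (Hn0 n Hn); simpl in Hn0.
pose proof (Htail (a n) N (Ha n) (HaK n)) as H1.
pose proof (Htail l N Hl' HlK) as H2.
replace (Series (a n) - Series l) with
  ((Series (a n) - sum_f_R0 (a n) N) + (sum_f_R0 (a n) N - sum_f_R0 l N) - (Series l - sum_f_R0 l N)) by ring.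
apply Rabs_le_between in H1; apply Rabs_le_between in H2; apply Rabs_def2 in Hn0.
apply Rabs_def1; lra.
Qed.

Definition wright_majorant (nu b Y : R) (j : nat) : R :=
  Y ^ j / INR (Factorial.fact j) * gcoef_majorant (pole_index (b - INR j * nu)).

(** Boundedness of the terms at [2 * Y] gives domination by a geometric series of ratio [1/2] at
    [Y]. *)
Lemma ex_series_wright_majorant (nu b Y : R) :
  0 < nu < 1 / 2 -> 0 <= b -> 0 <= Y -> ex_series (wright_majorant nu b Y).
Proof.
intros Hnu Hb HY.
destruct (majorant_term_bounded nu b (2 * Y) Hnu Hb ltac:(lra)) as [C [HC1 HC]].
apply (ex_series_le (V := R_CompleteNormedModule) _ (fun j => C * (/ 2) ^ j)).
- intros j; change (Rabs (wright_majorant nu b Y j) <= C * (/ 2) ^ j).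
  pose proof (gcoef_majorant_pos (pole_index (b - INR j * nu))).
  pose proof (INR_fact_lt_0 j).
  assert (0 <= Y ^ j) by (apply pow_le, HY).
  unfold wright_majorant; rewrite Rabs_pos_eq by
    (apply Rmult_le_pos; [apply Rmult_le_pos; [assumption|left; apply Rinv_0_lt_compat; assumption]|lra]).
  specialize (HC j).
  replace (Y ^ j) with ((2 * Y) ^ j * (/ 2) ^ j)
    by (rewrite <- Rpow_mult_distr; f_equal; field).
  apply Rle_trans with ((2 * Y) ^ j / INR (Factorial.fact j) * gcoef_majorant (pole_index (b - INR j * nu)) * (/ 2) ^ j).
  + right; field; lra.
  + apply Rmult_le_compat_r; [apply pow_le; lra|exact HC].
- apply (ex_series_scal (V := R_NormedModule)), ex_series_geom; rewrite Rabs_pos_eq; lra.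
Qed.

Lemma wright_majorant_nonneg (nu b Y : R) (j : nat) : 0 <= Y -> 0 <= wright_majorant nu b Y j.
Proof.
intros HY; apply Rmult_le_pos; [|left; apply gcoef_majorant_pos].
apply Rmult_le_pos; [apply pow_le, HY|left; apply Rinv_0_lt_compat, INR_fact_lt_0].
Qed.

Lemma wright_term_le (nu b y Y r : R) (j : nat) :
  Rabs y <= Y -> Rabs r <= gcoef_majorant (pole_index (b - INR j * nu)) ->
  Rabs (y ^ j / INR (Factorial.fact j) * r) <= wright_majorant nu b Y j.
Proof.
intros Hy Hr; unfold wright_majorant, Rdiv.
rewrite !Rabs_mult, <- RPow_abs, (Rabs_pos_eq (/ _)) by (left; apply Rinv_0_lt_compat, INR_fact_lt_0).
apply Rmult_le_compat; [|apply Rabs_pos| |exact Hr].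
- apply Rmult_le_pos; [apply pow_le, Rabs_pos|left; apply Rinv_0_lt_compat, INR_fact_lt_0].
- apply Rmult_le_compat_r; [left; apply Rinv_0_lt_compat, INR_fact_lt_0|].
  apply pow_incr; split; [apply Rabs_pos|exact Hy].
Qed.

(** Inherited from [gcoef_norm_le] in the limit, so one majorant serves both the coefficients and
    the Wright series. *)
Lemma rgamma_le (a : R) : a <= 2 -> Rabs (rgamma a) <= gcoef_majorant (pole_index a).
Proof.
intros Ha; change (Rbar_le (Rabs (rgamma a)) (gcoef_majorant (pole_index a))).
apply is_lim_seq_le with (fun n => Rabs (gcoef_norm a (S n))) (fun _ => gcoef_majorant (pole_index a)).
- intros n; apply gcoef_norm_le, Ha.
- apply (is_lim_seq_incr_1 (fun n => Rabs (gcoef_norm a n))).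
  apply (is_lim_seq_abs _ (rgamma a)), is_lim_gcoef_norm.
- apply is_lim_seq_const.
Qed.

Lemma Wright_series (nu b z : R) :
  Wright z (- nu) b = Series (fun j => z ^ j / INR (Factorial.fact j) * rgamma (b - INR j * nu)).
Proof.
apply Series_ext; intros j; f_equal; f_equal; ring.
Qed.

(* [gsub nu b L n] is the coefficient of [z^n] in [(1 - z)^(-b) exp (- L (1 - z)^nu)]. *)
Definition gsub_term (nu b L : R) (n j : nat) : R :=
  (- L) ^ j / INR (Factorial.fact j) * gcoef (b - INR j * nu) n.

Definition gsub (nu b L : R) (n : nat) : R := Series (gsub_term nu b L n).

(** With [L = y n^nu] the power [L^j] carries exactly the factor [n^(j nu)] by which the
    normalisations at [b] and at [b - j nu] differ. *)
Lemma Rpower_gcoef_norm (nu b y x : R) (n j : nat) : x = INR n -> 0 < x ->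
  Rpower x (1 - b) * gsub_term nu b (y * Rpower x nu) n j =
  (- y) ^ j / INR (Factorial.fact j) * gcoef_norm (b - INR j * nu) n.
Proof.
intros E Hx; unfold gsub_term, gcoef_norm; rewrite <- E.
replace (1 - (b - INR j * nu)) with ((1 - b) + nu * INR j) by ring.
rewrite Rpower_plus, <- Rpower_mult, Rpower_pow by apply Rpower_pos.
replace (- (y * Rpower x nu)) with (- y * Rpower x nu) by ring.
rewrite Rpow_mult_distr; field; apply INR_fact_neq_0.
Qed.

Lemma gsub_scaled (nu b y : R) (n : nat) :
  Rpower (INR (S n)) (1 - b) * gsub nu b (y * Rpower (INR (S n)) nu) (S n) =
  Series (fun j => (- y) ^ j / INR (Factorial.fact j) * gcoef_norm (b - INR j * nu) (S n)).
Proof.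
unfold gsub; rewrite <- Series_scal_l; apply Series_ext; intros j.
apply Rpower_gcoef_norm; [reflexivity|apply lt_0_INR; lia].
Qed.

Lemma is_series_exp (x : R) : is_series (fun j => x ^ j / INR (Factorial.fact j)) (exp x).
Proof.
apply is_series_ext with (fun k => scal (pow_n x k) (/ INR (Factorial.fact k))).
- intros n; unfold scal; simpl; unfold mult; simpl; rewrite pow_n_pow; reflexivity.
- exact (is_exp_Reals x).
Qed.

Lemma sub_mul_le_2 (nu b : R) (j : nat) : 0 < nu -> b <= 2 -> b - INR j * nu <= 2.
Proof. intros Hnu Hb; pose proof (pos_INR j); nra. Qed.

Lemma ex_series_gsub (nu b L : R) (n : nat) :
  0 < nu < 1 / 2 -> 0 <= b <= 2 -> ex_series (gsub_term nu b L n).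
Proof.
intros Hnu Hb; destruct n as [|n].
- apply ex_series_ext with (fun j => (- L) ^ j / INR (Factorial.fact j)).
  + intros j; real_eq; unfold gsub_term; rewrite gcoef_0; ring.
  + eexists; apply is_series_exp.
- set (x := INR (S n)); assert (Hx : 0 < x) by (apply lt_0_INR; lia).
  set (y := L / Rpower x nu).
  assert (EL : L = y * Rpower x nu) by (unfold y; field; apply Rgt_not_eq, Rpower_pos).
  rewrite EL.
  apply ex_series_ext with (fun j => Rpower x (- (1 - b)) *
    ((- y) ^ j / INR (Factorial.fact j) * gcoef_norm (b - INR j * nu) (S n))).
  + intros j; real_eq; rewrite <- (Rpower_gcoef_norm nu b y x (S n) j eq_refl Hx), <- Rmult_assoc, <- Rpower_plus.
    rewrite Rplus_opp_l, Rpower_O by exact Hx; ring.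
  + apply (ex_series_scal (V := R_NormedModule)).
    apply (ex_series_le (V := R_CompleteNormedModule) _ (wright_majorant nu b (Rabs y)));
      [|apply ex_series_wright_majorant; [exact Hnu|lra|apply Rabs_pos]].
    intros j; apply wright_term_le; [rewrite Rabs_Ropp; lra|].
    apply gcoef_norm_le, sub_mul_le_2; lra.
Qed.

Lemma is_lim_gsub (nu b y : R) :
  0 < nu < 1 / 2 -> 0 <= b <= 2 ->
  is_lim_seq (fun n => Rpower (INR n) (1 - b) * gsub nu b (y * Rpower (INR n) nu) n)
    (Wright (- y) (- nu) b).
Proof.
intros Hnu Hb; apply is_lim_seq_incr_1.
apply is_lim_seq_ext with (fun n => Series (fun j =>
  (- y) ^ j / INR (Factorial.fact j) * gcoef_norm (b - INR j * nu) (S n))).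
- intros n; symmetry; apply gsub_scaled.
- rewrite Wright_series.
  apply is_lim_Series_dominated with (wright_majorant nu b (Rabs y)).
  + intros n j; apply wright_term_le; [rewrite Rabs_Ropp; lra|].
    apply gcoef_norm_le, sub_mul_le_2; lra.
  + apply ex_series_wright_majorant; [exact Hnu|lra|apply Rabs_pos].
  + intros j; apply is_lim_seq_mult'; [apply is_lim_seq_const|].
    apply (is_lim_seq_incr_1 (gcoef_norm (b - INR j * nu))), is_lim_gcoef_norm.
Qed.

(** Here [L] is not tied to [n]: in the convolution [L = y n^nu] belongs to the outer index, while
    the coefficient index [k] runs between [n/2] and [n]. *)
Lemma gsub_bounded (nu b Y : R) :
  0 < nu < 1 / 2 -> 0 <= b <= 2 -> 0 <= Y ->
  exists B, 0 <= B /\ forall L n, (1 <= n)%nat -> 0 <= L <= Y * Rpower (INR n) nu ->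
    Rpower (INR n) (1 - b) * gsub nu b L n <= B.
Proof.
intros Hnu Hb HY; exists (Series (wright_majorant nu b Y)).
assert (Hex : ex_series (wright_majorant nu b Y)) by (apply ex_series_wright_majorant; lra).
split.
- apply Rle_trans with (Rabs (Series (fun _ => 0))); [apply Rabs_pos|].
  apply Series_Rabs_le; [|exact Hex]; intros j; rewrite Rabs_R0; apply wright_majorant_nonneg, HY.
- intros L [|n] Hn HL; [lia|].
  set (x := INR (S n)) in *; set (y := L / Rpower x nu).
  assert (EL : L = y * Rpower x nu) by (unfold y; field; apply Rgt_not_eq, Rpower_pos).
  assert (Hy : Rabs y <= Y).
  { pose proof (Rpower_pos x nu) as Hp; rewrite Rabs_pos_eq.
    - apply (Rmult_le_reg_r (Rpower x nu)); [exact Hp|]; lra.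
    - unfold y; apply Rmult_le_pos; [lra|left; apply Rinv_0_lt_compat, Hp]. }
  rewrite EL; unfold x; rewrite gsub_scaled.
  eapply Rle_trans; [apply Rle_abs|]; apply Series_Rabs_le; [|exact Hex].
  intros j; apply wright_term_le; [rewrite Rabs_Ropp; exact Hy|].
  apply gcoef_norm_le, sub_mul_le_2; lra.
Qed.

(** Induction through a discrete product rule: the factor [n + 1] is split as [k + (n + 1 - k)], and
    [gcoef_S], the coefficient form of [(1 - z) u' = a u], is applied to each half. Both halves
    become multiples of the sum at [n], with total factor [a + b + n]. *)
Lemma gcoef_vandermonde (a b : R) (n : nat) :
  sum_f_R0 (fun k => gcoef a k * gcoef b (n - k)) n = gcoef (a + b) n.
Proof.
induction n as [|n IH]; [simpl; rewrite !gcoef_0; ring|].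
apply (Rmult_eq_reg_l (INR (S n))); [|apply not_0_INR; lia].
rewrite gcoef_S, <- IH.
rewrite scal_sum.
rewrite (sum_eq _ (fun k => INR k * gcoef a k * gcoef b (S n - k) +
  gcoef a k * (INR (S n - k) * gcoef b (S n - k)))) by (intros k Hk; rewrite minus_INR by lia; ring).
rewrite sum_plus, decomp_sum by lia; simpl pred; rewrite (tech5 _ n), Nat.sub_diag.
simpl (INR 0); rewrite (sum_eq _ (fun k => (a + INR k) * (gcoef a k * gcoef b (n - k)))).
2:{ intros k Hk; rewrite gcoef_S; simpl (S n - S k)%nat; ring. }
rewrite (sum_eq (fun k => gcoef a k * (INR (S n - k) * gcoef b (S n - k)))
  (fun k => (b + INR n - INR k) * (gcoef a k * gcoef b (n - k)))).
2:{ intros k Hk; replace (S n - k)%nat with (S (n - k)) by lia.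
    rewrite gcoef_S, minus_INR by lia; ring. }
rewrite !Rmult_0_l, Rmult_0_r, Rplus_0_l, Rplus_0_r, <- sum_plus, scal_sum.
apply sum_eq; intros k Hk; ring.
Qed.

Lemma is_series_sum_f_R0 (u : nat -> nat -> R) (s : nat -> R) (n : nat) :
  (forall k, is_series (u k) (s k)) ->
  is_series (fun j => sum_f_R0 (fun k => u k j) n) (sum_f_R0 s n).
Proof.
intros H; induction n as [|n IH]; simpl; [apply H|].
apply (is_series_plus (V := R_NormedModule)); [exact IH|apply H].
Qed.

Lemma gsub_convolution (nu b c L : R) (n : nat) :
  0 < nu < 1 / 2 -> 0 <= b <= 2 ->
  sum_f_R0 (fun k => gsub nu b L k * gcoef c (n - k)) n = gsub nu (b + c) L n.
Proof.
intros Hnu Hb; symmetry; apply is_series_unique.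
apply is_series_ext with (fun j => sum_f_R0 (fun k => gsub_term nu b L k j * gcoef c (n - k)) n).
- intros j; real_eq; unfold gsub_term.
  replace (b + c - INR j * nu) with (b - INR j * nu + c) by ring.
  rewrite <- gcoef_vandermonde, scal_sum; apply sum_eq; intros; ring.
- apply is_series_sum_f_R0; intros k.
  apply (is_series_scal_r (gcoef c (n - k))), Series_correct, ex_series_gsub; assumption.
Qed.

(** Coefficient form of [d/dz exp (- L (1-z)^nu) = nu L (1-z)^(nu-1) exp (- L (1-z)^nu)]. The term
    [j = 0] drops out because [(1-z)^0] has no coefficient of positive index. *)
Lemma gsub_0_S (nu L : R) (n : nat) :
  0 < nu < 1 / 2 ->
  INR (S n) * gsub nu 0 L (S n) = nu * L * gsub nu (1 - nu) L n.
Proof.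
intros Hnu; unfold gsub; rewrite <- !Series_scal_l.
rewrite Series_incr_1.
2:{ apply (ex_series_scal (V := R_NormedModule)), ex_series_gsub; lra. }
rewrite (Series_ext _ (fun j => nu * L * gsub_term nu (1 - nu) L n j)).
- replace (INR (S n) * gsub_term nu 0 L (S n) 0) with 0; [ring|].
  unfold gsub_term; pose proof (gcoef_S_shift (0 - INR 0 * nu) n) as E; simpl INR in E at 2 3.
  rewrite <- (Rmult_1_l (INR (S n))); simpl pow; simpl Factorial.fact; simpl (INR 1).
  transitivity (INR (S n) * gcoef (0 - INR 0 * nu) (S n)); [|field].
  rewrite gcoef_S_shift; simpl (INR 0); ring.
- intros j; real_eq; unfold gsub_term.
  transitivity ((- L) ^ S j / INR (Factorial.fact (S j)) *
    (INR (S n) * gcoef (0 - INR (S j) * nu) (S n))); [ring|].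
  rewrite gcoef_S_shift; replace (0 - INR (S j) * nu + 1) with (1 - nu - INR j * nu)
    by (rewrite S_INR; ring).
  rewrite fact_simpl, mult_INR; simpl pow.
  field; split; [apply INR_fact_neq_0|apply not_0_INR; lia].
Qed.

Lemma gsub_0_0 (nu L : R) : gsub nu 0 L 0 = exp (- L).
Proof.
apply is_series_unique; apply is_series_ext with (2 := is_series_exp (- L)).
intros j; real_eq; unfold gsub_term; rewrite gcoef_0; ring.
Qed.

(* Differentiating [exp (- L (1 - z)^nu)] gives a recurrence with nonnegative coefficients. *)
Lemma gsub_0_nonneg (nu L : R) (n : nat) : 0 < nu < 1 / 2 -> 0 <= L -> 0 <= gsub nu 0 L n.
Proof.
intros Hnu HL; induction n as [n IH] using (well_founded_induction Wf_nat.lt_wf).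
destruct n as [|n]; [rewrite gsub_0_0; left; apply exp_pos|].
apply (Rmult_le_reg_l (INR (S n))); [apply lt_0_INR; lia|].
rewrite Rmult_0_r, gsub_0_S by exact Hnu.
apply Rmult_le_pos; [nra|].
replace (1 - nu) with (0 + (1 - nu)) by ring.
rewrite <- gsub_convolution by lra; apply sum_f_R0_nonneg.
intros k Hk; apply Rmult_le_pos; [apply IH; lia|apply gcoef_nonneg; lra].
Qed.

Lemma gsub_nonneg (nu b L : R) (n : nat) :
  0 < nu < 1 / 2 -> 0 <= b -> 0 <= L -> 0 <= gsub nu b L n.
Proof.
intros Hnu Hb HL; rewrite <- (Rplus_0_l b), <- gsub_convolution by lra.
apply sum_f_R0_nonneg; intros k Hk.
apply Rmult_le_pos; [apply gsub_0_nonneg; assumption|apply gcoef_nonneg; lra].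
Qed.

Lemma Wright_nonneg (nu b y : R) :
  0 < nu < 1 / 2 -> 0 <= b <= 2 -> 0 <= y -> 0 <= Wright (- y) (- nu) b.
Proof.
intros Hnu Hb Hy; change (Rbar_le 0 (Wright (- y) (- nu) b)).
apply is_lim_seq_le with (2 := is_lim_seq_const 0) (3 := is_lim_gsub nu b y Hnu Hb).
intros n; apply Rmult_le_pos; [apply Rpower_ge_0|].
apply gsub_nonneg; [exact Hnu|lra|]; apply Rmult_le_pos; [exact Hy|apply Rpower_ge_0].
Qed.

(** * Monotonicity of the Wright and Mainardi functions *)

Definition wright_coef (nu b : R) (j : nat) : R := rgamma (b - INR j * nu) / INR (Factorial.fact j).

Lemma Wright_PSeries (nu b z : R) : Wright z (- nu) b = PSeries (wright_coef nu b) z.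
Proof.
rewrite Wright_series; apply Series_ext; intros j; unfold wright_coef, Rdiv; ring.
Qed.

Lemma wright_coef_entire (nu b X : R) :
  0 < nu < 1 / 2 -> 0 <= b <= 2 -> 0 <= X ->
  exists C, 0 <= C /\ forall j, Rabs (wright_coef nu b j) * X ^ j <= C.
Proof.
intros Hnu Hb HX.
destruct (majorant_term_bounded nu b X Hnu (proj1 Hb) HX) as [C [HC1 HC]].
exists C; split; [lra|]; intros j; apply Rle_trans with (2 := HC j).
unfold wright_coef, Rdiv; rewrite Rabs_mult, (Rabs_pos_eq (/ _))
  by (left; apply Rinv_0_lt_compat, INR_fact_lt_0).
rewrite Rmult_comm, Rmult_comm with (r2 := / _), <- Rmult_assoc.
apply Rmult_le_compat_l.
- apply Rmult_le_pos; [apply pow_le, HX|left; apply Rinv_0_lt_compat, INR_fact_lt_0].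
- apply rgamma_le, sub_mul_le_2; lra.
Qed.

Lemma CV_radius_entire (a : nat -> R) :
  (forall X, 0 <= X -> exists C, forall j, Rabs (a j) * X ^ j <= C) -> CV_radius a = p_infty.
Proof.
intros H; destruct (CV_radius_bounded a) as [Hub _].
assert (H1 : forall X, 0 <= X -> Rbar_le X (CV_radius a)).
{ intros X HX; apply Hub; destruct (H X HX) as [C HC]; exists C; intros j.
  rewrite Rabs_mult, <- RPow_abs, (Rabs_pos_eq X HX); apply HC. }
destruct (CV_radius a) as [r| |]; [|reflexivity|destruct (H1 0 (Rle_refl 0))].
exfalso; specialize (H1 (Rabs r + 1)); pose proof (Rabs_pos r); pose proof (Rle_abs r).
simpl in H1; assert (Rabs r + 1 <= r) by (apply H1; lra); lra.
Qed.

Lemma CV_radius_wright (nu b : R) :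
  0 < nu < 1 / 2 -> 0 <= b <= 2 -> CV_radius (wright_coef nu b) = p_infty.
Proof.
intros Hnu Hb; apply CV_radius_entire; intros X HX.
destruct (wright_coef_entire nu b X Hnu Hb HX) as [C [_ HC]]; exists C; exact HC.
Qed.

Lemma is_derive_Wright (nu b z : R) :
  0 < nu < 1 / 2 -> 0 <= b <= 2 ->
  is_derive (fun z => Wright z (- nu) b) z (Wright z (- nu) (b - nu)).
Proof.
intros Hnu Hb; apply is_derive_ext with (PSeries (wright_coef nu b)).
- intros t; symmetry; apply Wright_PSeries.
- rewrite Wright_PSeries.
  replace (PSeries (wright_coef nu (b - nu)) z) with (PSeries (PS_derive (wright_coef nu b)) z).
  + apply is_derive_PSeries; rewrite CV_radius_wright by assumption; exact Logic.I.
  + apply PSeries_ext; intros j; unfold PS_derive, wright_coef.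
    replace (b - nu - INR j * nu) with (b - INR (S j) * nu) by (rewrite S_INR; ring).
    rewrite fact_simpl, mult_INR; field; split; [apply INR_fact_neq_0|apply not_0_INR; lia].
Qed.

Lemma is_derive_Wright_opp (nu b y : R) :
  0 < nu < 1 / 2 -> 0 <= b <= 2 ->
  is_derive (fun y => Wright (- y) (- nu) b) y (- Wright (- y) (- nu) (b - nu)).
Proof.
intros Hnu Hb.
replace (- Wright (- y) (- nu) (b - nu)) with (scal (-1) (Wright (- y) (- nu) (b - nu)))
  by (unfold scal; simpl; unfold mult; simpl; ring).
apply (is_derive_comp (fun z => Wright z (- nu) b) Ropp).
- apply is_derive_Wright; assumption.
- auto_derive; [exact Logic.I|ring].
Qed.

Lemma Wright_0 (nu b : R) : Wright 0 (- nu) b = rgamma b.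
Proof.
rewrite Wright_PSeries, PSeries_0; unfold wright_coef; simpl.
replace (b - 0 * nu) with b by ring; field.
Qed.

Lemma Wright_opp_mvt (nu b u v : R) :
  0 < nu < 1 / 2 -> 0 <= b <= 2 -> u < v ->
  exists w, u < w < v /\
    Wright (- u) (- nu) b - Wright (- v) (- nu) b = Wright (- w) (- nu) (b - nu) * (v - u).
Proof.
intros Hnu Hb Huv.
destruct (MVT_cor2 (fun y => Wright (- y) (- nu) b) (fun y => - Wright (- y) (- nu) (b - nu)) u v Huv)
  as [w [E Hw]].
- intros c _; apply is_derive_Reals, is_derive_Wright_opp; assumption.
- exists w; split; [exact Hw|lra].
Qed.

Lemma Wright_decreasing (nu b u v : R) :
  0 < nu < 1 / 2 -> nu <= b <= 2 -> 0 <= u <= v ->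
  Wright (- v) (- nu) b <= Wright (- u) (- nu) b.
Proof.
intros Hnu Hb Huv; destruct (Req_dec u v) as [->|Hne]; [lra|].
destruct (Wright_opp_mvt nu b u v) as [w [Hw E]]; try lra.
assert (0 <= Wright (- w) (- nu) (b - nu)) by (apply Wright_nonneg; lra).
assert (0 <= Wright (- w) (- nu) (b - nu) * (v - u)) by (apply Rmult_le_pos; lra); lra.
Qed.

Lemma Wright_le_rgamma (nu b y : R) :
  0 < nu < 1 / 2 -> nu <= b <= 2 -> 0 <= y -> Wright (- y) (- nu) b <= rgamma b.
Proof.
intros Hnu Hb Hy; rewrite <- (Wright_0 nu), <- Ropp_0 at 1; apply Wright_decreasing; lra.
Qed.

(** The function at [b] is decreasing and is minus the derivative of the one at [b + nu], so [y]
    times its value at [y] is at most the total drop of the latter, hence at most its value at [0].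
    This gives decay of order [1/y]. *)
Lemma Wright_mul_le (nu b y : R) :
  0 < nu < 1 / 2 -> nu <= b <= 2 - nu -> 0 <= y ->
  y * Wright (- y) (- nu) b <= rgamma (b + nu).
Proof.
intros Hnu Hb [Hy|<-].
- destruct (Wright_opp_mvt nu (b + nu) 0 y) as [w [Hw E]]; try lra.
  replace (b + nu - nu) with b in E by ring; rewrite Ropp_0, Wright_0, Rminus_0_r in E.
  assert (Wright (- y) (- nu) b <= Wright (- w) (- nu) b) by (apply Wright_decreasing; lra).
  assert (0 <= Wright (- y) (- nu) (b + nu)) by (apply Wright_nonneg; lra).
  nra.
- rewrite Rmult_0_l, rgamma_pos by lra; left; apply Rinv_0_lt_compat, Gamma_pos; lra.
Qed.

(** Pascal's rule: [(s + 1)!] is written as [(k + 1) s! + (n + 1) s!], and each part falls under the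
    induction hypothesis. *)
Lemma fact_add_le (k n : nat) :
  (Factorial.fact (k + n) <= 2 ^ (k + n) * (Factorial.fact k * Factorial.fact n))%nat.
Proof.
remember (k + n)%nat as s eqn:E; revert k n E; induction s as [|s IH]; intros k n E.
- assert (k = 0 /\ n = 0)%nat as [-> ->] by lia; simpl; lia.
- destruct k as [|k]; [simpl in E; subst n; simpl Factorial.fact at 2; 
    pose proof (Nat.pow_nonzero 2 (S s)); nia|].
  destruct n as [|n]; [rewrite Nat.add_0_r in E; rewrite <- E; simpl Factorial.fact at 3;
    pose proof (Nat.pow_nonzero 2 (S s)); nia|].
  pose proof (IH k (S n) ltac:(lia)) as H1; pose proof (IH (S k) n ltac:(lia)) as H2.
  rewrite fact_simpl, Nat.pow_succ_r'.
  replace (S s) with (S k + S n)%nat by lia.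
  rewrite Nat.mul_add_distr_r.
  apply Nat.le_trans with (S k * (2 ^ s * (Factorial.fact k * Factorial.fact (S n))) +
    S n * (2 ^ s * (Factorial.fact (S k) * Factorial.fact n)))%nat.
  + apply Nat.add_le_mono; apply Nat.mul_le_mono_l; assumption.
  + rewrite !fact_simpl; nia.
Qed.

(** A Cauchy estimate. Division by [n!] turns the factors of the differentiated series into binomial
    coefficients, at most [2^(k+n)]; having control at radius [4 r] absorbs these and leaves
    [(1/2)^(k+n)], to be summed over [k]. *)
Lemma PSeries_derive_n_bound (a : nat -> R) (C r z : R) (n : nat) :
  0 <= r -> Rabs z <= r -> (forall j, Rabs (a j) * (4 * r) ^ j <= C) ->
  r ^ n / INR (Factorial.fact n) * Rabs (PSeries (PS_derive_n n a) z) <= 2 * C * (/ 2) ^ n.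
Proof.
intros Hr Hz HC.
assert (Hf : 0 <= r ^ n / INR (Factorial.fact n)).
{ apply Rmult_le_pos; [apply pow_le, Hr|left; apply Rinv_0_lt_compat, INR_fact_lt_0]. }
rewrite <- (Rabs_pos_eq _ Hf), <- Rabs_mult; unfold PSeries; rewrite <- Series_scal_l.
replace (2 * C * (/ 2) ^ n) with (Series (fun k => C * (/ 2) ^ n * (/ 2) ^ k)).
2:{ rewrite Series_scal_l, Series_geom by (rewrite Rabs_pos_eq; lra); field. }
apply Series_Rabs_le.
2:{ apply (ex_series_scal (V := R_NormedModule)), ex_series_geom; rewrite Rabs_pos_eq; lra. }
intros k; unfold PS_derive_n.
rewrite !Rabs_mult, (Rabs_pos_eq _ Hf), <- RPow_abs.
assert (Hq : 0 <= INR (Factorial.fact (k + n)) / INR (Factorial.fact k)).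
{ left; apply Rdiv_lt_0_compat; apply INR_fact_lt_0. }
replace (n + k)%nat with (k + n)%nat by lia.
rewrite (Rabs_pos_eq _ Hq).
assert (Hc : INR (Factorial.fact (k + n)) / INR (Factorial.fact k) / INR (Factorial.fact n) <= 2 ^ (k + n)).
{ pose proof (INR_fact_lt_0 k); pose proof (INR_fact_lt_0 n).
  apply (Rmult_le_reg_r (INR (Factorial.fact k) * INR (Factorial.fact n))); [apply Rmult_lt_0_compat; assumption|].
  replace (INR (Factorial.fact (k + n)) / INR (Factorial.fact k) / INR (Factorial.fact n) *
    (INR (Factorial.fact k) * INR (Factorial.fact n))) with (INR (Factorial.fact (k + n))) by (field; lra).
  rewrite <- mult_INR; change 2 with (INR 2); rewrite <- pow_INR, <- mult_INR.
  apply le_INR, fact_add_le. }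
apply Rle_trans with (r ^ n / INR (Factorial.fact n) *
  (INR (Factorial.fact (k + n)) / INR (Factorial.fact k) * Rabs (a (k + n)%nat) * r ^ k)).
- apply Rmult_le_compat_l; [exact Hf|]; apply Rmult_le_compat_l.
  + apply Rmult_le_pos; [exact Hq|apply Rabs_pos].
  + apply pow_incr; split; [apply Rabs_pos|exact Hz].
- apply Rle_trans with (2 ^ (k + n) * (Rabs (a (k + n)%nat) * r ^ (k + n))).
  + replace (r ^ n / INR (Factorial.fact n) *
      (INR (Factorial.fact (k + n)) / INR (Factorial.fact k) * Rabs (a (k + n)%nat) * r ^ k))
      with (INR (Factorial.fact (k + n)) / INR (Factorial.fact k) / INR (Factorial.fact n) *
        (Rabs (a (k + n)%nat) * r ^ (k + n))).
    * apply Rmult_le_compat_r; [|exact Hc]; apply Rmult_le_pos; [apply Rabs_pos|apply pow_le, Hr].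
    * rewrite pow_add; field; split; apply INR_fact_neq_0.
  + specialize (HC (k + n)%nat).
    replace (2 ^ (k + n) * (Rabs (a (k + n)%nat) * r ^ (k + n)))
      with (Rabs (a (k + n)%nat) * (4 * r) ^ (k + n) * ((/ 2) ^ n * (/ 2) ^ k)).
    * rewrite (Rmult_assoc C); apply Rmult_le_compat_r; [|exact HC].
      apply Rmult_le_pos; apply pow_le; lra.
    * assert (E : (4 * r) ^ (k + n) * (/ 2) ^ (k + n) = 2 ^ (k + n) * r ^ (k + n))
        by (rewrite <- !Rpow_mult_distr; f_equal; field).
      rewrite <- pow_add, (Nat.add_comm n k), Rmult_assoc, E; ring.
Qed.

(* All derivatives vanish at [z0], and the Taylor remainders at [0] tend to zero. *)
Lemma PSeries_locally_zero (a : nat -> R) (z0 : R) :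
  (forall X, 0 <= X -> exists C, forall j, Rabs (a j) * X ^ j <= C) ->
  z0 < 0 -> locally z0 (fun z => PSeries a z = 0) -> PSeries a 0 = 0.
Proof.
intros Ha Hz0 Hloc.
assert (HR : CV_radius a = p_infty) by (apply CV_radius_entire, Ha).
destruct (Ha (4 * - z0) ltac:(lra)) as [C HC].
assert (HT : forall n, Rabs (PSeries a 0) <= 2 * C * (/ 2) ^ S n).
{ intros n.
  assert (Hex : forall t k, ex_derive_n (PSeries a) k t)
    by (intros t k; apply ex_derive_n_PSeries; rewrite HR; exact Logic.I).
  destruct (Taylor_Lagrange (PSeries a) n z0 0 Hz0) as [zeta [Hzeta E]]; [intros; apply Hex|].
  assert (Hzero : forall k, Derive_n (PSeries a) k z0 = 0).
  { intros k; rewrite (Derive_n_ext_loc _ (fun _ => 0) k z0 Hloc).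
    destruct k as [|k]; [reflexivity|apply Derive_n_const]. }
  rewrite (sum_eq _ (fun _ => 0)), sum_cte, Rmult_0_l, Rplus_0_l in E
    by (intros; rewrite Hzero; ring).
  rewrite E, Derive_n_PSeries by (rewrite HR; exact Logic.I).
  rewrite Rminus_0_l, Rabs_mult, Rabs_pos_eq.
  - apply PSeries_derive_n_bound; [lra| |exact HC].
    rewrite Rabs_left; lra.
  - apply Rmult_le_pos; [apply pow_le; lra|left; apply Rinv_0_lt_compat, INR_fact_lt_0]. }
assert (H0 : Rbar_le (Rabs (PSeries a 0)) (2 * C * 0)).
{ apply is_lim_seq_le with (fun _ => Rabs (PSeries a 0)) (fun n => 2 * C * (/ 2) ^ S n);
    [exact HT|apply is_lim_seq_const|].
  apply is_lim_seq_mult'; [apply is_lim_seq_const|].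
  apply (is_lim_seq_incr_1 (fun n => (/ 2) ^ n)), is_lim_seq_geom; rewrite Rabs_pos_eq; lra. }
simpl in H0; pose proof (Rabs_pos (PSeries a 0)).
apply Rabs_eq_0; lra.
Qed.

(** Otherwise monotonicity makes the function constant between [u] and [v], so the Wright function
    of index [1 - 2 nu] vanishes on an interval. By [PSeries_locally_zero] it then vanishes at [0],
    where its value is [1 / Gamma (1 - 2 nu) > 0]. *)
Lemma Mainardi_strictly_decreasing (nu u v : R) :
  0 < nu < 1 / 2 -> 0 <= u < v -> Mainardi nu v < Mainardi nu u.
Proof.
intros Hnu Huv; unfold Mainardi; apply Rnot_le_lt; intros H.
assert (Hconst : forall x, u < x < v -> Wright (- x) (- nu) (1 - nu) = Wright (- u) (- nu) (1 - nu)).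
{ intros x Hx; apply Rle_antisym; [apply Wright_decreasing; lra|].
  apply Rle_trans with (1 := H); apply Wright_decreasing; lra. }
assert (Hz : forall x, u < x < v -> Wright (- x) (- nu) (1 - nu - nu) = 0).
{ intros x Hx.
  pose proof (is_derive_Wright_opp nu (1 - nu) x Hnu ltac:(lra)) as H1.
  assert (H2 : is_derive (fun y => Wright (- y) (- nu) (1 - nu)) x 0).
  { apply is_derive_ext_loc with (fun _ => Wright (- u) (- nu) (1 - nu)); [|apply (is_derive_const (V := R_NormedModule))].
    apply (locally_interval _ x u v); simpl; [lra|lra|].
    intros y Hy1 Hy2; symmetry; apply Hconst; simpl in *; lra. }
  apply is_derive_unique in H1; apply is_derive_unique in H2; lra. }
set (b := 1 - nu - nu) in *.
assert (H0 : PSeries (wright_coef nu b) 0 = 0).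
{ apply (PSeries_locally_zero _ (- ((u + v) / 2))); [|lra|].
  - intros X HX; destruct (wright_coef_entire nu b X Hnu ltac:(unfold b; lra) HX) as [C [_ HC]].
    exists C; exact HC.
  - apply (locally_interval _ (- ((u + v) / 2)) (- v) (- u)); simpl; [lra|lra|].
    intros z Hz1 Hz2; simpl in *; rewrite <- Wright_PSeries.
    replace z with (- - z) by ring; apply Hz; lra. }
rewrite <- Wright_PSeries, Wright_0, rgamma_pos in H0 by (unfold b; lra).
pose proof (Rinv_0_lt_compat _ (Gamma_pos b ltac:(unfold b; lra))); lra.
Qed.

Lemma Mainardi_nonneg (nu x : R) : 0 < nu < 1 / 2 -> 0 <= x -> 0 <= Mainardi nu x.
Proof. intros Hnu Hx; unfold Mainardi; apply Wright_nonneg; [exact Hnu|lra|exact Hx]. Qed.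

Lemma Mainardi_pos (nu x : R) : 0 < nu < 1 / 2 -> 0 <= x -> 0 < Mainardi nu x.
Proof.
intros Hnu Hx.
pose proof (Mainardi_strictly_decreasing nu x (x + 1) Hnu ltac:(lra)).
pose proof (Mainardi_nonneg nu (x + 1) Hnu ltac:(lra)).
lra.
Qed.

(** * Discrete convolutions *)

Lemma gcoef_succ_sum (a : R) (n : nat) : gcoef (a + 1) (S n) = gcoef (a + 1) n + gcoef a (S n).
Proof.
assert (INR (S n) <> 0) by (apply not_0_INR; lia).
apply (Rmult_eq_reg_l (INR (S n))); [|assumption].
rewrite Rmult_plus_distr_l, (gcoef_S (a + 1)), (gcoef_S_shift a), S_INR; ring.
Qed.

(** The index [n] fixes the kernel and [v] truncates the sum, so differences in [v] isolate blocks
    of one and the same convolution. *)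
Definition gconv (mu : R) (q : nat -> R) (n v : nat) : R :=
  sum_f_R0 (fun k => q k * gcoef mu (n - k)) v.

(** Since [mu <= 1], the kernel [gcoef mu (n - k)] increases with [k] and lies on the block between
    its values at the two ends. *)
Lemma gconv_block (mu : R) (q : nat -> R) (n u v : nat) :
  0 <= mu <= 1 -> (forall k, 0 <= q k) -> (u <= v)%nat -> (v <= n)%nat ->
  0 <= sum_f_R0 q v - sum_f_R0 q u /\
  gcoef mu (n - u) * (sum_f_R0 q v - sum_f_R0 q u) <= gconv mu q n v - gconv mu q n u
    <= gcoef mu (n - v) * (sum_f_R0 q v - sum_f_R0 q u).
Proof.
intros Hmu Hq Huv; induction Huv as [|v Huv IH]; intros Hvn; [lra|].
destruct (IH ltac:(lia)) as [H0 [H1 H2]].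
unfold gconv in *; simpl sum_f_R0; pose proof (Hq (S v)) as Hv.
pose proof (gcoef_decreasing mu (n - S v) (n - u) Hmu ltac:(lia)).
pose proof (gcoef_decreasing mu (n - S v) (n - v) Hmu ltac:(lia)).
split; [lra|split; nra].
Qed.

(** Near [k = n] the limiting kernel may be singular, so the roles are exchanged: [q] is bounded by
    [D] and the kernel is summed exactly, [gcoef mu 0 + ... + gcoef mu r = gcoef (mu + 1) r]. *)
Lemma gconv_last_block (mu D : R) (q : nat -> R) (n r : nat) :
  0 <= mu -> 0 <= D -> (S r <= n)%nat -> (forall k, (n - S r < k <= n)%nat -> q k <= D) ->
  gconv mu q n n - gconv mu q n (n - S r) <= D * gcoef (mu + 1) r.
Proof.
intros Hmu HD; induction r as [|r IH]; intros Hr Hq.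
- destruct n as [|n]; [lia|]; replace (S n - 1)%nat with n by lia.
  unfold gconv; simpl sum_f_R0; rewrite Nat.sub_diag, !gcoef_0.
  specialize (Hq (S n) ltac:(lia)); lra.
- assert (H := IH ltac:(lia) ltac:(intros; apply Hq; lia)).
  rewrite gcoef_succ_sum.
  assert (E : gconv mu q n (n - S r) = gconv mu q n (n - S (S r)) + q (n - S r)%nat * gcoef mu (S r)).
  { unfold gconv; replace (n - S r)%nat with (S (n - S (S r))) by lia; simpl sum_f_R0.
    replace (n - S (n - S (S r)))%nat with (S r) by lia; reflexivity. }
  pose proof (gcoef_nonneg mu (S r) Hmu).
  pose proof (Hq (n - S r)%nat ltac:(lia)); nra.
Qed.

Lemma filterlim_mul_S (i : nat) : (1 <= i)%nat -> filterlim (fun r => (i * S r)%nat) eventually eventually.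
Proof. intros Hi P [N HN]; exists N; intros n Hn; apply HN; nia. Qed.

Lemma is_lim_gcoef_scaled (a : R) (i p : nat) :
  (1 <= i)%nat -> (1 <= p)%nat ->
  is_lim_seq (fun r => Rpower (INR (p * S r)) (1 - a) * gcoef a (i * S r))
    (rgamma a * Rpower (INR i / INR p) (a - 1)).
Proof.
intros Hi Hp.
assert (Hi' : 0 < INR i) by (apply lt_0_INR; lia).
assert (Hp' : 0 < INR p) by (apply lt_0_INR; lia).
apply is_lim_seq_ext with (fun r => gcoef_norm a (i * S r) * Rpower (INR i / INR p) (a - 1)).
- intros r; unfold gcoef_norm.
  assert (Hr : 0 < INR (S r)) by (apply lt_0_INR; lia).
  assert (E : Rpower (INR (i * S r)) (1 - a) * Rpower (INR i / INR p) (a - 1) = Rpower (INR (p * S r)) (1 - a)).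
  { replace (a - 1) with (- (1 - a)) by ring.
    rewrite <- Rpower_Rinv_l by (apply Rdiv_lt_0_compat; assumption).
    rewrite !mult_INR, Rpower_mult_distr by
      (try apply Rinv_0_lt_compat; try apply Rdiv_lt_0_compat; try apply Rmult_lt_0_compat; assumption).
    f_equal; field; lra. }
  rewrite <- E; ring.
- apply is_lim_seq_mult'; [|apply is_lim_seq_const].
  apply (is_lim_seq_subseq (gcoef_norm a)); [apply filterlim_mul_S, Hi|apply is_lim_gcoef_norm].
Qed.

Lemma sum_f_R0_telescope (u : nat -> R) (m : nat) :
  sum_f_R0 (fun i => u (S i) - u i) m = u (S m) - u 0%nat.
Proof. induction m as [|m IH]; simpl; [ring|rewrite IH; ring]. Qed.

Lemma sum_f_R0_scal_l (c : R) (u : nat -> R) (m : nat) :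
  sum_f_R0 (fun i => c * u i) m = c * sum_f_R0 u m.
Proof. rewrite scal_sum; apply sum_eq; intros; ring. Qed.

(* Splits [0..n], [n = p r], into [p] blocks; on all but the last one the kernel [gcoef mu (n - k)]
   is monotone and converges, after rescaling, to [(1 - tau)^(mu - 1) / Gamma mu]. *)
Lemma gconv_limit_sandwich (mu V C : R) (q : nat -> nat -> R) (F : R -> R) :
  0 < mu <= 1 -> (forall n k, 0 <= q n k) -> F 0 = 0 ->
  (forall p i, (1 <= p)%nat -> (i <= p)%nat ->
     is_lim_seq (fun r => sum_f_R0 (q (p * S r)%nat) (i * S r)) (F (INR i / INR p))) ->
  is_lim_seq (fun n => Rpower (INR n) (1 - mu) * gconv mu (q n) n n) V ->
  0 <= C -> (forall n k, (1 <= n)%nat -> (n <= 2 * k)%nat -> (k <= n)%nat -> INR n * q n k <= C) ->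
  forall m, let p := INR (S (S m)) in
  rgamma mu * sum_f_R0 (fun i => (F (INR (S i) / p) - F (INR i / p)) * Rpower (1 - INR i / p) (mu - 1)) m <= V
  /\ V <= rgamma mu * sum_f_R0 (fun i => (F (INR (S i) / p) - F (INR i / p)) * Rpower (1 - INR (S i) / p) (mu - 1)) m
     + C * rgamma (mu + 1) * Rpower p (- mu).
Proof.
intros Hmu Hq HF0 H1 H2 HC H3 m p.
set (pn := S (S m)) in *.
assert (Hp : 0 < p) by (apply lt_0_INR; unfold pn; lia).
set (n := fun r => (pn * S r)%nat).
assert (HV : is_lim_seq (fun r => Rpower (INR (n r)) (1 - mu) * gconv mu (q (n r)) (n r) (n r)) V).
{ apply (is_lim_seq_subseq (fun n => Rpower (INR n) (1 - mu) * gconv mu (q n) n n)); [|exact H2].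
  apply filterlim_mul_S; unfold pn; lia. }
(* The blocks are open on the left, so the single term [k = 0] is left over. It tends to [0] by the
   case [i = 0] of [H1], since [F 0 = 0]. *)
assert (HT0 : is_lim_seq (fun r => Rpower (INR (n r)) (1 - mu) * gconv mu (q (n r)) (n r) 0) 0).
{ apply is_lim_seq_ext with (fun r => sum_f_R0 (q (n r)) (0 * S r) *
    (Rpower (INR (pn * S r)) (1 - mu) * gcoef mu (pn * S r))).
  - intros r; unfold gconv, n; rewrite Nat.mul_0_l; cbn [sum_f_R0]; rewrite Nat.sub_0_r; ring.
  - replace (Finite 0) with (Finite (F (INR 0 / INR pn) * (rgamma mu * Rpower (INR pn / INR pn) (mu - 1)))).
    + apply is_lim_seq_mult'; [apply H1|apply is_lim_gcoef_scaled]; unfold pn; lia.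
    + simpl (INR 0); unfold Rdiv at 1; rewrite Rmult_0_l, HF0, Rmult_0_l; reflexivity. }
set (G := fun r i => gconv mu (q (n r)) (n r) (i * S r)).
set (P := fun r i => sum_f_R0 (q (n r)) (i * S r)).
assert (Hblock : forall r i, (i <= m)%nat ->
  0 <= P r (S i) - P r i /\
  gcoef mu ((pn - i) * S r) * (P r (S i) - P r i) <= G r (S i) - G r i
    <= gcoef mu ((pn - S i) * S r) * (P r (S i) - P r i)).
{ intros r i Hi; rewrite !Nat.mul_sub_distr_r.
  apply gconv_block; [lra|apply Hq|nia|unfold n, pn; nia]. }
assert (Hw : forall r, 0 < Rpower (INR (n r)) (1 - mu)) by (intros; apply Rpower_pos).
assert (HG0 : forall r, 0 <= gconv mu (q (n r)) (n r) 0).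
{ intros r; apply Rmult_le_pos; [apply Hq|apply gcoef_nonneg; lra]. }
assert (Htel : forall r, gconv mu (q (n r)) (n r) (S m * S r) =
  gconv mu (q (n r)) (n r) 0 + sum_f_R0 (fun i => G r (S i) - G r i) m).
{ intros r; rewrite (sum_f_R0_telescope (G r)); unfold G; simpl (0 * S r)%nat; ring. }
assert (HlimP : forall i, (i <= m)%nat ->
  is_lim_seq (fun r => P r (S i) - P r i) (F (INR (S i) / p) - F (INR i / p))).
{ intros i Hi; apply is_lim_seq_minus'; apply H1; unfold pn; lia. }
assert (Hkernel : forall i, (i <= S m)%nat ->
  is_lim_seq (fun r => Rpower (INR (n r)) (1 - mu) * gcoef mu ((pn - i) * S r))
    (rgamma mu * Rpower (1 - INR i / p) (mu - 1))).
{ intros i Hi; replace (1 - INR i / p) with (INR (pn - i) / INR pn).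
  - apply is_lim_gcoef_scaled; unfold pn; lia.
  - rewrite minus_INR by (unfold pn; lia); fold p; field; lra. }
(* The last block has length [n / p] with [p >= 2], so [n <= 2 k] holds on it and [H3] bounds [q] by
   [C / n]. *)
assert (Hlast : forall r, gconv mu (q (n r)) (n r) (n r) - gconv mu (q (n r)) (n r) (S m * S r)
   <= C / INR (n r) * gcoef (mu + 1) (S r)).
{ intros r; assert (Hn : 0 < INR (n r)) by (apply lt_0_INR; unfold n, pn; lia).
  assert (HD : 0 <= C / INR (n r)) by (apply Rmult_le_pos; [exact HC|left; apply Rinv_0_lt_compat, Hn]).
  replace (S m * S r)%nat with (n r - S r)%nat by (unfold n, pn; nia).
  eapply Rle_trans.
  - apply (gconv_last_block mu (C / INR (n r))); [lra|exact HD|unfold n, pn; nia|].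
    intros k Hk; apply (Rmult_le_reg_l (INR (n r))); [exact Hn|].
    replace (INR (n r) * (C / INR (n r))) with C by (field; lra).
    apply H3; unfold n, pn in *; nia.
  - apply Rmult_le_compat_l; [exact HD|]; rewrite gcoef_succ_sum.
    pose proof (gcoef_nonneg mu (S r) ltac:(lra)); lra. }
assert (HGn : forall r, 0 <= gconv mu (q (n r)) (n r) (n r) - gconv mu (q (n r)) (n r) (S m * S r)).
{ intros r.
  destruct (gconv_block mu (q (n r)) (n r) (S m * S r) (n r)) as [H4 [H5 _]];
    [lra|apply Hq|unfold n, pn; nia|lia|].
  eapply Rle_trans; [|exact H5]; apply Rmult_le_pos; [apply gcoef_nonneg; lra|exact H4]. }
split; rewrite <- sum_f_R0_scal_l.
- match goal with |- ?s <= _ => change (Rbar_le s V) end.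
  refine (is_lim_seq_le (fun r => sum_f_R0 (fun i => Rpower (INR (n r)) (1 - mu) *
    gcoef mu ((pn - i) * S r) * (P r (S i) - P r i)) m) _ _ _ _ _ HV).
  + intros r; replace (gconv mu (q (n r)) (n r) (n r)) with
      (gconv mu (q (n r)) (n r) (n r) - gconv mu (q (n r)) (n r) (S m * S r)
       + gconv mu (q (n r)) (n r) 0 + sum_f_R0 (fun i => G r (S i) - G r i) m)
      by (rewrite Htel; ring).
    rewrite (sum_eq _ (fun i => Rpower (INR (n r)) (1 - mu) * (gcoef mu ((pn - i) * S r) * (P r (S i) - P r i))))
      by (intros; ring).
    rewrite sum_f_R0_scal_l; apply Rmult_le_compat_l; [left; apply Hw|].
    apply Rle_trans with (sum_f_R0 (fun i => G r (S i) - G r i) m).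
    * apply sum_Rle; intros i Hi; apply Hblock, Hi.
    * pose proof (HG0 r); pose proof (HGn r); lra.
  + apply is_lim_sum_f_R0; intros i Hi.
    replace (Finite (rgamma mu * ((F (INR (S i) / p) - F (INR i / p)) * Rpower (1 - INR i / p) (mu - 1))))
      with (Finite (rgamma mu * Rpower (1 - INR i / p) (mu - 1) * (F (INR (S i) / p) - F (INR i / p))))
      by (f_equal; ring).
    apply is_lim_seq_mult'; [apply Hkernel; lia|apply HlimP, Hi].
- match goal with |- _ <= ?s => change (Rbar_le V s) end.
  refine (is_lim_seq_le _ (fun r => sum_f_R0 (fun i => Rpower (INR (n r)) (1 - mu) *
    gcoef mu ((pn - S i) * S r) * (P r (S i) - P r i)) m +
    C * gcoef_norm (mu + 1) (S r) * Rpower p (- mu) +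
    Rpower (INR (n r)) (1 - mu) * gconv mu (q (n r)) (n r) 0) _ _ _ HV _).
  + intros r; replace (gconv mu (q (n r)) (n r) (n r)) with
      (gconv mu (q (n r)) (n r) (n r) - gconv mu (q (n r)) (n r) (S m * S r)
       + gconv mu (q (n r)) (n r) 0 + sum_f_R0 (fun i => G r (S i) - G r i) m)
      by (rewrite Htel; ring).
    rewrite (sum_eq (fun i => Rpower (INR (n r)) (1 - mu) * gcoef mu ((pn - S i) * S r) * (P r (S i) - P r i))
      (fun i => Rpower (INR (n r)) (1 - mu) * (gcoef mu ((pn - S i) * S r) * (P r (S i) - P r i))))
      by (intros; ring).
    rewrite sum_f_R0_scal_l.
    assert (E : C * gcoef_norm (mu + 1) (S r) * Rpower p (- mu) =
      Rpower (INR (n r)) (1 - mu) * (C / INR (n r) * gcoef (mu + 1) (S r))).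
    { assert (Hr : 0 < INR (S r)) by (apply lt_0_INR; lia).
      unfold n, gcoef_norm; rewrite mult_INR; fold p.
      replace (1 - mu) with (- mu + 1) by ring; replace (1 - (mu + 1)) with (- mu) by ring.
      rewrite Rpower_plus, Rpower_1, <- Rpower_mult_distr by (try apply Rmult_lt_0_compat; assumption).
      field; lra. }
    rewrite E.
    assert (H4 : sum_f_R0 (fun i => G r (S i) - G r i) m <=
      sum_f_R0 (fun i => gcoef mu ((pn - S i) * S r) * (P r (S i) - P r i)) m)
      by (apply sum_Rle; intros i Hi; apply Hblock, Hi).
    rewrite <- !Rmult_plus_distr_l; apply Rmult_le_compat_l; [left; apply Hw|].
    pose proof (Hlast r); lra.
  + match goal with |- is_lim_seq _ (Finite ?s) => replace (Finite s) with (Finite (s + 0)) by (f_equal; ring) end.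
    apply is_lim_seq_plus'; [|exact HT0].
    apply is_lim_seq_plus'.
    * apply is_lim_sum_f_R0; intros i Hi.
      replace (Finite (rgamma mu * ((F (INR (S i) / p) - F (INR i / p)) * Rpower (1 - INR (S i) / p) (mu - 1))))
        with (Finite (rgamma mu * Rpower (1 - INR (S i) / p) (mu - 1) * (F (INR (S i) / p) - F (INR i / p))))
        by (f_equal; ring).
      apply is_lim_seq_mult'; [apply Hkernel; lia|apply HlimP, Hi].
    * apply is_lim_seq_mult'; [|apply is_lim_seq_const].
      apply is_lim_seq_mult'; [apply is_lim_seq_const|].
      apply (is_lim_seq_incr_1 (gcoef_norm (mu + 1))), is_lim_gcoef_norm.
Qed.

(** * Riemann-Stieltjes sums *)

Lemma Rpower_1_minus_increasing (mu x y : R) :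
  mu <= 1 -> x <= y < 1 -> Rpower (1 - x) (mu - 1) <= Rpower (1 - y) (mu - 1).
Proof. intros Hmu Hxy; apply Rpower_le_base_neg; lra. Qed.

Lemma continuous_Rpower_1_minus (mu x : R) : x < 1 -> continuous (fun t => Rpower (1 - t) (mu - 1)) x.
Proof.
intros Hx; apply (continuous_comp (fun t => 1 - t) (fun t => Rpower t (mu - 1))).
- apply (ex_derive_continuous (V := R_NormedModule)); auto_derive; exact Logic.I.
- apply continuous_Rpower; lra.
Qed.

Lemma RInt_weighted_block (F f g : R -> R) (x y : R) :
  x <= y ->
  (forall t, x <= t <= y -> is_derive F t (f t) /\ continuous f t /\ 0 <= f t) ->
  (forall t, x <= t <= y -> continuous g t /\ g x <= g t <= g y) ->
  ex_RInt (fun t => f t * g t) x y /\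
  g x * (F y - F x) <= RInt (fun t => f t * g t) x y <= g y * (F y - F x).
Proof.
intros Hxy Hf Hg.
assert (Hex : ex_RInt (fun t => f t * g t) x y).
{ apply (ex_RInt_continuous (V := R_CompleteNormedModule)); intros t Ht.
  rewrite Rmin_left, Rmax_right in Ht by exact Hxy.
  apply (continuous_mult (K := R_AbsRing)); [apply Hf, Ht|apply Hg, Ht]. }
assert (HI : is_RInt f x y (F y - F x)).
{ apply (is_RInt_derive (V := R_CompleteNormedModule) F f); intros t Ht;
    rewrite Rmin_left, Rmax_right in Ht by exact Hxy; apply Hf, Ht. }
assert (Hc : forall c, is_RInt (fun t => c * f t) x y (c * (F y - F x)))
  by (intros c; apply (is_RInt_scal (V := R_NormedModule) f x y c _ HI)).
split; [exact Hex|].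
rewrite <- (is_RInt_unique _ _ _ _ (Hc (g x))), <- (is_RInt_unique _ _ _ _ (Hc (g y))).
split; (apply RInt_le; [exact Hxy|try exact Hex; eexists; apply Hc|try exact Hex; eexists; apply Hc|]);
  intros t Ht; destruct (Hf t ltac:(lra)) as [_ [_ H1]]; destruct (Hg t ltac:(lra)) as [_ H2]; nra.
Qed.

(* The lower and upper Riemann-Stieltjes sums differ by [O(p^(-mu) + 1/p)]. *)
Lemma is_RInt_gen_of_sandwich (mu V D B : R) (F f : R -> R) :
  0 < mu <= 1 ->
  (forall t, 0 < t <= 1 -> is_derive F t (f t) /\ continuous f t /\ 0 <= f t) ->
  F 0 = 0 -> filterlim F (at_right 0) (locally 0) ->
  0 <= D -> 0 <= B -> (forall t, / 2 <= t <= 1 -> f t <= B) ->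
  (forall m, let p := INR (S (S m)) in
  sum_f_R0 (fun i => (F (INR (S i) / p) - F (INR i / p)) * Rpower (1 - INR i / p) (mu - 1)) m <= V
  /\ V <= sum_f_R0 (fun i => (F (INR (S i) / p) - F (INR i / p)) * Rpower (1 - INR (S i) / p) (mu - 1)) m
     + D * Rpower p (- mu)) ->
  is_RInt_gen (fun t => f t * Rpower (1 - t) (mu - 1)) (at_right 0) (at_left 1) V.
Proof.
intros Hmu HF HF0 Hlim HD HB Hfb HS.
set (g := fun t => Rpower (1 - t) (mu - 1)); set (h := fun t => f t * g t).
assert (Hmono : forall x y, 0 < x <= y -> y <= 1 -> F x <= F y).
{ intros x y Hx Hy; destruct (Req_dec x y) as [->|Hne]; [lra|].
  destruct (MVT_cor2 F f x y ltac:(lra)) as [c [E Hc]].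
  - intros c Hc; apply is_derive_Reals, HF; lra.
  - destruct (HF c ltac:(lra)) as [_ [_ H]].
    assert (0 <= f c * (y - x)) by (apply Rmult_le_pos; lra); lra. }
assert (HFpos : forall x, 0 < x <= 1 -> 0 <= F x).
{ intros x Hx; apply Rnot_lt_le; intros Hneg.
  destruct (Hlim (fun y => F x < y)) as [eps He].
  - exists (mkposreal (- F x) ltac:(lra)); intros y Hy.
    change (Rabs (y - 0) < - F x) in Hy; apply Rabs_def2 in Hy; lra.
  - set (y := Rmin (x / 2) (eps / 2)).
    assert (0 < y <= x / 2) by (unfold y; split; [apply Rmin_pos; [lra|apply is_pos_div_2]|apply Rmin_l]).
    assert (y <= eps / 2) by apply Rmin_r.
    assert (F x < F y).
    { apply (He y); [|lra]; change (Rabs (y - 0) < eps); pose proof (cond_pos eps).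
      rewrite Rabs_pos_eq; lra. }
    pose proof (Hmono y x ltac:(lra) ltac:(lra)); lra. }
assert (Hex : forall u v, 0 < u -> u <= v -> v < 1 -> ex_RInt h u v).
{ intros u v Hu Huv Hv; apply (ex_RInt_continuous (V := R_CompleteNormedModule)); intros t Ht.
  rewrite Rmin_left, Rmax_right in Ht by exact Huv.
  apply (continuous_mult (K := R_AbsRing)); [apply HF; lra|apply continuous_Rpower_1_minus; lra]. }
(* The integral over [[1/p, 1 - 1/p]] is compared with [V]. The [B] and [F 1] terms come from the
   gap between the two sums ([Hdiff], where [17] leaves a margin over [16]), the [D] term from the
   hypothesis, and [F (1/p)] is the first block, which the integral omits. *)
set (err := fun m => let p := INR (S (S m)) in
  (B + D) * Rpower p (- mu) + 17 * (/ p * F 1) + F (/ p)).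
assert (Happrox : forall m, (2 <= m)%nat ->
  Rabs (RInt h (/ INR (S (S m))) (INR (S m) / INR (S (S m))) - V) <= err m).
{ intros m Hm; destruct (HS m) as [HL HU]; unfold err; set (p := INR (S (S m))) in *.
  assert (Hp : 4 <= p) by (replace 4 with (INR 4) by (simpl; lra); apply le_INR; lia).
  set (x := fun i => INR i / p) in *.
  assert (Hxm : INR (S m) = p - 1) by (unfold p; rewrite (S_INR (S m)); ring).
  assert (Hx : forall i, (i <= m)%nat -> 0 <= x i /\ x (S i) = x i + / p /\ x (S i) <= 1 - / p).
  { intros i Hi; unfold x; pose proof (pos_INR i); repeat split.
    - apply Rmult_le_pos; [assumption|left; apply Rinv_0_lt_compat; lra].
    - rewrite S_INR; field; lra.
    - apply (Rmult_le_reg_r p); [lra|]; replace (INR (S i) / p * p) with (INR (S i)) by (field; lra).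
      replace ((1 - / p) * p) with (p - 1) by (field; lra).
      rewrite <- Hxm; apply le_INR; lia. }
  assert (Hip : 0 < / p <= / 4) by (split; [apply Rinv_0_lt_compat; lra|apply Rinv_le_contravar; lra]).
  assert (Hx1 : forall i, (1 <= i)%nat -> / p <= x i).
  { intros i Hi; unfold x; rewrite <- (Rmult_1_l (/ p)) at 1.
    apply Rmult_le_compat_r; [lra|]; change 1 with (INR 1); apply le_INR, Hi. }
  set (dF := fun i => F (x (S i)) - F (x i)).
  assert (HdF : forall i, (i <= m)%nat -> 0 <= dF i).
  { intros i Hi; destruct (Hx i Hi) as [H1 [H2 H3]]; unfold dF; destruct i as [|i].
    - unfold x at 2; simpl (INR 0); unfold Rdiv; rewrite Rmult_0_l, HF0, Rminus_0_r.
      apply HFpos; lra.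
    - pose proof (Hx1 (S i) ltac:(lia)); pose proof (Hmono (x (S i)) (x (S (S i))) ltac:(lra) ltac:(lra)); lra. }
  assert (HSL : sum_f_R0 (fun i => dF i * g (x i)) m <= V) by exact HL.
  assert (HSU : V <= sum_f_R0 (fun i => dF i * g (x (S i))) m + D * Rpower p (- mu)) by exact HU.
  assert (HdF0 : dF 0%nat = F (/ p)).
  { unfold dF, x; simpl (INR 0); simpl (INR 1); unfold Rdiv; rewrite Rmult_0_l, HF0, Rmult_1_l; ring. }
  assert (Hblocks : forall k, (k <= m)%nat ->
    sum_f_R0 (fun i => dF i * g (x i)) k - F (/ p) <= RInt h (x 1%nat) (x (S k))
      <= sum_f_R0 (fun i => dF i * g (x (S i))) k).
  { induction k as [|k IH]; intros Hk.
    - simpl sum_f_R0; rewrite RInt_point; unfold zero; simpl; rewrite HdF0.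
      assert (Hg0 : g (x 0%nat) = 1).
      { unfold g, x; simpl; unfold Rdiv; rewrite Rmult_0_l, Rminus_0_r.
        unfold Rpower; rewrite ln_1, Rmult_0_r; apply exp_0. }
      rewrite Hg0; split; [lra|].
      apply Rmult_le_pos; [rewrite <- HdF0; apply HdF; lia|apply Rpower_ge_0].
    - destruct (IH ltac:(lia)) as [I1 I2].
      destruct (Hx (S k) Hk) as [H1 [H2 H3]].
      pose proof (Hx1 (S k) ltac:(lia)) as H4; pose proof (Hx1 1%nat ltac:(lia)) as H5.
      assert (H6 : x 1%nat <= x (S k)).
      { apply Rmult_le_compat_r; [lra|]; apply le_INR; lia. }
      destruct (RInt_weighted_block F f g (x (S k)) (x (S (S k)))) as [_ H7].
      + lra.
      + intros t Ht; apply HF; lra.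
      + intros t Ht; split; [apply continuous_Rpower_1_minus; lra|].
        split; apply Rpower_1_minus_increasing; lra.
      + rewrite <- (RInt_Chasles h (x 1%nat) (x (S k)) (x (S (S k)))) by (apply Hex; lra).
        unfold plus; simpl sum_f_R0; fold (dF (S k)) in H7; fold h in H7; simpl; lra. }
  assert (Hdiff : sum_f_R0 (fun i => dF i * g (x (S i))) m - sum_f_R0 (fun i => dF i * g (x i)) m
    <= B * Rpower p (- mu) + 16 * (/ p * F 1)).
  { rewrite <- minus_sum.
    (* In each product of increments one factor is of order [1/p]: that of [F] where [x i >= 1/2],
       by the bound [B], and that of [g] where [x i < 1/2]. In the latter case [1 - c >= 1/4] and
       the exponent [mu - 2] exceeds [-2], whence [16 = 4^2]. The sum of the other factors
       telescopes. *)
    apply Rle_trans with (sum_f_R0 (fun i => B * / p * (g (x (S i)) - g (x i)) + 16 * / p * (F (x (S i)) - F (x i))) m).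
    - apply sum_Rle; intros i Hi.
      destruct (Hx i Hi) as [H1 [H2 H3]]; pose proof (HdF i Hi) as H4.
      assert (H5 : 0 <= g (x (S i)) - g (x i)).
      { pose proof (Rpower_1_minus_increasing mu (x i) (x (S i)) ltac:(lra) ltac:(lra)) as H5.
        unfold g; lra. }
      fold (dF i); rewrite <- Rmult_minus_distr_l.
      destruct (Rle_lt_dec (/ 2) (x i)) as [H6|H6].
      + assert (H7 : dF i <= B * / p).
        { destruct (MVT_cor2 F f (x i) (x (S i)) ltac:(lra)) as [c [E Hc]].
          - intros c Hc; apply is_derive_Reals, HF; lra.
          - unfold dF; rewrite E, H2; replace (x i + / p - x i) with (/ p) by ring.
            apply Rmult_le_compat_r; [lra|apply Hfb; lra]. }
        assert (0 <= 16 * / p * dF i) by (apply Rmult_le_pos; lra); nra.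
      + assert (H7 : g (x (S i)) - g (x i) <= 16 * / p).
        { destruct (MVT_cor2 g (fun t => - ((mu - 1) * Rpower (1 - t) (mu - 1 - 1))) (x i) (x (S i)) ltac:(lra))
            as [c [E Hc]].
          - intros c Hc; apply is_derive_Reals.
            replace (- ((mu - 1) * Rpower (1 - c) (mu - 1 - 1)))
              with (scal (-1) ((mu - 1) * Rpower (1 - c) (mu - 1 - 1)))
              by (unfold scal; simpl; unfold mult; simpl; ring).
            apply (is_derive_comp (fun t => Rpower t (mu - 1)) (fun t => 1 - t)).
            + apply is_derive_Rpower; lra.
            + auto_derive; [exact Logic.I|ring].
          - rewrite E, H2; replace (x i + / p - x i) with (/ p) by ring.
            apply Rmult_le_compat_r; [lra|].
            assert (H8 : Rpower (1 - c) (mu - 1 - 1) <= 16).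
            { apply Rle_trans with (Rpower (/ 4) (mu - 1 - 1)); [apply Rpower_le_base_neg; lra|].
              rewrite Rpower_Rinv_l by lra.
              apply Rle_trans with (Rpower 4 (INR 2)); [apply Rle_Rpower; simpl; lra|].
              rewrite Rpower_pow by lra; simpl; lra. }
            pose proof (Rpower_pos (1 - c) (mu - 1 - 1)); nra. }
        assert (0 <= B * / p * (g (x (S i)) - g (x i)))
          by (apply Rmult_le_pos; [apply Rmult_le_pos; lra|exact H5]).
        nra.
    - rewrite sum_plus, !sum_f_R0_scal_l, (sum_f_R0_telescope (fun i => g (x i))),
        (sum_f_R0_telescope (fun i => F (x i))).
      assert (Hx0 : x 0%nat = 0) by (unfold x; simpl; unfold Rdiv; ring).
      assert (HxS : x (S m) = 1 - / p) by (unfold x; rewrite Hxm; field; lra).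
      rewrite Hx0, HF0, HxS.
      assert (Hg1 : / p * g (1 - / p) = Rpower p (- mu)).
      { unfold g; replace (1 - (1 - / p)) with (/ p) by ring.
        rewrite Rpower_Rinv_l, <- (Rpower_1 p) at 1 by lra.
        rewrite <- Rpower_Ropp, <- Rpower_plus; f_equal; ring. }
      assert (0 <= / p * g 0) by (apply Rmult_le_pos; [lra|apply Rpower_ge_0]).
      assert (F (1 - / p) <= F 1) by (apply Hmono; lra).
      assert (B * / p * (g (1 - / p) - g 0) <= B * Rpower p (- mu)) by (rewrite <- Hg1; nra).
      assert (/ p * F (1 - / p) <= / p * F 1) by (apply Rmult_le_compat_l; lra); lra. }
  destruct (Hblocks m (Nat.le_refl m)) as [H1 H2].
  replace (/ p) with (x 1%nat) at 1 by (unfold x; simpl (INR 1); field; lra).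
  fold (x (S m)).
  assert (0 <= F (/ p)) by (apply HFpos; lra).
  assert (0 <= / p * F 1) by (apply Rmult_le_pos; [lra|apply HFpos; lra]).
  assert (0 <= D * Rpower p (- mu)) by (apply Rmult_le_pos; [lra|apply Rpower_ge_0]).
  apply Rabs_le; split; lra. }
assert (Hinv : is_lim_seq (fun m => / INR (S (S m))) 0).
{ apply (is_lim_seq_incr_1 (fun n => / INR (S n))), (is_lim_seq_incr_1 (fun n => / INR n)).
  apply (is_lim_seq_inv INR p_infty); [apply is_lim_seq_INR|discriminate]. }
assert (Hpow : is_lim_seq (fun m => Rpower (INR (S (S m))) (- mu)) 0).
{ apply is_lim_seq_spec; intros eps.
  apply is_lim_seq_spec in Hinv.
  destruct (Hinv (mkposreal _ (Rpower_pos eps (/ mu)))) as [N HN]; exists N; intros n Hn.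
  specialize (HN n Hn); simpl pos in HN.
  assert (Hq : 0 < INR (S (S n))) by (apply lt_0_INR; lia).
  rewrite Rminus_0_r, Rabs_pos_eq in HN by (left; apply Rinv_0_lt_compat, Hq).
  rewrite Rminus_0_r, Rabs_pos_eq by apply Rpower_ge_0.
  rewrite <- Rpower_Rinv_l by exact Hq.
  replace (pos eps) with (Rpower (Rpower eps (/ mu)) mu)
    by (rewrite Rpower_mult, Rinv_l, Rpower_1 by (try apply cond_pos; lra); reflexivity).
  apply Rlt_Rpower_l; [lra|]; split; [apply Rinv_0_lt_compat, Hq|exact HN]. }
assert (Herr : is_lim_seq err 0).
{ replace (Finite 0) with (Finite ((B + D) * 0 + 17 * (0 * F 1) + 0)) by (f_equal; ring).
  apply is_lim_seq_plus'; [apply is_lim_seq_plus'|].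
  - apply is_lim_seq_mult'; [apply is_lim_seq_const|exact Hpow].
  - apply is_lim_seq_mult'; [apply is_lim_seq_const|].
    apply is_lim_seq_mult'; [exact Hinv|apply is_lim_seq_const].
  - apply (filterlim_comp _ _ _ (fun m => / INR (S (S m))) F eventually (at_right 0) (locally 0)); [|exact Hlim].
    intros P [eps HP]; apply is_lim_seq_spec in Hinv; destruct (Hinv eps) as [N HN].
    exists N; intros n Hn; apply HP.
    + exact (HN n Hn).
    + apply Rinv_0_lt_compat, lt_0_INR; lia. }
apply (is_RInt_gen_nonneg h (fun t => 0 < t < 1)); try typeclasses eauto.
- intros u v t Hu Hv Ht; apply Rmult_le_pos; [apply HF; lra|apply Rpower_ge_0].
- intros u v Hu Hv Huv; split; [apply Hex; lra|].
  change (Rbar_le (RInt h u v) V); replace (Finite V) with (Finite (V + 0)) by (f_equal; ring).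
  apply (is_lim_seq_le_loc (fun _ => RInt h u v) (fun m => V + err m)).
  (* For large [m] the interval [[u, v]] is contained in [[1/p, 1 - 1/p]]. *)
  + assert (Hloc : 0 < Rmin u (1 - v)) by (apply Rmin_pos; lra).
    apply is_lim_seq_spec in Hinv; destruct (Hinv (mkposreal _ Hloc)) as [N HN].
    exists (N + 2)%nat; intros m Hm; specialize (HN m ltac:(lia)); specialize (Happrox m ltac:(lia)).
    simpl pos in HN; rewrite Rminus_0_r in HN.
    set (p := INR (S (S m))) in *.
    assert (Hp : 0 < p) by (apply lt_0_INR; lia).
    rewrite Rabs_pos_eq in HN by (left; apply Rinv_0_lt_compat, Hp).
    pose proof (Rmin_l u (1 - v)); pose proof (Rmin_r u (1 - v)).
    assert (E : INR (S m) / p = 1 - / p) by (unfold p; rewrite (S_INR (S m)) at 2; rewrite (S_INR (S m)); field;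
      pose proof (pos_INR (S m)); lra).
    rewrite E in Happrox; apply Rabs_le_between in Happrox.
    pose proof (Rinv_0_lt_compat p Hp).
    assert (RInt h u v <= RInt h (/ p) (1 - / p)); [|lra].
    apply RInt_le_of_subinterval; [lra|lra|apply Hex; lra|].
    intros t Ht; apply Rmult_le_pos; [apply HF; lra|apply Rpower_ge_0].
  + apply is_lim_seq_const.
  + apply is_lim_seq_plus'; [apply is_lim_seq_const|exact Herr].
- intros eps Heps; apply is_lim_seq_spec in Herr; destruct (Herr (mkposreal eps Heps)) as [N HN].
  set (m := (N + 2)%nat); specialize (HN m ltac:(unfold m; lia)); specialize (Happrox m ltac:(unfold m; lia)).
  simpl pos in HN; apply Rabs_def2 in HN; apply Rabs_le_between in Happrox.
  set (p := INR (S (S m))) in *.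
  assert (Hp : 2 < p) by (change 2 with (INR 2); apply lt_INR; unfold m; lia).
  assert (E : INR (S m) / p = 1 - / p).
  { assert (INR (S m) = p - 1) as -> by (unfold p; rewrite (S_INR (S m)); ring); field; lra. }
  rewrite E in Happrox.
  assert (Hip : 0 < / p < / 2) by (split; [apply Rinv_0_lt_compat; lra|apply Rinv_lt_contravar; lra]).
  exists (/ p), (1 - / p); split; [lra|split; [lra|]].
  exists (fun a => 0 < a <= / p) (fun b => 1 - / p <= b < 1).
  + apply filter_at_right_le; lra.
  + apply filter_at_left_ge; lra.
  + simpl; intros; lra.
Qed.

Lemma is_RInt_gen_scale (h : R -> R) (t V : R) :
  0 < t -> is_RInt_gen h (at_right 0) (at_left 1) V ->
  is_RInt_gen (fun tau => / t * h (tau / t)) (at_right 0) (at_left t) V.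
Proof.
intros Ht H P HP; destruct (H P HP) as [Q R HQ HR HQR].
assert (Hit : 0 < / t) by (apply Rinv_0_lt_compat, Ht).
exists (fun a => Q (a / t)) (fun b => R (b / t)).
- destruct HQ as [eps He].
  assert (Hd : 0 < eps * t) by (apply Rmult_lt_0_compat; [apply cond_pos|exact Ht]).
  exists (mkposreal _ Hd); intros y Hy Hy0; apply He; [|apply Rdiv_lt_0_compat; assumption].
  change (Rabs (y - 0) < eps * t) in Hy; change (Rabs (y / t - 0) < eps).
  rewrite Rminus_0_r in *; unfold Rdiv; rewrite Rabs_mult, (Rabs_pos_eq (/ t)) by lra.
  apply (Rmult_lt_reg_r t); [exact Ht|]; rewrite Rmult_assoc, Rinv_l by lra; lra.
- destruct HR as [eps He].
  assert (Hd : 0 < eps * t) by (apply Rmult_lt_0_compat; [apply cond_pos|exact Ht]).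
  exists (mkposreal _ Hd); intros y Hy Hy0; apply He.
  + change (Rabs (y - t) < eps * t) in Hy; change (Rabs (y / t - 1) < eps).
    replace (y / t - 1) with ((y - t) * / t) by (field; lra).
    rewrite Rabs_mult, (Rabs_pos_eq (/ t)) by lra.
    apply (Rmult_lt_reg_r t); [exact Ht|]; rewrite Rmult_assoc, Rinv_l by lra; lra.
  + replace (y / t) with (y * / t) by reflexivity.
    apply (Rmult_lt_reg_r t); [exact Ht|]; rewrite Rmult_assoc, Rinv_l by lra.
    change (y < t) in Hy0; lra.
- intros a b Ha Hb; destruct (HQR _ _ Ha Hb) as [y [Hy1 Hy2]]; exists y; split; [|exact Hy2].
  simpl fst in *; simpl snd in *.
  apply (is_RInt_ext (fun tau => scal (/ t) (h (/ t * tau + 0)))).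
  + intros z _; unfold scal; simpl; unfold mult; simpl; do 2 f_equal; unfold Rdiv; ring.
  + apply (is_RInt_comp_lin (V := R_NormedModule) h (/ t) 0 a b).
    replace (/ t * a + 0) with (a / t) by (unfold Rdiv; ring).
    replace (/ t * b + 0) with (b / t) by (unfold Rdiv; ring); exact Hy1.
Qed.

(** * Beta and Wright integrals, Caputo derivatives *)

(** The transfer principle behind both the Beta and the Wright integral: [q n] is a discrete density
    on [0..n], [F] the limit of its cumulative sums, [f] the derivative of [F], and [V] the limit of
    the rescaled convolution. *)
Lemma is_RInt_gen_of_gconv (mu V C B : R) (q : nat -> nat -> R) (F f : R -> R) :
  0 < mu <= 1 -> (forall n k, 0 <= q n k) -> F 0 = 0 ->
  (forall p i, (1 <= p)%nat -> (i <= p)%nat ->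
     is_lim_seq (fun r => sum_f_R0 (q (p * S r)%nat) (i * S r)) (F (INR i / INR p))) ->
  is_lim_seq (fun n => Rpower (INR n) (1 - mu) * gconv mu (q n) n n) V ->
  0 <= C -> (forall n k, (1 <= n)%nat -> (n <= 2 * k)%nat -> (k <= n)%nat -> INR n * q n k <= C) ->
  (forall t, 0 < t <= 1 -> is_derive F t (f t) /\ continuous f t /\ 0 <= f t) ->
  filterlim F (at_right 0) (locally 0) ->
  0 <= B -> (forall t, / 2 <= t <= 1 -> f t <= B) ->
  is_RInt_gen (fun t => f t * Rpower (1 - t) (mu - 1)) (at_right 0) (at_left 1) (Gamma mu * V).
Proof.
intros Hmu Hq HF0 H1 H2 HC H3 HF Hlim HB Hf.
assert (HG : 0 < Gamma mu) by (apply Gamma_pos; lra).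
assert (HG1 : 0 < Gamma (mu + 1)) by (apply Gamma_pos; lra).
apply (is_RInt_gen_of_sandwich mu (Gamma mu * V) (Gamma mu * (C * rgamma (mu + 1))) B F f); try assumption.
- rewrite rgamma_pos by lra; pose proof (Rinv_0_lt_compat _ HG1).
  apply Rmult_le_pos; [lra|apply Rmult_le_pos; lra].
- intros m; destruct (gconv_limit_sandwich mu V C q F Hmu Hq HF0 H1 H2 HC H3 m) as [HL HU].
  cbv zeta; set (p := INR (S (S m))) in *.
  rewrite (rgamma_pos mu) in HL, HU by lra.
  split.
  + apply (Rmult_le_compat_l (Gamma mu)) in HL; [|lra].
    rewrite <- Rmult_assoc, Rinv_r, Rmult_1_l in HL by lra; exact HL.
  + apply (Rmult_le_compat_l (Gamma mu)) in HU; [|lra].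
    rewrite Rmult_plus_distr_l, <- Rmult_assoc, Rinv_r, Rmult_1_l in HU by lra.
    rewrite <- (Rmult_assoc (Gamma mu)) in HU; exact HU.
Qed.

Lemma filterlim_squeeze_0 (F G : R -> R) (Fa : (R -> Prop) -> Prop) :
  Filter Fa -> Fa (fun t => 0 <= F t <= G t) -> filterlim G Fa (locally 0) ->
  filterlim F Fa (locally 0).
Proof.
intros HFa H HG P [eps HP].
assert (H' : Fa (fun t => Rabs (G t - 0) < eps)) by (apply (HG (fun y => Rabs (y - 0) < eps)); exists eps; auto).
apply filter_imp with (2 := filter_and _ _ H H'); intros t [Ht1 Ht2]; apply HP.
change (Rabs (F t - 0) < eps); rewrite Rminus_0_r in *.
rewrite Rabs_pos_eq in * by lra; lra.
Qed.

Lemma filterlim_scal_Rpower_0 (c a : R) :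
  0 < a -> filterlim (fun t => c * Rpower t a) (at_right 0) (locally 0).
Proof.
intros Ha.
assert (H : filterlim (fun t => Rpower t a) (at_right 0) (locally 0)).
{ intros P [eps HP].
  exists (mkposreal (Rpower eps (/ a)) (Rpower_pos _ _)); simpl; intros t Ht Ht0; apply HP.
  change (Rabs (t - 0) < Rpower eps (/ a)) in Ht; rewrite Rminus_0_r, Rabs_pos_eq in Ht by lra.
  change (Rabs (Rpower t a - 0) < eps); rewrite Rminus_0_r, Rabs_pos_eq by apply Rpower_ge_0.
  replace (pos eps) with (Rpower (Rpower eps (/ a)) a)
    by (rewrite Rpower_mult, Rinv_l, Rpower_1 by (try apply cond_pos; lra); reflexivity).
  apply Rlt_Rpower_l; lra. }
replace (locally 0) with (locally (scal c 0)) by (unfold scal; simpl; unfold mult; simpl; rewrite Rmult_0_r; reflexivity).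
apply (filterlim_comp _ _ _ (fun t => Rpower t a) (fun y => scal c y) _ (locally 0)); [exact H|].
apply (filterlim_scal_r c 0).
Qed.

Lemma is_lim_Rpower_neg (a : R) : 0 < a -> is_lim_seq (fun n => Rpower (INR (S n)) (- a)) 0.
Proof.
intros Ha; apply is_lim_seq_ext with (fun n => 1 * Rpower (/ INR (S n)) a).
- intros n; rewrite Rmult_1_l; apply Rpower_Rinv_l, lt_0_INR; lia.
- apply (filterlim_comp _ _ _ (fun n => / INR (S n)) (fun x => 1 * Rpower x a) eventually (at_right 0) (locally 0));
    [|apply filterlim_scal_Rpower_0, Ha].
  assert (Hinv : is_lim_seq (fun n => / INR (S n)) 0).
  { apply (is_lim_seq_incr_1 (fun n => / INR n)).
    apply (is_lim_seq_inv INR p_infty); [apply is_lim_seq_INR|discriminate]. }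
  intros P [eps HP]; apply is_lim_seq_spec in Hinv; destruct (Hinv eps) as [N HN].
  exists N; intros n Hn; apply HP; [exact (HN n Hn)|apply Rinv_0_lt_compat, lt_0_INR; lia].
Qed.

Lemma is_derive_piecewise_pos (F : R -> R) (t d : R) :
  0 < t -> is_derive F t d -> is_derive (fun x => if Rlt_dec 0 x then F x else 0) t d.
Proof.
intros Ht H; apply is_derive_ext_loc with (2 := H).
apply (locally_interval _ t 0 p_infty); simpl; [exact Ht|exact Logic.I|].
intros y Hy _; simpl in Hy; destruct (Rlt_dec 0 y); [reflexivity|contradiction].
Qed.

Lemma is_RInt_gen_Beta (a mu : R) :
  0 < a <= 1 -> 0 < mu <= 1 ->
  is_RInt_gen (fun t => Rpower t (a - 1) * Rpower (1 - t) (mu - 1)) (at_right 0) (at_left 1)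
    (Gamma a * Gamma mu / Gamma (a + mu)).
Proof.
intros Ha Hmu.
assert (HGa : 0 < Gamma a) by (apply Gamma_pos; lra).
assert (HGa1 : 0 < Gamma (a + 1)) by (apply Gamma_pos; lra).
assert (HGs : 0 < Gamma (a + mu)) by (apply Gamma_pos; lra).
assert (Hr : rgamma (a + 1) * a = rgamma a) by (rewrite (rgamma_S a); ring).
assert (Hra : rgamma a = / Gamma a) by (apply rgamma_pos; lra).
assert (Hra' : 0 < / Gamma a) by (apply Rinv_0_lt_compat, HGa).
assert (H : is_RInt_gen (fun t => rgamma a * Rpower t (a - 1) * Rpower (1 - t) (mu - 1)) (at_right 0) (at_left 1)
    (Gamma mu * rgamma (a + mu))).
(* The cumulative sums of [gcoef a] are [gcoef (a + 1)], whence the limit [t^a / Gamma (a + 1)]. The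
   constant [8 = 2 * 4] combines [n^(1-a) <= 2 k^(1-a)] with [gcoef_norm_le], and the [2] in the
   last bound is that of [t^(a-1)] on [[1/2, 1]]. The value at [t = 0] is set by hand, because
   [Rpower 0 a] is not [0]. *)
{ apply (is_RInt_gen_of_gconv mu _ 8 (rgamma a * 2)
    (fun n k => gcoef a k * Rpower (INR n) (- a))
    (fun t => if Rlt_dec 0 t then rgamma (a + 1) * Rpower t a else 0)
    (fun t => rgamma a * Rpower t (a - 1))).
  - exact Hmu.
  - intros n k; apply Rmult_le_pos; [apply gcoef_nonneg; lra|apply Rpower_ge_0].
  - destruct (Rlt_dec 0 0); [lra|reflexivity].
  - intros p i Hp Hi.
    apply is_lim_seq_ext with (fun r => Rpower (INR (p * S r)) (1 - (a + 1)) * gcoef (a + 1) (i * S r)).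
    { intros r; rewrite <- gcoef_vandermonde.
      replace (1 - (a + 1)) with (- a) by ring.
      rewrite scal_sum; apply sum_eq; intros; rewrite gcoef_1; ring. }
    destruct i as [|i].
    + simpl (INR 0); replace (0 / INR p) with 0 by (unfold Rdiv; ring); destruct (Rlt_dec 0 0); [lra|].
      apply is_lim_seq_ext with (fun r => Rpower (INR p) (- a) * Rpower (INR (S r)) (- a)).
      * intros r; rewrite Nat.mul_0_l, gcoef_0, Rmult_1_r, mult_INR.
        rewrite Rpower_mult_distr by (apply lt_0_INR; lia); f_equal; ring.
      * replace (Finite 0) with (Finite (Rpower (INR p) (- a) * 0)) by (f_equal; ring).
        apply is_lim_seq_mult'; [apply is_lim_seq_const|apply is_lim_Rpower_neg; lra].
    + destruct (Rlt_dec 0 (INR (S i) / INR p)) as [H|H].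
      * replace (Rpower (INR (S i) / INR p) a) with (Rpower (INR (S i) / INR p) (a + 1 - 1)) by (f_equal; ring).
        apply is_lim_gcoef_scaled; lia.
      * exfalso; apply H, Rdiv_lt_0_compat; apply lt_0_INR; lia.
  - apply is_lim_seq_incr_1.
    apply is_lim_seq_ext with (fun n => gcoef_norm (a + mu) (S n)).
    + intros n; unfold gcoef_norm, gconv; rewrite <- gcoef_vandermonde.
      replace (1 - (a + mu)) with ((1 - mu) + - a) by ring.
      rewrite Rpower_plus, Rmult_assoc, (scal_sum _ _ (Rpower _ (- a))).
      f_equal; apply sum_eq; intros; ring.
    + apply (is_lim_seq_incr_1 (gcoef_norm (a + mu))), is_lim_gcoef_norm.
  - lra.
  - intros n [|k] Hn Hnk Hkn; [lia|].
    assert (Hk : 0 < INR (S k)) by (apply lt_0_INR; lia).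
    assert (Hn' : 0 < INR n) by (apply lt_0_INR; lia).
    pose proof (gcoef_norm_le a k ltac:(lra)) as Hle.
    rewrite pole_index_0 in Hle by lra; simpl gcoef_majorant in Hle.
    rewrite Rabs_pos_eq in Hle by (apply Rmult_le_pos; [apply Rpower_ge_0|apply gcoef_nonneg; lra]).
    assert (H2 : Rpower (INR n) (1 - a) <= 2 * Rpower (INR (S k)) (1 - a)).
    { apply Rle_trans with (Rpower (2 * INR (S k)) (1 - a)).
      - apply Rle_Rpower_l; [lra|]; split; [exact Hn'|].
        replace (2 * INR (S k)) with (INR (2 * S k)) by (rewrite mult_INR; simpl (INR 2); ring).
        apply le_INR, Hnk.
      - rewrite <- Rpower_mult_distr by lra; apply Rmult_le_compat_r; [apply Rpower_ge_0|].
        rewrite <- (Rpower_1 2) at 2 by lra; apply Rle_Rpower; lra. }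
    replace (INR n * (gcoef a (S k) * Rpower (INR n) (- a))) with (Rpower (INR n) (1 - a) * gcoef a (S k)).
    + pose proof (gcoef_nonneg a (S k) ltac:(lra)).
      apply Rle_trans with (2 * Rpower (INR (S k)) (1 - a) * gcoef a (S k)).
      * apply Rmult_le_compat_r; assumption.
      * unfold gcoef_norm in Hle; lra.
    + unfold Rminus; rewrite Rpower_plus, Rpower_1 by exact Hn'; ring.
  - intros t Ht; split; [|split].
    + apply is_derive_piecewise_pos; [lra|].
      rewrite <- Hr, Rmult_assoc.
      apply (is_derive_scal (fun t => Rpower t a) t (rgamma (a + 1))), is_derive_Rpower; lra.
    + apply (continuous_mult (K := R_AbsRing)); [apply continuous_const|apply continuous_Rpower; lra].
    + apply Rmult_le_pos; [lra|apply Rpower_ge_0].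
  - apply (filterlim_ext_loc (fun t => rgamma (a + 1) * Rpower t a)).
    + apply filter_imp with (2 := filter_at_right_le 0 1 Rlt_0_1).
      intros t Ht; destruct (Rlt_dec 0 t); [reflexivity|lra].
    + apply filterlim_scal_Rpower_0; lra.
  - lra.
  - intros t Ht; apply Rmult_le_compat_l; [lra|].
    apply Rle_trans with (Rpower (/ 2) (a - 1)); [apply Rpower_le_base_neg; lra|].
    rewrite Rpower_Rinv_l by lra; rewrite <- (Rpower_1 2) at 2 by lra; apply Rle_Rpower; lra. }
pose proof (is_RInt_gen_scal _ (Gamma a) _ H) as H2.
rewrite (rgamma_pos (a + mu)) in H2 by lra.
replace (Gamma a * Gamma mu / Gamma (a + mu)) with (scal (Gamma a) (Gamma mu * / Gamma (a + mu)))
  by (unfold scal; simpl; unfold mult; simpl; field; lra).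
apply is_RInt_gen_ext with (2 := H2).
exists (fun _ => True) (fun _ => True); [apply filter_true|apply filter_true|].
intros u v _ _ t _; unfold scal; simpl; unfold mult; simpl.
rewrite Hra; real_eq; field; lra.
Qed.

Lemma continuous_Wright_opp (nu b y : R) :
  0 < nu < 1 / 2 -> 0 <= b <= 2 -> continuous (fun y => Wright (- y) (- nu) b) y.
Proof.
intros Hnu Hb; apply (ex_derive_continuous (V := R_NormedModule)).
eexists; apply is_derive_Wright_opp; assumption.
Qed.

(** The [t]-derivative of [W(- y t^(-nu); - nu, 1)], the distribution function of the one-sided
    stable law with Laplace transform [exp (- y s^nu)]. *)
Definition stable_density (nu y t : R) : R :=
  nu * y * Rpower t (- nu - 1) * Mainardi nu (y * Rpower t (- nu)).

Lemma is_derive_Wright_Rpower (nu y t : R) :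
  0 < nu < 1 / 2 -> 0 < t ->
  is_derive (fun t => Wright (- (y * Rpower t (- nu))) (- nu) 1) t (stable_density nu y t).
Proof.
intros Hnu Ht.
replace (stable_density nu y t) with
  (scal (y * (- nu * Rpower t (- nu - 1))) (- Wright (- (y * Rpower t (- nu))) (- nu) (1 - nu)))
  by (unfold stable_density, Mainardi, scal; simpl; unfold mult; simpl; ring).
apply (is_derive_comp (fun y => Wright (- y) (- nu) 1) (fun t => y * Rpower t (- nu))).
- apply is_derive_Wright_opp; lra.
- apply (is_derive_scal (fun t => Rpower t (- nu)) t y), is_derive_Rpower, Ht.
Qed.

Lemma continuous_stable_density (nu y t : R) :
  0 < nu < 1 / 2 -> 0 < t -> continuous (stable_density nu y) t.
Proof.
intros Hnu Ht; apply (continuous_mult (K := R_AbsRing)).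
- apply (continuous_mult (K := R_AbsRing)); [apply continuous_const|apply continuous_Rpower, Ht].
- apply (continuous_comp (fun t => y * Rpower t (- nu)) (fun y => Wright (- y) (- nu) (1 - nu))).
  + apply (continuous_mult (K := R_AbsRing)); [apply continuous_const|apply continuous_Rpower, Ht].
  + apply continuous_Wright_opp; lra.
Qed.

(* [stable_density nu y] is, in [tau], the limit of the rescaled coefficients of
   [exp (- y n^nu (1 - z)^nu)]; convolving them with [gcoef mu] is multiplication by [(1 - z)^(-mu)]. *)
Lemma is_RInt_gen_Wright (nu y : R) :
  0 < nu < 1 / 2 -> 0 < y ->
  is_RInt_gen (fun t => stable_density nu y t * Rpower (1 - t) (1 - 2 * nu - 1)) (at_right 0) (at_left 1)
    (Gamma (1 - 2 * nu) * Wright (- y) (- nu) (1 - 2 * nu)).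
Proof.
intros Hnu Hy.
destruct (gsub_bounded nu 0 (2 * y) Hnu ltac:(lra) ltac:(lra)) as [B0 [HB0 HB]].
assert (HM0 : 0 < rgamma (1 - nu)) by (rewrite rgamma_pos by lra; apply Rinv_0_lt_compat, Gamma_pos; lra).
assert (HL : forall n, 0 <= y * Rpower (INR n) nu)
  by (intros n; apply Rmult_le_pos; [lra|apply Rpower_ge_0]).
assert (HYpos : forall t, 0 < y * Rpower t (- nu))
  by (intros t; apply Rmult_lt_0_compat; [exact Hy|apply Rpower_pos]).
(* In [2 * B0] the factor [2] is [n <= 2 k]. In the bound on [f], [4] bounds [t^(-nu-1)] on
   [[1/2, 1]] and [rgamma (1 - nu)] is the maximum of the Mainardi function, at [0]. *)
apply (is_RInt_gen_of_gconv (1 - 2 * nu) _ (2 * B0) (nu * y * 4 * rgamma (1 - nu))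
  (fun n k => gsub nu 0 (y * Rpower (INR n) nu) k)
  (fun t => if Rlt_dec 0 t then Wright (- (y * Rpower t (- nu))) (- nu) 1 else 0)
  (stable_density nu y)).
- lra.
- intros n k; apply gsub_0_nonneg; [exact Hnu|apply HL].
- destruct (Rlt_dec 0 0); [lra|reflexivity].
- intros p [|i] Hp Hi.
  + simpl (INR 0); replace (0 / INR p) with 0 by (unfold Rdiv; ring); destruct (Rlt_dec 0 0); [lra|].
    apply is_lim_seq_ext with (fun r => exp (- (y * Rpower (INR (p * S r)) nu))).
    { intros r; rewrite Nat.mul_0_l; simpl sum_f_R0; symmetry; apply gsub_0_0. }
    apply (is_lim_seq_le_le (fun _ => 0) _ (fun r => / y * Rpower (INR p) (- nu) * Rpower (INR (S r)) (- nu))).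
    * intros r; split; [left; apply exp_pos|].
      set (z := y * Rpower (INR (p * S r)) nu).
      assert (Hz : 0 < z) by (apply Rmult_lt_0_compat; [exact Hy|apply Rpower_pos]).
      replace (/ y * Rpower (INR p) (- nu) * Rpower (INR (S r)) (- nu)) with (/ z).
      -- rewrite exp_Ropp; apply Rinv_le_contravar; [exact Hz|].
         pose proof (exp_ineq1_le z); lra.
      -- unfold z; rewrite mult_INR, <- Rpower_mult_distr by (apply lt_0_INR; lia).
         rewrite !Rpower_Ropp, !Rinv_mult; ring.
    * apply is_lim_seq_const.
    * replace (Finite 0) with (Finite (/ y * Rpower (INR p) (- nu) * 0)) by (f_equal; ring).
      apply is_lim_seq_mult'; [apply is_lim_seq_const|apply is_lim_Rpower_neg; lra].
  + assert (Hi' : 0 < INR (S i)) by (apply lt_0_INR; lia).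
    assert (Hp' : 0 < INR p) by (apply lt_0_INR; lia).
    destruct (Rlt_dec 0 (INR (S i) / INR p)) as [H|H];
      [|exfalso; apply H, Rdiv_lt_0_compat; assumption].
    (* Partial sums of the coefficients are coefficients at [b = 1], where the normalisation
       [n^(1-b)] is trivial. Expressing [y n^nu], with [n = p * S r], through the index [S i * S r]
       replaces [y] by [Y]. *)
    set (Y := y * Rpower (INR (S i) / INR p) (- nu)).
    apply is_lim_seq_ext with (fun r => Rpower (INR (S i * S r)) (1 - 1) *
      gsub nu 1 (Y * Rpower (INR (S i * S r)) nu) (S i * S r)).
    * intros r; assert (Hr : 0 < INR (S r)) by (apply lt_0_INR; lia).
      rewrite Rminus_diag, Rpower_O, Rmult_1_l by (apply lt_0_INR; lia).
      replace (Y * Rpower (INR (S i * S r)) nu) with (y * Rpower (INR (p * S r)) nu).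
      -- replace 1 with (0 + 1) at 1 by ring; rewrite <- gsub_convolution by lra.
         apply sum_eq; intros; rewrite gcoef_1; ring.
      -- unfold Y; rewrite <- Rpower_Rinv_l by exact H.
         rewrite Rmult_assoc, Rpower_mult_distr, !mult_INR
           by (try (apply Rinv_0_lt_compat, H); apply lt_0_INR; lia).
         do 2 f_equal; field; lra.
    * apply (is_lim_seq_subseq (fun n => Rpower (INR n) (1 - 1) * gsub nu 1 (Y * Rpower (INR n) nu) n)).
      -- apply filterlim_mul_S; lia.
      -- apply is_lim_gsub; lra.
- apply is_lim_seq_ext with (fun n => Rpower (INR n) (1 - (1 - 2 * nu)) *
    gsub nu (1 - 2 * nu) (y * Rpower (INR n) nu) n).
  + intros n; f_equal; unfold gconv.
    rewrite gsub_convolution by lra; f_equal; ring.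
  + apply is_lim_gsub; lra.
- lra.
- intros n k Hn Hnk Hkn.
  assert (Hk : 0 < INR k) by (apply lt_0_INR; lia).
  assert (Hn' : 0 < INR n) by (apply lt_0_INR; lia).
  assert (Hnk' : INR n <= 2 * INR k).
  { replace (2 * INR k) with (INR (2 * k)) by (rewrite mult_INR; simpl (INR 2); ring).
    apply le_INR, Hnk. }
  assert (H : Rpower (INR k) (1 - 0) * gsub nu 0 (y * Rpower (INR n) nu) k <= B0).
  { apply HB; [lia|split; [apply HL|]].
    replace (2 * y * Rpower (INR k) nu) with (y * (2 * Rpower (INR k) nu)) by ring.
    apply Rmult_le_compat_l; [lra|].
    apply Rle_trans with (Rpower (2 * INR k) nu); [apply Rle_Rpower_l; lra|].
    rewrite <- Rpower_mult_distr by lra; apply Rmult_le_compat_r; [apply Rpower_ge_0|].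
    rewrite <- (Rpower_1 2) at 2 by lra; apply Rle_Rpower; lra. }
  rewrite Rminus_0_r, Rpower_1 in H by exact Hk.
  pose proof (gsub_0_nonneg nu (y * Rpower (INR n) nu) k Hnu (HL n)); nra.
- intros t Ht; split; [|split].
  + apply is_derive_piecewise_pos; [lra|].
    apply is_derive_Wright_Rpower; lra.
  + apply continuous_stable_density; lra.
  + unfold stable_density; apply Rmult_le_pos.
    * apply Rmult_le_pos; [nra|apply Rpower_ge_0].
    * apply Mainardi_nonneg; [exact Hnu|left; apply HYpos].
- apply filterlim_squeeze_0 with (fun t => rgamma (1 + nu) / y * Rpower t nu); [typeclasses eauto| |].
  + apply filter_imp with (2 := filter_at_right_le 0 1 Rlt_0_1).
    intros t Ht; destruct (Rlt_dec 0 t); [|lra]; set (z := y * Rpower t (- nu)).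
    assert (Hz : 0 < z) by apply HYpos.
    split; [apply Wright_nonneg; lra|].
    pose proof (Wright_mul_le nu 1 z Hnu ltac:(lra) ltac:(lra)) as H.
    apply (Rmult_le_reg_l z); [exact Hz|]; apply Rle_trans with (1 := H); right.
    unfold z; rewrite Rpower_Ropp; field; split; [lra|apply Rgt_not_eq, Rpower_pos].
  + apply filterlim_scal_Rpower_0; lra.
- apply Rmult_le_pos; [apply Rmult_le_pos; [nra|lra]|lra].
- intros t Ht; unfold stable_density.
  assert (H1 : Rpower t (- nu - 1) <= 4).
  { apply Rle_trans with (Rpower (/ 2) (- nu - 1)); [apply Rpower_le_base_neg; lra|].
    rewrite Rpower_Rinv_l by lra; apply Rle_trans with (Rpower 2 (INR 2)); [apply Rle_Rpower; simpl; lra|].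
    rewrite Rpower_pow by lra; simpl; lra. }
  assert (H2 : Mainardi nu (y * Rpower t (- nu)) <= rgamma (1 - nu)).
  { unfold Mainardi; apply Wright_le_rgamma; [exact Hnu|lra|left; apply HYpos]. }
  assert (0 < nu * y) by (apply Rmult_lt_0_compat; lra).
  apply Rmult_le_compat; [|apply Mainardi_nonneg; [exact Hnu|left; apply HYpos]| |exact H2].
  + apply Rmult_le_pos; [lra|apply Rpower_ge_0].
  + apply Rmult_le_compat_l; lra.
Qed.

(** Substitution [tau = t u], with [(t - tau)^(-alpha) = t^(-alpha) (1 - u)^(-alpha)]. *)
Lemma is_caputo_of_unit_interval (alpha t v I : R) (phi dphi : R -> R) :
  0 < t -> (forall tau, 0 < tau -> is_derive phi tau (dphi tau)) ->
  is_RInt_gen (fun u => t * dphi (t * u) * Rpower (1 - u) (- alpha)) (at_right 0) (at_left 1) I ->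
  v * Gamma (1 - alpha) = Rpower t (- alpha) * I ->
  is_caputo alpha phi t v.
Proof.
intros Ht Hphi HI Hv; split.
- intros tau Htau; eexists; apply Hphi; lra.
- rewrite Hv.
  apply is_RInt_gen_ext with
    (2 := is_RInt_gen_scal _ (Rpower t (- alpha)) _ (is_RInt_gen_scale _ t I Ht HI)).
  exists (fun a => 0 < a <= t / 2) (fun b => t / 2 <= b < t).
  + apply filter_at_right_le; lra.
  + apply filter_at_left_ge; lra.
  + simpl; intros a b Ha Hb x Hx; rewrite Rmin_left, Rmax_right in Hx by lra.
    unfold scal; simpl; unfold mult; simpl; real_eq.
    rewrite (is_derive_unique _ _ _ (Hphi x ltac:(lra))).
    replace (t - x) with (t * (1 - x / t)) by (field; lra).
    rewrite <- Rpower_mult_distr.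
    * replace (t * (x / t)) with x by (field; lra); field; lra.
    * exact Ht.
    * apply (Rmult_lt_reg_r t); [exact Ht|].
      replace ((1 - x / t) * t) with (t - x) by (field; lra); lra.
Qed.

Lemma rpow_pos (t a : R) : 0 < t -> rpow t a = Rpower t a.
Proof. intros Ht; unfold rpow; destruct (Rlt_dec 0 t); [reflexivity|contradiction]. Qed.

Lemma is_derive_ext_pos (f g : R -> R) (x d : R) :
  0 < x -> (forall y, 0 < y -> f y = g y) -> is_derive f x d -> is_derive g x d.
Proof.
intros Hx Hfg H; apply is_derive_ext_loc with (2 := H).
apply (locally_interval _ x 0 p_infty); simpl; [exact Hx|exact Logic.I|].
intros y Hy _; apply Hfg, Hy.
Qed.

Lemma is_caputo_rpow (nu c t : R) :
  0 < nu < 1 / 2 -> 0 < t ->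
  is_caputo (2 * nu) (fun tau => c * rpow tau nu) t
    (c * (Gamma (1 + nu) / Gamma (1 - nu)) * Rpower t (- nu)).
Proof.
intros Hnu Ht.
assert (HG1 : 0 < Gamma (1 - nu)) by (apply Gamma_pos; lra).
apply (is_caputo_of_unit_interval _ _ _
  (c * nu * Rpower t nu * (Gamma nu * Gamma (1 - 2 * nu) / Gamma (nu + (1 - 2 * nu))))
  _ (fun tau => c * (nu * Rpower tau (nu - 1)))); [exact Ht| | |].
- intros tau Htau; apply is_derive_ext_pos with (fun tau => c * Rpower tau nu); [exact Htau| |].
  + intros y Hy; rewrite rpow_pos by exact Hy; reflexivity.
  + apply (is_derive_scal (fun t => Rpower t nu) tau c), is_derive_Rpower, Htau.
- pose proof (is_RInt_gen_Beta nu (1 - 2 * nu) ltac:(lra) ltac:(lra)) as H.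
  apply is_RInt_gen_ext with (2 := is_RInt_gen_scal _ (c * nu * Rpower t nu) _ H).
  exists (fun a => 0 < a <= 1) (fun b => 0 <= b < 1);
    [apply filter_at_right_le; lra|apply filter_at_left_ge; lra|].
  simpl; intros a b Ha Hb x Hx; unfold scal; simpl; unfold mult; simpl; real_eq.
  assert (Hx0 : 0 < x \/ x <= 0) by lra; destruct Hx0 as [Hx0|Hx0].
  + rewrite <- Rpower_mult_distr by assumption.
    replace (1 - 2 * nu - 1) with (- (2 * nu)) by ring.
    replace (Rpower t nu) with (t * Rpower t (nu - 1)).
    * ring.
    * rewrite <- (Rpower_1 t) at 1 by exact Ht; rewrite <- Rpower_plus; f_equal; ring.
  + exfalso; destruct Ha as [Ha _]; destruct (Rle_lt_dec a b) as [H1|H1].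
    * rewrite Rmin_left in Hx by exact H1; lra.
    * rewrite Rmin_right in Hx by lra; lra.
- replace (nu + (1 - 2 * nu)) with (1 - nu) by ring.
  rewrite (Rplus_comm 1 nu), Gamma_S by lra.
  replace (Rpower t (- nu)) with (Rpower t (- (2 * nu)) * Rpower t nu)
    by (rewrite <- Rpower_plus; f_equal; ring).
  field; lra.
Qed.

(** Self-similarity: [t * stable_density nu Y (t * u) = stable_density nu y u] for [y = Y t^(-nu)],
    which reduces the derivative at any time to [is_RInt_gen_Wright]. *)
Lemma is_caputo_Wright (nu A K x lam t : R) :
  0 < nu < 1 / 2 -> 0 < x -> 0 < lam -> 0 < t ->
  is_caputo (2 * nu)
    (fun tau => A - K * (1 - Wright (- (x / (lam * rpow tau nu))) (- nu) 1)) t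
    (K * Rpower t (- (2 * nu)) * Wright (- (x / (lam * rpow t nu))) (- nu) (1 - 2 * nu)).
Proof.
intros Hnu Hx Hlam Ht.
assert (E : forall tau, 0 < tau -> x / (lam * rpow tau nu) = x / lam * Rpower tau (- nu)).
{ intros tau Htau; rewrite rpow_pos, Rpower_Ropp by exact Htau.
  field; split; [apply Rgt_not_eq, Rpower_pos|lra]. }
rewrite (E t Ht); set (Y := x / lam) in *; assert (HY : 0 < Y) by (apply Rdiv_lt_0_compat; assumption).
set (y := Y * Rpower t (- nu)).
assert (Hy : 0 < y) by (apply Rmult_lt_0_compat; [exact HY|apply Rpower_pos]).
apply (is_caputo_of_unit_interval _ _ _ (K * (Gamma (1 - 2 * nu) * Wright (- y) (- nu) (1 - 2 * nu)))
  _ (fun tau => K * stable_density nu Y tau)); [exact Ht| | |].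
- intros tau Htau.
  apply is_derive_ext_pos with (fun tau => A - K * (1 - Wright (- (Y * Rpower tau (- nu))) (- nu) 1));
    [exact Htau| |].
  + intros z Hz; rewrite (E z Hz); reflexivity.
  + pose proof (is_derive_Wright_Rpower nu Y tau Hnu Htau) as H.
    apply is_derive_ext with (fun tau => plus (A - K) (scal K (Wright (- (Y * Rpower tau (- nu))) (- nu) 1))).
    * intros z; unfold plus, scal; simpl; unfold mult; simpl; real_eq; ring.
    * replace (K * stable_density nu Y tau) with (plus zero (scal K (stable_density nu Y tau)))
        by (unfold plus, zero, scal; simpl; unfold mult; simpl; ring).
      apply (is_derive_plus (V := R_NormedModule)); [apply (is_derive_const (V := R_NormedModule))|].
      apply (is_derive_scal (fun tau => Wright (- (Y * Rpower tau (- nu))) (- nu) 1)); exact H.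
- apply is_RInt_gen_ext with (2 := is_RInt_gen_scal _ K _ (is_RInt_gen_Wright nu y Hnu Hy)).
  exists (fun a => 0 < a <= 1) (fun b => 0 <= b < 1);
    [apply filter_at_right_le; lra|apply filter_at_left_ge; lra|].
  simpl; intros a b Ha Hb u Hu; unfold scal; simpl; unfold mult; simpl; real_eq.
  assert (Hu0 : 0 < u \/ u <= 0) by lra; destruct Hu0 as [Hu0|Hu0].
  + unfold stable_density; rewrite <- !Rpower_mult_distr by assumption.
    unfold y; rewrite !Rmult_assoc.
    replace (1 - 2 * nu - 1) with (- (2 * nu)) by ring.
    replace (Rpower t (- nu)) with (t * Rpower t (- nu - 1)) at 1.
    * ring.
    * rewrite <- (Rpower_1 t) at 1 by exact Ht; rewrite <- Rpower_plus; f_equal; ring.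
  + exfalso; destruct Ha as [Ha _]; destruct (Rle_lt_dec a b) as [H1|H1].
    * rewrite Rmin_left in Hu by exact H1; lra.
    * rewrite Rmin_right in Hu by lra; lra.
- ring.
Qed.

(** * The similarity solution *)

Lemma Wright_1_at_0 (nu : R) : Wright (- 0) (- nu) 1 = 1.
Proof. rewrite Ropp_0, Wright_0, rgamma_pos, Gamma_1 by lra; field. Qed.

Lemma one_minus_Wright_mvt (nu x y : R) :
  0 < nu < 1 / 2 -> x < y -> exists z, x < z < y /\
  (1 - Wright (- y) (- nu) 1) - (1 - Wright (- x) (- nu) 1) = (y - x) * Mainardi nu z.
Proof.
intros Hnu Hxy; destruct (Wright_opp_mvt nu 1 x y Hnu ltac:(lra) Hxy) as [z [Hz E]].
exists z; split; [exact Hz|unfold Mainardi; lra].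
Qed.

Lemma Mainardi_decreasing (nu x y : R) : 0 < nu < 1 / 2 -> 0 <= x <= y -> Mainardi nu y <= Mainardi nu x.
Proof. intros Hnu Hxy; unfold Mainardi; apply Wright_decreasing; [exact Hnu|lra|exact Hxy]. Qed.

Lemma one_minus_Wright_ge (nu x : R) :
  0 < nu < 1 / 2 -> 0 < x -> x * Mainardi nu x <= 1 - Wright (- x) (- nu) 1.
Proof.
intros Hnu Hx; destruct (one_minus_Wright_mvt nu 0 x Hnu Hx) as [z [Hz E]].
rewrite Wright_1_at_0 in E; pose proof (Mainardi_decreasing nu z x Hnu ltac:(lra)); nra.
Qed.

Lemma one_minus_Wright_pos (nu x : R) :
  0 < nu < 1 / 2 -> 0 < x -> 0 < 1 - Wright (- x) (- nu) 1.
Proof.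
intros Hnu Hx; pose proof (one_minus_Wright_ge nu x Hnu Hx).
pose proof (Mainardi_pos nu x Hnu ltac:(lra)).
assert (0 < x * Mainardi nu x) by (apply Rmult_lt_0_compat; assumption); lra.
Qed.

(* [(1 - W) / x] is the mean of the strictly decreasing [M] over [0, x]. *)
Lemma Mainardi_mean_strictly_decreasing (nu x y : R) :
  0 < nu < 1 / 2 -> 0 < x < y ->
  Mainardi nu y * (1 - Wright (- y) (- nu) 1) / y < Mainardi nu x * (1 - Wright (- x) (- nu) 1) / x.
Proof.
intros Hnu Hxy; destruct (one_minus_Wright_mvt nu x y Hnu ltac:(lra)) as [z [Hz E]].
pose proof (Mainardi_decreasing nu x z Hnu ltac:(lra)) as H1.
pose proof (Mainardi_strictly_decreasing nu x y Hnu ltac:(lra)) as H2.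
pose proof (one_minus_Wright_ge nu x Hnu ltac:(lra)) as H3.
pose proof (one_minus_Wright_pos nu x Hnu ltac:(lra)) as H4.
pose proof (Mainardi_pos nu y Hnu ltac:(lra)) as H5.
set (a := 1 - Wright (- x) (- nu) 1) in *; set (b := 1 - Wright (- y) (- nu) 1) in *.
(* The mean does not increase: the increment [b - a] is at most [(y - x) M(x)], and
   [x M(x) <= a]. *)
assert (H6 : x * b <= y * a).
{ assert (x * (b - a) <= (y - x) * (x * Mainardi nu x)).
  { rewrite E; apply Rle_trans with (x * ((y - x) * Mainardi nu x)); [|lra].
    apply Rmult_le_compat_l; [lra|]; apply Rmult_le_compat_l; lra. }
  assert ((y - x) * (x * Mainardi nu x) <= (y - x) * a) by (apply Rmult_le_compat_l; lra).
  lra. }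
apply (Rmult_lt_reg_r (x * y)); [apply Rmult_lt_0_compat; lra|].
replace (Mainardi nu y * b / y * (x * y)) with (Mainardi nu y * (x * b)) by (field; lra).
replace (Mainardi nu x * a / x * (x * y)) with (Mainardi nu x * (y * a)) by (field; lra).
apply Rle_lt_trans with (Mainardi nu y * (y * a)); [apply Rmult_le_compat_l; lra|].
apply Rmult_lt_compat_r; [apply Rmult_lt_0_compat; lra|exact H2].
Qed.

Lemma Mainardi_at_0 (nu : R) : 0 < nu < 1 / 2 -> Mainardi nu 0 = / Gamma (1 - nu).
Proof. intros Hnu; unfold Mainardi; rewrite Ropp_0, Wright_0, rgamma_pos by lra; reflexivity. Qed.

(** The equation is multiplied by [x], so that the intermediate value theorem applies to the
    continuous [G]. Near [0], [G x >= x (M(x)^2 - A) > 0] by continuity of [M] and [A < M(0)^2]; at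
    [x1], [G x1 <= M(0) - A x1 < 0]. *)
Lemma Mainardi_mean_root (nu A : R) :
  0 < nu < 1 / 2 -> 0 < A -> A < (/ Gamma (1 - nu)) ^ 2 ->
  exists x, 0 < x /\ Mainardi nu x * (1 - Wright (- x) (- nu) 1) / x = A.
Proof.
intros Hnu HA HA2.
set (G := fun x => Mainardi nu x * (1 - Wright (- x) (- nu) 1) - A * x).
assert (HMc : forall x, continuous (Mainardi nu) x)
  by (intros x; apply (continuous_Wright_opp nu (1 - nu)); lra).
assert (HG : forall x, continuous G x).
{ intros x; apply (continuous_minus (V := R_NormedModule)).
  - apply (continuous_mult (K := R_AbsRing)); [apply HMc|].
    apply (continuous_minus (V := R_NormedModule)); [apply continuous_const|].
    apply continuous_Wright_opp; lra.
  - apply (continuous_mult (K := R_AbsRing)); [apply continuous_const|apply continuous_id]. }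
assert (Hsmall : exists x0, 0 < x0 /\ 0 < G x0).
{ assert (H : locally 0 (fun x => A < Mainardi nu x * Mainardi nu x)).
  { apply (continuous_mult (K := R_AbsRing) _ _ 0 (HMc 0) (HMc 0) (fun y => A < y)).
    apply (locally_interval _ _ A p_infty); simpl; [|exact Logic.I|intros y Hy _; exact Hy].
    unfold mult; simpl; rewrite Mainardi_at_0 by exact Hnu; simpl in HA2; lra. }
  destruct H as [eps He]; pose proof (cond_pos eps).
  exists (eps / 2); split; [lra|].
  specialize (He (eps / 2)); simpl in He.
  assert (H1 : A < Mainardi nu (eps / 2) * Mainardi nu (eps / 2)).
  { apply He; change (Rabs (eps / 2 - 0) < eps); rewrite Rabs_pos_eq; lra. }
  pose proof (one_minus_Wright_ge nu (eps / 2) Hnu ltac:(lra)) as H2.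
  pose proof (Mainardi_pos nu (eps / 2) Hnu ltac:(lra)) as H3.
  unfold G; apply Rlt_le_trans with (Mainardi nu (eps / 2) * (eps / 2 * Mainardi nu (eps / 2)) - A * (eps / 2)).
  - replace (Mainardi nu (eps / 2) * (eps / 2 * Mainardi nu (eps / 2)) - A * (eps / 2))
      with (eps / 2 * (Mainardi nu (eps / 2) * Mainardi nu (eps / 2) - A)) by ring.
    apply Rmult_lt_0_compat; lra.
  - apply Rplus_le_compat_r, Rmult_le_compat_l; lra. }
destruct Hsmall as [x0 [Hx0 HG0]].
set (x1 := x0 + Mainardi nu 0 / A + 1).
pose proof (Mainardi_pos nu 0 Hnu (Rle_refl 0)) as HM0.
assert (Hq : 0 < Mainardi nu 0 / A) by (apply Rdiv_lt_0_compat; assumption).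
assert (Hx1 : x0 < x1) by (unfold x1; lra).
assert (HG1 : G x1 <= 0).
{ unfold G.
  pose proof (Mainardi_decreasing nu 0 x1 Hnu ltac:(lra)) as H1.
  pose proof (Mainardi_pos nu x1 Hnu ltac:(lra)) as H2.
  pose proof (one_minus_Wright_pos nu x1 Hnu ltac:(lra)) as H3.
  pose proof (Wright_nonneg nu 1 x1 Hnu ltac:(lra) ltac:(lra)) as H4.
  assert (Mainardi nu x1 * (1 - Wright (- x1) (- nu) 1) <= Mainardi nu 0 * 1)
    by (apply Rmult_le_compat; lra).
  assert (A * x1 = A * x0 + Mainardi nu 0 + A) by (unfold x1; field; lra).
  assert (0 < A * x0) by (apply Rmult_lt_0_compat; assumption); lra. }
destruct (IVT_gen G x0 x1 0) as [x [Hx Gx]].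
- intros x; apply continuity_pt_filterlim, HG.
- rewrite Rmin_right, Rmax_left by lra; lra.
- rewrite Rmin_left, Rmax_right in Hx by lra.
  exists x; split; [lra|]; unfold G in Gx.
  replace (Mainardi nu x * (1 - Wright (- x) (- nu) 1)) with (A * x) by lra; field; lra.
Qed.

Lemma is_derive_profile (nu A K L z : R) :
  0 < nu < 1 / 2 -> 0 < L ->
  is_derive (fun z => A - K * (1 - Wright (- (z / L)) (- nu) 1)) z (- (K / L) * Mainardi nu (z / L)).
Proof.
intros Hnu HL.
pose proof (is_derive_Wright_opp nu 1 (z / L) Hnu ltac:(lra)) as H.
assert (Hin : is_derive (fun z => z / L) z (/ L)) by (auto_derive; [exact Logic.I|field; lra]).
pose proof (is_derive_comp (fun y => Wright (- y) (- nu) 1) (fun z => z / L) z _ _ H Hin) as H2.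
apply is_derive_ext with (fun z => plus (A - K) (scal K (Wright (- (z / L)) (- nu) 1))).
- intros y; unfold plus, scal; simpl; unfold mult; simpl; real_eq; ring.
- replace (- (K / L) * Mainardi nu (z / L)) with
    (plus zero (scal K (scal (/ L) (- Wright (- (z / L)) (- nu) (1 - nu)))))
    by (unfold Mainardi, plus, zero, scal; simpl; unfold mult; simpl; field; lra).
  apply (is_derive_plus (V := R_NormedModule)); [apply (is_derive_const (V := R_NormedModule))|].
  apply (is_derive_scal (fun z => Wright (- (z / L)) (- nu) 1)); exact H2.
Qed.

Lemma is_derive_Derive_profile (nu A K L z : R) :
  0 < nu < 1 / 2 -> 0 < L ->
  is_derive (fun y => Derive (fun z => A - K * (1 - Wright (- (z / L)) (- nu) 1)) y) z
    (K / L ^ 2 * Wright (- (z / L)) (- nu) (1 - 2 * nu)).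
Proof.
intros Hnu HL.
apply is_derive_ext with (fun y => scal (- (K / L)) (Mainardi nu (y / L))).
- intros y; symmetry; apply is_derive_unique, is_derive_profile; assumption.
- pose proof (is_derive_Wright_opp nu (1 - nu) (z / L) Hnu ltac:(lra)) as H.
  assert (Hin : is_derive (fun z => z / L) z (/ L)) by (auto_derive; [exact Logic.I|field; lra]).
  pose proof (is_derive_comp (fun y => Wright (- y) (- nu) (1 - nu)) (fun z => z / L) z _ _ H Hin) as H2.
  replace (K / L ^ 2 * Wright (- (z / L)) (- nu) (1 - 2 * nu)) with
    (scal (- (K / L)) (scal (/ L) (- Wright (- (z / L)) (- nu) (1 - nu - nu)))).
  + apply (is_derive_scal (fun y => Mainardi nu (y / L))); exact H2.
  + replace (1 - nu - nu) with (1 - 2 * nu) by ring.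
    unfold scal; simpl; unfold mult; simpl; field; lra.
Qed.

Lemma temp_ext_right (T : R -> R -> R) (s : R -> R) (Tm x t : R) : s t <= x -> temp_ext T s Tm x t = Tm.
Proof. intros H; unfold temp_ext; destruct (Rlt_dec x (s t)); [lra|reflexivity]. Qed.

(* [HS] is the Stefan condition solved for [lam ^ 2], [HE] the equation for [xi]. *)
Lemma similarity_stefan_solution (nu k rho c l Tm T0 q0 xi lam : R) :
  0 < nu < 1 / 2 -> 0 < k -> 0 < rho -> 0 < c -> 0 < l -> Tm < T0 -> 0 < q0 -> 0 < xi -> 0 < lam ->
  lam ^ 2 = k / (rho * c) ->
  lam ^ 2 = k * (T0 - Tm) * Gamma (1 - nu) / (rho * l * Gamma (1 + nu))
    * (Mainardi nu xi / (xi * (1 - Wright (- xi) (- nu) 1))) ->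
  (1 - Wright (- xi) (- nu) 1) / xi =
    k * rho * l * (T0 - Tm) * Gamma (1 + nu) / (q0 ^ 2 * Gamma (1 - nu) ^ 3) * / Mainardi nu xi ->
  stefan_solution (2 * nu) k rho c l Tm T0 q0
    (fun x t => T0 - (T0 - Tm) / (1 - Wright (- xi) (- nu) 1)
       * (1 - Wright (- (x / (lam * rpow t nu))) (- nu) 1))
    (fun t => lam * xi * rpow t nu).
Proof.
intros Hnu Hk Hrho Hc Hl HT Hq Hxi Hlam Hlam2 HS HE.
pose proof (one_minus_Wright_pos nu xi Hnu Hxi) as HW.
pose proof (Mainardi_pos nu xi Hnu ltac:(lra)) as HM.
assert (HG1 : 0 < Gamma (1 - nu)) by (apply Gamma_pos; lra).
assert (HG2 : 0 < Gamma (1 + nu)) by (apply Gamma_pos; lra).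
set (K := (T0 - Tm) / (1 - Wright (- xi) (- nu) 1)) in *.
assert (HK : 0 < K) by (apply Rdiv_lt_0_compat; lra).
assert (HL : forall t, 0 < t -> 0 < lam * rpow t nu).
{ intros t Ht; rewrite rpow_pos by exact Ht; apply Rmult_lt_0_compat; [exact Hlam|apply Rpower_pos]. }
assert (Hxi_t : forall t, 0 < t -> lam * xi * rpow t nu / (lam * rpow t nu) = xi).
{ intros t Ht; pose proof (HL t Ht) as H; rewrite rpow_pos in * by exact Ht.
  pose proof (Rpower_pos t nu); field; lra. }
assert (HKW : K * (1 - Wright (- xi) (- nu) 1) = T0 - Tm) by (unfold K; field; lra).
unfold stefan_solution; replace (2 * nu / 2) with nu by field.
repeat split.
- intros y _; eexists; apply is_derive_profile; auto.
- exists (K / (lam * rpow t nu) ^ 2 * Wright (- (x / (lam * rpow t nu))) (- nu) (1 - 2 * nu)); split.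
  + apply is_derive_Derive_profile; auto.
  + rewrite <- Hlam2.
    replace (lam ^ 2 * (K / (lam * rpow t nu) ^ 2 * Wright (- (x / (lam * rpow t nu))) (- nu) (1 - 2 * nu)))
      with (K * Rpower t (- (2 * nu)) * Wright (- (x / (lam * rpow t nu))) (- nu) (1 - 2 * nu)).
    * apply is_caputo_Wright; tauto.
    * assert (E : Rpower t (- (2 * nu)) = / rpow t nu ^ 2).
      { rewrite rpow_pos by assumption; rewrite Rpower_Ropp; f_equal.
        replace (2 * nu) with (nu + nu) by ring; rewrite Rpower_plus; ring. }
      rewrite E; field; split; [|lra].
      rewrite rpow_pos by assumption; apply Rgt_not_eq, Rpower_pos.
- unfold rpow; destruct (Rlt_dec 0 0); [lra|ring].
- intros x Hx; apply temp_ext_right; unfold rpow; destruct (Rlt_dec 0 0); lra.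
- intros t Ht.
  apply (is_lim_ext_loc (fun _ => Tm)); [|apply is_lim_const].
  exists (lam * xi * rpow t nu); intros x Hx; symmetry; apply temp_ext_right; lra.
- intros t Ht; rewrite Hxi_t by exact Ht; lra.
- intros t Ht; pose proof (HL t Ht) as HLt.
  exists (- (K / (lam * rpow t nu)) * Mainardi nu (lam * xi * rpow t nu / (lam * rpow t nu))),
    (lam * xi * (Gamma (1 + nu) / Gamma (1 - nu)) * Rpower t (- nu)).
  split; [apply is_derive_profile; auto|split; [apply is_caputo_rpow; assumption|]].
  rewrite Hxi_t by exact Ht; rewrite Rpower_Ropp, rpow_pos in * by exact Ht.
  pose proof (Rpower_pos t nu) as Hp; set (P := Rpower t nu) in *.
  (* After multiplication by [lam * P] only [lam ^ 2] occurs, and [HS] applies. *)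
  apply (Rmult_eq_reg_r (lam * P)); [|lra].
  replace (- k * (- (K / (lam * P)) * Mainardi nu xi) * (lam * P)) with (k * K * Mainardi nu xi)
    by (field; lra).
  replace (rho * l * (lam * xi * (Gamma (1 + nu) / Gamma (1 - nu)) * / P) * (lam * P))
    with (lam ^ 2 * (rho * l * xi * (Gamma (1 + nu) / Gamma (1 - nu)))) by (field; lra).
  rewrite HS; unfold K; field; repeat split; lra.
- intros t Ht; replace (0 / (lam * rpow t nu)) with 0 by (unfold Rdiv; ring); rewrite Wright_1_at_0; ring.
- intros t Ht; pose proof (HL t Ht) as HLt.
  exists (- (K / (lam * rpow t nu)) * Mainardi nu (0 / (lam * rpow t nu))).
  split; [apply is_derive_profile; auto|].
  replace (0 / (lam * rpow t nu)) with 0 by (unfold Rdiv; ring).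
  rewrite Mainardi_at_0 by exact Hnu.
  rewrite rpow_pos in * by exact Ht.
  pose proof (Rpower_pos t nu) as Hp; set (P := Rpower t nu) in *.
  (* The flux condition at [x = 0] amounts to [k K = q0 Gamma (1 - nu) lam]. As [HS] gives only
     [lam ^ 2], the squares are compared, which is the equation for [xi]; positivity of both sides
     then removes the squares. *)
  assert (Hsq : (k * K) ^ 2 = (q0 * Gamma (1 - nu) * lam) ^ 2).
  { rewrite !Rpow_mult_distr, HS.
    set (W := 1 - Wright (- xi) (- nu) 1) in *.
    assert (HE' : W * (q0 ^ 2 * Gamma (1 - nu) ^ 3) * Mainardi nu xi =
      xi * (k * rho * l * (T0 - Tm) * Gamma (1 + nu))).
    { apply (f_equal (fun z => z * (xi * (q0 ^ 2 * Gamma (1 - nu) ^ 3) * Mainardi nu xi))) in HE.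
      replace (W / xi * (xi * (q0 ^ 2 * Gamma (1 - nu) ^ 3) * Mainardi nu xi))
        with (W * (q0 ^ 2 * Gamma (1 - nu) ^ 3) * Mainardi nu xi) in HE by (field; lra).
      rewrite HE; field; repeat split; lra. }
    unfold K.
    apply (Rmult_eq_reg_r (W ^ 2 * (xi * (rho * l * Gamma (1 + nu))))).
    - transitivity (k * (T0 - Tm) * (xi * (k * rho * l * (T0 - Tm) * Gamma (1 + nu)))).
      + field; lra.
      + rewrite <- HE'; field; repeat split; lra.
    - apply Rgt_not_eq, Rmult_lt_0_compat; [apply pow_lt, HW|].
      apply Rmult_lt_0_compat; [exact Hxi|]; apply Rmult_lt_0_compat; [|exact HG2].
      apply Rmult_lt_0_compat; assumption. }
  assert (Hroot : k * K = q0 * Gamma (1 - nu) * lam).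
  { assert (0 < k * K) by (apply Rmult_lt_0_compat; assumption).
    assert (0 < q0 * Gamma (1 - nu) * lam) by (apply Rmult_lt_0_compat; [apply Rmult_lt_0_compat|]; assumption).
    apply Rsqr_inj; [lra|lra|]; rewrite !Rsqr_pow2; exact Hsq. }
  replace (k * (- (K / (lam * P)) * / Gamma (1 - nu))) with (- (k * K) / (lam * P * Gamma (1 - nu)))
    by (field; lra).
  rewrite Hroot; field; lra.
Qed.

Theorem theorem2 :
  forall alpha k rho l Tm T0 q0 : R,
    0 < alpha < 1 -> 0 < k -> 0 < rho -> 0 < l -> Tm < T0 -> 0 < q0 ->
    k * rho * l * (T0 - Tm) * Gamma (1 + alpha / 2)
      / (q0 ^ 2 * Gamma (1 - alpha / 2)) < 1 ->
    let E := fun x : R =>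
      (1 - Wright (- x) (- (alpha / 2)) 1) / x =
      k * rho * l * (T0 - Tm) * Gamma (1 + alpha / 2)
        / (q0 ^ 2 * Gamma (1 - alpha / 2) ^ 3) * / Mainardi (alpha / 2) x in
    exists xi : R,
      0 < xi /\ E xi /\ (forall y : R, 0 < y -> E y -> y = xi) /\
      let c := l * Gamma (1 + alpha / 2) / ((T0 - Tm) * Gamma (1 - alpha / 2))
               * (xi / Mainardi (alpha / 2) xi)
               * (1 - Wright (- xi) (- (alpha / 2)) 1) in
      let lam := sqrt (k / (rho * c)) in
      0 < c /\
      lam ^ 2 = k * (T0 - Tm) * Gamma (1 - alpha / 2)
                / (rho * l * Gamma (1 + alpha / 2))
                * (Mainardi (alpha / 2) xi
                   / (xi * (1 - Wright (- xi) (- (alpha / 2)) 1))) /\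
      stefan_solution alpha k rho c l Tm T0 q0
        (fun x t => T0 - (T0 - Tm) / (1 - Wright (- xi) (- (alpha / 2)) 1)
                         * (1 - Wright (- (x / (lam * rpow t (alpha / 2))))
                                       (- (alpha / 2)) 1))
        (fun t => lam * xi * rpow t (alpha / 2)).
Proof.
intros alpha k rho l Tm T0 q0 Halpha Hk Hrho Hl HT Hq.
replace alpha with (2 * (alpha / 2)) by field; set (nu := alpha / 2).
replace (2 * nu / 2) with nu by field.
assert (Hnu : 0 < nu < 1 / 2) by (unfold nu; lra); clearbody nu; clear Halpha.
intros Hlt E.
assert (HG1 : 0 < Gamma (1 - nu)) by (apply Gamma_pos; lra).
assert (HG2 : 0 < Gamma (1 + nu)) by (apply Gamma_pos; lra).
assert (HT' : 0 < T0 - Tm) by lra.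
set (A := k * rho * l * (T0 - Tm) * Gamma (1 + nu) / (q0 ^ 2 * Gamma (1 - nu) ^ 3)) in *.
assert (Hq2 : 0 < q0 ^ 2) by (apply pow_lt, Hq).
assert (HA : 0 < A).
{ apply Rdiv_lt_0_compat; repeat apply Rmult_lt_0_compat; try assumption; lra. }
(* The smallness hypothesis is exactly [A < M(0)^2]: [A] lies below the limit at [0] of the
   decreasing function whose level is sought. *)
assert (HA2 : A < (/ Gamma (1 - nu)) ^ 2).
{ replace A with (k * rho * l * (T0 - Tm) * Gamma (1 + nu) / (q0 ^ 2 * Gamma (1 - nu)) * (/ Gamma (1 - nu)) ^ 2)
    by (unfold A; field; lra).
  rewrite <- (Rmult_1_l ((/ Gamma (1 - nu)) ^ 2)) at 2.
  apply Rmult_lt_compat_r; [apply pow_lt, Rinv_0_lt_compat, HG1|exact Hlt]. }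
assert (HE : forall x, 0 < x -> E x <-> Mainardi nu x * (1 - Wright (- x) (- nu) 1) / x = A).
{ intros x Hx; pose proof (Mainardi_pos nu x Hnu ltac:(lra)) as HM; unfold E; split; intros H.
  - unfold Rdiv in *; rewrite Rmult_assoc, H; field; lra.
  - rewrite <- H; field; lra. }
destruct (Mainardi_mean_root nu A Hnu HA HA2) as [xi [Hxi Exi]].
pose proof (Mainardi_pos nu xi Hnu ltac:(lra)) as HM.
pose proof (one_minus_Wright_pos nu xi Hnu Hxi) as HW.
exists xi; split; [exact Hxi|split; [apply HE; assumption|split]].
- intros y Hy Ey; apply HE in Ey; [|exact Hy].
  destruct (Rtotal_order y xi) as [H|[H|H]]; [|exact H|].
  + pose proof (Mainardi_mean_strictly_decreasing nu y xi Hnu ltac:(lra)); lra.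
  + pose proof (Mainardi_mean_strictly_decreasing nu xi y Hnu ltac:(lra)); lra.
- intros c lam.
  assert (Hc : 0 < c).
  { unfold c; repeat apply Rmult_lt_0_compat; try assumption.
    - apply Rinv_0_lt_compat, Rmult_lt_0_compat; assumption.
    - apply Rinv_0_lt_compat, HM. }
  assert (Hkc : 0 < k / (rho * c))
    by (apply Rdiv_lt_0_compat; [exact Hk|apply Rmult_lt_0_compat; assumption]).
  assert (Hlam : 0 < lam) by (apply sqrt_lt_R0, Hkc).
  assert (Hlam2 : lam ^ 2 = k / (rho * c)) by (apply pow2_sqrt; lra).
  assert (HS : lam ^ 2 = k * (T0 - Tm) * Gamma (1 - nu) / (rho * l * Gamma (1 + nu))
     * (Mainardi nu xi / (xi * (1 - Wright (- xi) (- nu) 1)))).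
  { rewrite Hlam2; unfold c; field; repeat split; lra. }
  split; [exact Hc|split; [exact HS|]].
  apply similarity_stefan_solution; try assumption.
  apply HE; assumption.
Qed.
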